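(* Let $C \subset \{xy = 0\} \subset \mathbb{P}^3$ be a curve that is not arithmetically Cohen-Macaulay, with homogeneous ideal $$I_C = \left(xy,\ x^2A + xhF,\ y^2B + yhG,\ xAG + yBF + hFG\right),$$ where $h, F, G \in K[z,t]$, $F, G \notin K$, $A \in K[x,z,t]$, $B \in K[y,z,t]$ are homogeneous polynomials, and $AB \neq 0$ in case $h = 0$. Let $d_F, d_G, d_h$ be the degrees of $F, G, h$, respectively, and let $d = 2d_h + d_F + d_G$ be the degree of $C$. Then the Hartshorne-Rao module of $C$ is $$M_C = \bigoplus_{j\in\mathbb{Z}} H^1(\mathbb{P}^3, \mathscr{I}_C(j)) \cong \left(R/(x,y,F,G)\right)(-d_h).$$ It is self-dual, and $M_C^{\vee} \cong M_C(d-2)$.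
   Context: $K$ is an algebraically closed field, $\mathbb{P}^3 = \mathbb{P}^3_K$, $R = K[x,y,z,t]$ its homogeneous coordinate ring. A curve is a pure one-dimensional locally Cohen-Macaulay closed subscheme of $\mathbb{P}^3$; $I_C$ is its saturated homogeneous ideal and $\mathscr{I}_C$ its ideal sheaf. $C$ is arithmetically Cohen-Macaulay if $R/I_C$ is Cohen-Macaulay. $M^{\vee}$ denotes the graded $K$-dual of a graded $R$-module $M$. All displayed generators are assumed homogeneous. If $h = 0$, then $d_h$ denotes the formal degree forced by homogeneity, i.e. $d_h = \deg A + 1 - d_F = \deg B + 1 - d_G$ (possibly negative). *)

(* Defs.v *)
From HB Require Import structures.
From mathcomp Require Import all_boot all_order all_algebra.
From mathcomp Require Import fraction generic_quotient ring_quotient.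
From mathcomp Require Import boolp classical_sets functions.
From mathcomp Require Import mpoly ring.

Set Implicit Arguments.
Unset Strict Implicit.
Unset Printing Implicit Defensive.

Import GRing.Theory.

Local Open Scope classical_set_scope.
Local Open Scope ring_scope.
Local Open Scope quotient_scope.

(** Quotients of rings are handled through pairs [(S, J)], standing for [S/J]:
    [S] is (the carrier of) a subring of a commutative ring [T] and [J] is an
    ideal of [S].  The primes of [S/J] are the primes of [S] containing [J]. *)
#[local] Obligation Tactic := idtac.

Section CommutativeAlgebra.
Variable T : comPzRingType.
Implicit Types (S J P : set T) (s : seq T).

Definition ideal_in S J : Prop :=
  [/\ J `<=` S, J 0,
      forall u v, J u -> J v -> J (u + v) &
      forall a u, S a -> J u -> J (a * u)].

Definition prime_in S P : Prop :=
  [/\ ideal_in S P, ~ P 1 &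
      forall a b, S a -> S b -> P (a * b) -> P a \/ P b].

Definition has_chain (Q : set (set T)) (n : nat) : Prop :=
  exists c : nat -> set T,
    (forall i, (i <= n)%N -> Q (c i)) /\
    (forall i, (i < n)%N -> c i `<` c i.+1).

(* [n] is the supremum of the lengths of the chains in [Q]. *)
Definition chain_dim (Q : set (set T)) (n : nat) : Prop :=
  has_chain Q n /\ ~ has_chain Q n.+1.

Definition krull_dim S J (n : nat) : Prop :=
  chain_dim [set P | prime_in S P /\ J `<=` P] n.

(* J + s_0 S + ... + s_(n-1) S *)
Definition add_gens S J s : set T :=
  [set u | exists (v : T) (c : nat -> T),
     [/\ J v, forall i, S (c i) & u = v + \sum_(i < size s) c i * s`_i]].

Definition regular_sequence S J s : Prop :=
  [/\ forall i, (i < size s)%N -> S s`_i,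
      forall i u, (i < size s)%N -> S u ->
        add_gens S J (take i s) (s`_i * u) -> add_gens S J (take i s) u &
      ~ add_gens S J s 1].

Definition nonunits S : set T :=
  [set a | S a /\ ~ (exists2 b, S b & a * b = 1)].

Definition has_depth S J (n : nat) : Prop :=
  (exists s, [/\ size s = n, forall a, a \in s -> nonunits S a
                 & regular_sequence S J s]) /\
  ~ (exists s, [/\ size s = n.+1, forall a, a \in s -> nonunits S a
                 & regular_sequence S J s]).

(* For [S] local (and noetherian), with maximal ideal [nonunits S]. *)
Definition local_CM S J : Prop :=
  exists n, krull_dim S J n /\ has_depth S J n.

Record ideal := Ideal {
  ideal_set :> set T;
  idealP : ideal_in [set: T] ideal_set }.

Lemma gen_ideal_subproof s : ideal_in [set: T]
  [set u | exists c : nat -> T, u = \sum_(i < size s) c i * s`_i].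
Proof.
split=> //.
- by exists (fun=> 0); rewrite big1 // => i _; rewrite mul0r.
- move=> _ _ [c ->] [c' ->]; exists (fun i => c i + c' i).
  by rewrite -big_split; apply: eq_bigr => i _; rewrite /= mulrDl.
- move=> a _ _ [c ->]; exists (fun i => a * c i).
  by rewrite mulr_sumr; apply: eq_bigr => i _; rewrite mulrA.
Qed.

Definition gen_ideal s : ideal := Ideal (gen_ideal_subproof s).

End CommutativeAlgebra.

Section Subquotient.
Variables (K : fieldType) (V : lmodType K) (Z B : submodClosed V).

Record subspace := Subspace { subspace_val :> V; _ : subspace_val \in Z }.
HB.instance Definition _ := [isSub for subspace_val].
HB.instance Definition _ := [Choice of subspace by <:].
HB.instance Definition _ := [SubChoice_isSubLmodule of subspace by <:].

Lemma subspace_valP a (u v : subspace) :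
  val (a *: u + v) = a *: val u + val v.
Proof. exact: linearP. Qed.

Definition subspace_in : {pred subspace} := [pred z | val z \in B].
Lemma subspace_in_submod : submod_closed subspace_in.
Proof.
split=> [|a u v]; rewrite !inE; first by rewrite raddf0 rpred0.
by move=> hu hv; rewrite linearP rpredD ?rpredZ.
Qed.
HB.instance Definition _ :=
  GRing.isSubmodClosed.Build K subspace subspace_in subspace_in_submod.

(* Z / (Z :&: B) *)
Definition subquot : Type := {ideal_quot subspace_in}.
HB.instance Definition _ := GRing.Zmodule.on subquot.
HB.instance Definition _ := EqQuotient.on subquot.

Definition subquot_scale (c : K) (m : subquot) : subquot :=
  \pi_subquot (c *: (repr m)).

Lemma subquot_eqP (u v : subspace) :
  reflect (\pi_subquot u = \pi_subquot v) (val u - val v \in B).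
Proof.
have -> : (val u - val v \in B) = (u - v \in subspace_in).
  by rewrite inE raddfB.
rewrite Quotient.idealrBE; exact: eqP.
Qed.

Lemma pi_subquot_scale c u :
  subquot_scale c (\pi_subquot u) = \pi_subquot (c *: u).
Proof.
apply/eqP; rewrite -Quotient.idealrBE -scalerBr rpredZ //.
by rewrite Quotient.idealrBE reprK.
Qed.

Lemma pi_subquotD (u v : subspace) :
  \pi_subquot (u + v) = \pi_subquot u + \pi_subquot v.
Proof. exact: Quotient.pi_add. Qed.

Fact subquot_scaleA a b v :
  subquot_scale a (subquot_scale b v) = subquot_scale (a * b) v.
Proof. by rewrite -[v]reprK (pi_subquot_scale b) !pi_subquot_scale scalerA. Qed.
Fact subquot_scale1 : left_id 1 subquot_scale.
Proof. by move=> v; rewrite -[v]reprK !pi_subquot_scale scale1r. Qed.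
Fact subquot_scaleDr : right_distributive subquot_scale +%R.
Proof.
move=> a u v; rewrite -[u]reprK -[v]reprK.
by rewrite -pi_subquotD !pi_subquot_scale -pi_subquotD scalerDr.
Qed.
Fact subquot_scaleDl v : {morph subquot_scale^~ v : a b / a + b}.
Proof.
move=> a b; rewrite -[v]reprK.
by rewrite !pi_subquot_scale -pi_subquotD scalerDl.
Qed.
HB.instance Definition _ := GRing.Zmodule_isLmodule.Build K subquot
  subquot_scaleA subquot_scale1 subquot_scaleDr subquot_scaleDl.

(* The class of [v] if [v \in Z]; [0] otherwise. *)
Definition subquot_class (v : V) : subquot := \pi_subquot (insubd 0 v).

Let insubspaceK v : v \in Z -> val (insubd (0 : subspace) v) = v.
Proof. exact: insubdK. Qed.

(* A vector of [Z] in the class [m]. *)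
Definition subquot_repr (m : subquot) : V := val (repr m).

Lemma subquot_reprP m : subquot_repr m \in Z.
Proof. exact: valP. Qed.

Lemma subquot_reprK m : subquot_class (subquot_repr m) = m.
Proof. by rewrite /subquot_class /subquot_repr valKd reprK. Qed.

Lemma subquot_classE u v : u \in Z -> v \in Z ->
  (subquot_class u = subquot_class v) <-> (u - v \in B).
Proof.
move=> hu hv; rewrite -{2}(insubspaceK hu) -{2}(insubspaceK hv).
by split=> /subquot_eqP.
Qed.

Lemma subquot_classP a u v : u \in Z -> v \in Z ->
  subquot_class (a *: u + v) = a *: subquot_class u + subquot_class v.
Proof.
move=> hu hv; rewrite /subquot_class.
have -> : insubd 0 (a *: u + v) = a *: insubd 0 u + insubd 0 v :> subspace.
  by apply: val_inj; rewrite subspace_valP !insubspaceK ?rpredD ?rpredZ.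
by rewrite pi_subquotD -pi_subquot_scale.
Qed.

Lemma subquot_repr_class v : v \in Z ->
  subquot_repr (subquot_class v) - v \in B.
Proof.
by move=> hv; apply/(subquot_classE (subquot_reprP _) hv); rewrite subquot_reprK.
Qed.

End Subquotient.

Section DualSpace.
Variables (K : fieldType) (V : lmodType K).

Definition linear_form : {pred V -> K^o} := [pred f | `[< linear f >]].
Lemma linear_formP f : reflect (linear f) (f \in linear_form).
Proof. by rewrite inE; exact: asboolP. Qed.

Lemma linear_form_submod : submod_closed linear_form.
Proof.
split=> [|a f g]; first by apply/linear_formP => c u v; rewrite scaler0 addr0.
move=> /linear_formP hf /linear_formP hg; apply/linear_formP => c u v.
rewrite -[LHS]/(a *: f (c *: u + v) + g (c *: u + v)) hf hg.
rewrite -[RHS]/(c *: (a *: f u + g u) + (a *: f v + g v)).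
rewrite !scalerDr !scalerA [a * c]mulrC -!addrA; congr (_ + _).
by rewrite addrCA.
Qed.
HB.instance Definition _ :=
  GRing.isSubmodClosed.Build K (V -> K^o) linear_form linear_form_submod.

Record dual_space :=
  DualSpace { dual_val :> V -> K^o; _ : dual_val \in linear_form }.
HB.instance Definition _ := [isSub for dual_val].
HB.instance Definition _ := [Choice of dual_space by <:].
HB.instance Definition _ := [SubChoice_isSubLmodule of dual_space by <:].

Lemma dual_valP a (f g : dual_space) :
  dual_val (a *: f + g) = a *: dual_val f + dual_val g.
Proof. by []. Qed.

Lemma dual_ext (f g : dual_space) : dual_val f = dual_val g -> f = g.
Proof. exact: val_inj. Qed.

Lemma dual_linear (f : dual_space) : linear f.
Proof. by apply/linear_formP; case: f. Qed.

Definition has_dim (n : nat) : Prop :=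
  exists f : {linear 'rV[K]_n -> V}, bijective f.

End DualSpace.

Section Graded.
Variable K : fieldType.
Local Notation R := {mpoly K[4]}.

(* Homogeneity in a possibly negative degree: R_d = 0 for d < 0. *)
Definition zhomog (d : int) (p : R) : bool :=
  match d with Posz n => p \is n.-homog | Negz _ => p == 0 end.

Lemma zhomogE d p : zhomog d p = all (fun m => (mdeg m)%:Z == d) (msupp p).
Proof.
case: d => n; first by rewrite /= dhomogE.
by rewrite /= -msupp_eq0; case: (msupp p).
Qed.

Lemma zhomog_submod d : submod_closed (zhomog d : {pred R}).
Proof.
have inE' p : (p \in (zhomog d : {pred R})) = zhomog d p by [].
split=> [|c p q]; rewrite !inE' !zhomogE ?msupp0 //.
move=> /allP hp /allP hq; apply/allP => m /msuppD_le; rewrite mem_cat.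
by case/orP=> [/msuppZ_le/hp|/hq].
Qed.
HB.instance Definition _ d :=
  GRing.isSubmodClosed.Build K R (zhomog d) (zhomog_submod d).

Lemma zhomog0 d : zhomog d 0.
Proof. exact: (zhomog_submod d).1. Qed.

Lemma zhomogP d c p q : zhomog d p -> zhomog d q -> zhomog d (c *: p + q).
Proof. exact: (zhomog_submod d).2. Qed.

Lemma zhomogM d e p q : zhomog d p -> zhomog e q -> zhomog (d + e) (p * q).
Proof.
rewrite !zhomogE => /allP hp /allP hq; apply/allP => m /msuppM_le.
case/allpairsP => -[m1 m2] /= [/hp/eqP h1 /hq/eqP h2 ->].
by rewrite mdegD PoszD h1 h2.
Qed.

Lemma zhomogXn d p n : zhomog d p -> zhomog (d * n%:Z) (p ^+ n).
Proof.
move=> hp; elim: n => [|n ihn]; first by rewrite mulr0 /= dhomog1.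
by rewrite exprS intS mulrDr mulr1; apply: zhomogM.
Qed.

(* A graded R-module is a family of K-vector spaces [M j], [j : int], with
   bilinear multiplications R_(k - j) x M j -> M k.  The value of
   [gmul j k a m] is irrelevant unless [a] is homogeneous of degree [k - j]. *)
Record gradedModule := GradedModule {
  gcomp :> int -> lmodType K;
  gmul : forall j k : int, R -> gcomp j -> gcomp k;
  gmulP : forall (j k : int) a, zhomog (k - j) a -> linear (@gmul j k a);
  gmulDl : forall (j k : int) a b c (m : gcomp j),
    zhomog (k - j) a -> zhomog (k - j) b ->
    @gmul j k (c *: a + b) m = c *: @gmul j k a m + @gmul j k b m;
  gmul1 : forall (j : int) (m : gcomp j), @gmul j j 1 m = m;
  gmulA : forall (i j k : int) a b (m : gcomp i),
    zhomog (k - j) a -> zhomog (j - i) b ->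
    @gmul i k (a * b) m = @gmul j k a (@gmul i j b m) }.
Arguments gmul : clear implicits.

Definition giso (M N : gradedModule) : Prop :=
  exists phi : forall j, {linear M j -> N j},
    (forall j, bijective (phi j)) /\
    (forall (j k : int) a (m : M j), zhomog (k - j) a ->
       phi k (gmul M j k a m) = gmul N j k a (phi j m)).

Fact shift_degree (n j k : int) : n + k - (n + j) = k - j.
Proof. by rewrite opprD addrACA subrr add0r. Qed.

(* M(n), with M(n)_j = M_(n + j) *)
Program Definition gshift (M : gradedModule) (n : int) : gradedModule :=
  @GradedModule (fun j => M (n + j)) (fun j k => gmul M (n + j) (n + k))
    _ _ _ _.
Next Obligation. by move=> M n j k a h; apply: gmulP; rewrite shift_degree. Qed.
Next Obligation.
by move=> M n j k a b c m ha hb; apply: gmulDl; rewrite shift_degree.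
Qed.
Next Obligation. by move=> M n j m; apply: gmul1. Qed.
Next Obligation.
by move=> M n i j k a b m ha hb; apply: gmulA; rewrite shift_degree.
Qed.

(* The graded dual: (M^v)_j = Hom_K(M_(-j), K), with (a f)(m) = f(a m). *)
Section Gdual.
Variable M : gradedModule.

Definition gdual_mul (j k : int) (a : R) (f : dual_space (M (- j))) :
  dual_space (M (- k)) := insubd 0 (fun m => f (gmul M (- k) (- j) a m)).

Arguments gdual_mul : clear implicits.

Lemma gdual_mulE (j k : int) a f : zhomog (k - j) a ->
  dual_val (gdual_mul j k a f) = (fun m => f (gmul M (- k) (- j) a m)).
Proof.
move=> ha; rewrite insubdK //; apply/linear_formP => c u v.
by rewrite gmulP ?dual_linear // opprK addrC.
Qed.

Let opp_degree (j k : int) : - j - - k = k - j.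
Proof. by rewrite opprK addrC. Qed.

Program Definition gdual : gradedModule :=
  @GradedModule (fun j => dual_space (M (- j))) gdual_mul _ _ _ _.
Next Obligation.
by move=> j k a ha c f g; apply: dual_ext; rewrite dual_valP !gdual_mulE.
Qed.
Next Obligation.
move=> j k a b c f ha hb; apply: dual_ext.
rewrite dual_valP !gdual_mulE ?zhomogP //.
by apply/funext => m; rewrite gmulDl ?opp_degree // dual_linear.
Qed.
Next Obligation.
move=> j f; apply: dual_ext; rewrite /= gdual_mulE ?subrr /= ?dhomog1 //.
by apply/funext => m; rewrite gmul1.
Qed.
Next Obligation.
move=> i j k a b f ha hb; apply: dual_ext; rewrite /= !gdual_mulE //.
  by apply/funext => m; rewrite mulrC (gmulA (j := - j)) ?opp_degree.
by rewrite -[k](subrK j) -addrA; apply: zhomogM.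
Qed.

End Gdual.

Definition self_dual (M : gradedModule) : Prop :=
  exists n : int, giso (gdual M) (gshift M n).

(* The graded module with components Z_j / (Z_j :&: B_j), where Z_j and B_j
   are subspaces of a common R-module V, the R-action on V being [act]. *)
Section GradedSubquotient.
Variables (V : lmodType K) (act : R -> V -> V) (Z B : int -> submodClosed V).
Hypothesis act_linear : forall a, linear (act a).
Hypothesis act_linearl : forall v, linear (act^~ v).
Hypothesis act1 : forall v, act 1 v = v.
Hypothesis actA : forall a b v, act (a * b) v = act a (act b v).
Hypothesis actZ : forall a d j v, zhomog d a -> v \in Z j -> act a v \in Z (d + j).
Hypothesis actB : forall a d j v, zhomog d a -> v \in B j -> act a v \in B (d + j).

Definition gsubquot_mul (j k : int) (a : R) (m : subquot (Z j) (B j)) :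
  subquot (Z k) (B k) := subquot_class (Z k) (B k) (act a (subquot_repr m)).

Let actZ' j k a v : zhomog (k - j) a -> v \in Z j -> act a v \in Z k.
Proof. by move=> ha hv; rewrite -(subrK j k) actZ. Qed.

Let actB' j k a v : zhomog (k - j) a -> v \in B j -> act a v \in B k.
Proof. by move=> ha hv; rewrite -(subrK j k) actB. Qed.

Lemma gsubquot_mulE j k a v : zhomog (k - j) a -> v \in Z j ->
  gsubquot_mul k a (subquot_class (Z j) (B j) v)
    = subquot_class (Z k) (B k) (act a v).
Proof.
move=> ha hv; apply/subquot_classE; rewrite ?(actZ' ha) ?subquot_reprP //.
have -> : act a (subquot_repr (subquot_class (Z j) (B j) v)) - act a v =
  act a (subquot_repr (subquot_class (Z j) (B j) v) - v).
  by rewrite addrC -scaleN1r -act_linear scaleN1r addrC.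
by rewrite (actB' ha) // subquot_repr_class.
Qed.

Program Definition gsubquot : gradedModule :=
  @GradedModule (fun j => subquot (Z j) (B j)) (@gsubquot_mul) _ _ _ _.
Next Obligation.
move=> j k a ha c u v; rewrite -(subquot_reprK u) -(subquot_reprK v).
rewrite -subquot_classP ?subquot_reprP // !gsubquot_mulE ?subquot_reprP //.
  by rewrite act_linear subquot_classP // (actZ' ha) ?subquot_reprP.
by rewrite rpredD ?rpredZ ?subquot_reprP.
Qed.
Next Obligation.
move=> j k a b c m ha hb; rewrite /gsubquot_mul act_linearl.
by rewrite subquot_classP // ?(actZ' ha) ?(actZ' hb) ?subquot_reprP.
Qed.
Next Obligation. by move=> j m; rewrite /gsubquot_mul act1 subquot_reprK. Qed.
Next Obligation.
move=> i j k a b m ha hb; rewrite -(subquot_reprK m) !gsubquot_mulE //.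
- by rewrite actA.
- by rewrite (actZ' hb) ?subquot_reprP.
- exact: subquot_reprP.
- by rewrite -(subrK j k) -addrA; apply: zhomogM.
- exact: subquot_reprP.
Qed.

End GradedSubquotient.

(* R/J, for a homogeneous ideal J *)
Section QuotientByIdeal.
Variable J : ideal R.

Definition ideal_pred : {pred R} := [pred p | `[< ideal_set J p >]].
Lemma ideal_predP p : reflect (ideal_set J p) (p \in ideal_pred).
Proof. by rewrite inE; exact: asboolP. Qed.

Lemma ideal_pred_submod : submod_closed ideal_pred.
Proof.
case: (idealP J) => _ h0 hD hM; split=> [|c p q]; first exact/ideal_predP.
move=> /ideal_predP hp /ideal_predP hq; apply/ideal_predP; apply: hD => //.
by rewrite -mul_mpolyC; apply: hM.
Qed.
HB.instance Definition _ :=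
  GRing.isSubmodClosed.Build K R ideal_pred ideal_pred_submod.

Program Definition quotient_module : gradedModule :=
  @gsubquot R *%R (fun d => zhomog d : {pred R}) (fun=> ideal_pred) _ _ _ _ _ _.
Next Obligation. by move=> a c p q; rewrite mulrDr scalerAr. Qed.
Next Obligation. by move=> a c p q; rewrite mulrDl scalerAl. Qed.
Next Obligation. by move=> p; rewrite mul1r. Qed.
Next Obligation. by move=> a b p; rewrite mulrA. Qed.
Next Obligation. by move=> a d j p ha hp; apply: zhomogM. Qed.
Next Obligation.
move=> a d j p _ /ideal_predP hp; apply/ideal_predP.
by case: (idealP J) => _ _ _; apply.
Qed.

End QuotientByIdeal.

(* The fraction field of R, where all the localizations of R and of its
   ideals are taken. *)
Definition fracR := {fraction R}.
HB.instance Definition _ := GRing.Field.on fracR.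

Definition toF (p : R) : fracR := tofrac p.
HB.instance Definition _ := GRing.RMorphism.copy toF (@tofrac R).

Lemma toF_eq0 p : (toF p == 0) = (p == 0). Proof. exact: tofrac_eq0. Qed.

Definition fracR_scale (c : K) (u : fracR) : fracR := toF c%:MP * u.
Fact fracR_scaleA a b v : fracR_scale a (fracR_scale b v) = fracR_scale (a * b) v.
Proof. by rewrite /fracR_scale mulrA -rmorphM mpolyCM. Qed.
Fact fracR_scale1 : left_id 1 fracR_scale.
Proof. by move=> v; rewrite /fracR_scale rmorph1 mul1r. Qed.
Fact fracR_scaleDr : right_distributive fracR_scale +%R.
Proof. by move=> a u v; rewrite /fracR_scale mulrDr. Qed.
Fact fracR_scaleDl v : {morph fracR_scale^~ v : a b / a + b}.
Proof. by move=> a b; rewrite /fracR_scale mpolyCD rmorphD mulrDl. Qed.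
HB.instance Definition _ := GRing.Zmodule_isLmodule.Build K fracR
  fracR_scaleA fracR_scale1 fracR_scaleDr fracR_scaleDl.

Section Cech.
Variable J : ideal R.

(* The degree j part of the localization J_f, for f homogeneous of degree d;
   for f <> 0 this is the space of sections over D_+(f) of the twist by j of
   the sheaf associated with J. *)
Definition loc_part (f : R) (d : nat) (j : int) : set fracR :=
  [set u | exists (n : nat) (p : R),
     [/\ ideal_set J p, zhomog (j + d%:Z * n%:Z) p & u = toF p / toF f ^+ n]].

Lemma loc_part_linear f d j c u v : f != 0 -> f \is d.-homog ->
  loc_part f d j u -> loc_part f d j v -> loc_part f d j (c *: u + v).
Proof.
move=> f0 hf [n [p [Jp hp ->]]] [m [q [Jq hq ->]]].
case: (idealP J) => _ _ hD hM.
exists (n + m)%N, (c%:MP * f ^+ m * p + f ^+ n * q).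
have hfX e : zhomog (d%:Z * e%:Z) (f ^+ e) by apply: zhomogXn.
split; first by apply: hD; apply: hM.
- rewrite mul_mpolyC -scalerAl PoszD mulrDr; apply: zhomogP.
    by rewrite addrA addrC; apply: zhomogM.
  by rewrite addrCA; apply: zhomogM.
- have F0 : toF f != 0 by rewrite toF_eq0.
  rewrite -[c *: _]/(toF c%:MP * _) rmorphD !rmorphM !rmorphXn exprD.
  rewrite mulrDl invfM; congr (_ + _).
    rewrite -!mulrA; congr (_ * _); rewrite mulrCA; congr (_ * _).
    by rewrite [RHS]mulrCA divff ?mulr1 // expf_neq0.
  by rewrite [toF f ^+ n * _]mulrC -!mulrA mulVKf // expf_neq0.
Qed.

Lemma loc_part0 f d j : loc_part f d j 0.
Proof.
exists 0%N, 0; case: (idealP J) => _ h0 _ _; split=> //.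
  exact: zhomog0.
by rewrite rmorph0 mul0r.
Qed.

Lemma loc_partM f d j e a u : zhomog e a ->
  loc_part f d j u -> loc_part f d (e + j) (toF a * u).
Proof.
move=> ha [n [p [Jp hp ->]]]; exists n, (a * p).
case: (idealP J) => _ _ _ hM; split; first exact: hM.
  by rewrite -addrA; apply: zhomogM.
by rewrite rmorphM mulrA.
Qed.

(* The Cech complex of the standard covering by the D_+(x_i), in degrees 0 and
   1.  Cochains are indexed by all pairs (i, k): on a cocycle, the cocycle
   condition forces c_ii = 0 and c_ki = - c_ik. *)
Definition cochain0 (j : int) : set ('I_4 -> fracR) :=
  [set b | forall i, loc_part 'X_i 1 j (b i)].

Definition cochain1 (j : int) : set ('I_4 -> 'I_4 -> fracR) :=
  [set c | forall i k, loc_part ('X_i * 'X_k) 2 j (c i k)].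

Definition cocycle1 (j : int) : {pred 'I_4 -> 'I_4 -> fracR} :=
  [pred c | `[< cochain1 j c /\
                forall i k l, c k l - c i l + c i k = 0 >]].

Definition coboundary1 (j : int) : {pred 'I_4 -> 'I_4 -> fracR} :=
  [pred c | `[< exists2 b, cochain0 j b & forall i k, c i k = b k - b i >]].

Lemma cocycle1P j c :
  reflect (cochain1 j c /\ forall i k l, c k l - c i l + c i k = 0)
          (c \in cocycle1 j).
Proof. by rewrite inE; exact: asboolP. Qed.

Lemma coboundary1P j c :
  reflect (exists2 b, cochain0 j b & forall i k, c i k = b k - b i)
          (c \in coboundary1 j).
Proof. by rewrite inE; exact: asboolP. Qed.

Let X_homog i : ('X_i : R) \is 1.-homog.
Proof. by rewrite dhomogX /= mdeg1. Qed.
Let X_neq0 i : ('X_i : R) != 0.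
Proof. by rewrite -msupp_eq0 msuppX. Qed.

Lemma cocycle1_submod j : submod_closed (cocycle1 j).
Proof.
split=> [|a c c'].
  apply/cocycle1P; split=> [i k|i k l]; first exact: loc_part0.
  by rewrite subrr addr0.
move=> /cocycle1P[hc zc] /cocycle1P[hc' zc']; apply/cocycle1P; split=> [i k|i k l].
  apply: (@loc_part_linear _ _ _ a (c i k) (c' i k)) => //.
  + by rewrite mulf_neq0.
  + exact: (dhomogM (X_homog i) (X_homog k)).
rewrite -[LHS]/((a *: c k l + c' k l) - (a *: c i l + c' i l)
                + (a *: c i k + c' i k)).
have -> : a *: c k l + c' k l - (a *: c i l + c' i l) + (a *: c i k + c' i k)
    = (a *: c k l - a *: c i l + a *: c i k) + (c' k l - c' i l + c' i k).
  by ring.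
by rewrite -scalerBr -scalerDr zc zc' scaler0 addr0.
Qed.
HB.instance Definition _ j :=
  GRing.isSubmodClosed.Build K _ (cocycle1 j) (cocycle1_submod j).

Lemma coboundary1_submod j : submod_closed (coboundary1 j).
Proof.
split=> [|a c c'].
  apply/coboundary1P; exists 0 => [i|i k]; first exact: loc_part0.
  by rewrite subrr.
move=> /coboundary1P[b hb bE] /coboundary1P[b' hb' bE']; apply/coboundary1P.
exists (a *: b + b') => [i|i k].
  exact: (@loc_part_linear _ _ _ a (b i) (b' i)).
rewrite -[LHS]/(a *: c i k + c' i k) bE bE' scalerBr.
rewrite -[RHS]/(a *: b k + b' k - (a *: b i + b' i)) opprD.
by ring.
Qed.
HB.instance Definition _ j :=
  GRing.isSubmodClosed.Build K _ (coboundary1 j) (coboundary1_submod j).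

(* The direct sum over j of the H^1(P^3, J~(j)). *)
Program Definition H1_star : gradedModule :=
  @gsubquot ('I_4 -> 'I_4 -> fracR) (fun a c i k => toF a * c i k)
    (fun j => cocycle1 j) (fun j => coboundary1 j) _ _ _ _ _ _.
Next Obligation.
move=> a e c c'; apply/funext => i; apply/funext => k.
rewrite -[LHS]/(toF a * (toF e%:MP * c i k + c' i k)).
by rewrite mulrDr mulrCA.
Qed.
Next Obligation.
move=> c e a b; apply/funext => i; apply/funext => k.
by rewrite rmorphD -mul_mpolyC rmorphM mulrDl -mulrA.
Qed.
Next Obligation.
by move=> c; apply/funext => i; apply/funext => k; rewrite rmorph1 mul1r.
Qed.
Next Obligation.
by move=> a b c; apply/funext => i; apply/funext => k; rewrite rmorphM mulrA.
Qed.
Next Obligation.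
move=> a d j c ha /cocycle1P[hc zc]; apply/cocycle1P.
split=> [i k|i k l]; first exact: loc_partM.
by rewrite -mulrBr -mulrDr zc mulr0.
Qed.
Next Obligation.
move=> a d j c ha /coboundary1P[b hb bE]; apply/coboundary1P.
exists (fun i => toF a * b i) => [i|i k]; first exact: loc_partM.
by rewrite bE mulrBr.
Qed.

End Cech.

Definition homogeneous_ideal (J : set R) : Prop :=
  forall d p, J p -> J (pihomog mdeg d p).

(* Closed subschemes of P^3 correspond bijectively to saturated homogeneous
   ideals of R. *)
Record closedSubscheme := ClosedSubscheme {
  subscheme_ideal :> ideal R;
  subscheme_homog : homogeneous_ideal subscheme_ideal;
  subscheme_saturated : forall p,
    (exists n : nat, forall i, ideal_set subscheme_ideal ('X_i ^+ n * p)) ->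
    ideal_set subscheme_ideal p }.

(* The scheme-theoretic points of P^3. *)
Definition proj_point (P : set R) : Prop :=
  [/\ prime_in [set: R] P, homogeneous_ideal P & exists i, ~ P 'X_i].

Section Curves.
Variable C : closedSubscheme.

Definition point_of (P : set R) : Prop := proj_point P /\ C `<=` P.

Definition generic_point (P : set R) : Prop :=
  point_of P /\ forall Q, point_of Q -> Q `<=` P -> Q = P.

(* All the irreducible components, i.e. the closures of the generic points,
   have dimension 1. *)
Definition pure_one_dimensional : Prop :=
  (exists P, point_of P) /\
  forall P, generic_point P ->
    chain_dim [set Q | proj_point Q /\ P `<=` Q] 1.

(* The local ring of P^3 at P, and the stalk at P of the ideal sheaf of C. *)
Definition proj_local_ring (P : set R) : set fracR :=
  [set u | exists (d : nat) (a b : R),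
     [/\ a \is d.-homog, b \is d.-homog, ~ P b & u = toF a / toF b]].

Definition ideal_stalk (P : set R) : set fracR :=
  [set u | exists (d : nat) (a b : R),
     [/\ ideal_set C a, a \is d.-homog, b \is d.-homog, ~ P b & u = toF a / toF b]].

Definition locally_CM : Prop :=
  forall P, point_of P -> local_CM (proj_local_ring P) (ideal_stalk P).

Definition is_curve : Prop := pure_one_dimensional /\ locally_CM.

Definition loc_at (P J : set R) : set fracR :=
  [set u | exists a b : R, [/\ J a, ~ P b & u = toF a / toF b]].

(* R/I_C is Cohen-Macaulay: so are all its localizations R_P / I_C R_P. *)
Definition arithmetically_CM : Prop :=
  forall P, prime_in [set: R] P -> C `<=` P ->
    local_CM (loc_at P [set: R]) (loc_at P C).

Definition coordinate_ring : gradedModule := quotient_module C.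

(* For C of dimension 1: the Hilbert polynomial of C is d n + e. *)
Definition has_degree (d : int) : Prop :=
  exists (e : int) (n0 : nat), forall n : nat, (n0 <= n)%N ->
    exists2 r : nat, has_dim (coordinate_ring n%:Z) r & r%:Z = d * n%:Z + e.

Definition hartshorne_rao : gradedModule := H1_star C.

End Curves.

(* R = K[x, y, z, t] *)
Definition ix : 'I_4 := @Ordinal 4 0 isT.
Definition iy : 'I_4 := @Ordinal 4 1 isT.
Definition iz : 'I_4 := @Ordinal 4 2 isT.
Definition it : 'I_4 := @Ordinal 4 3 isT.

(* p belongs to the subring of R generated over K by the variables of s. *)
Definition poly_in (s : seq 'I_4) (p : R) : Prop :=
  forall m i, m \in msupp p -> i \notin s -> m i = 0%N.

(* The degree of p; only meaningful for p <> 0. *)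
Definition pdeg (p : R) : int := ((msize p).-1)%:Z.

Definition curve_generators (h F G A B : R) : seq R :=
  let x : R := 'X_ix in
  let y : R := 'X_iy in
  [:: x * y; x ^+ 2 * A + x * h * F; y ^+ 2 * B + y * h * G;
      x * A * G + y * B * F + h * F * G].

(* The degree of h; for h = 0, the degree forced by the homogeneity of
   x^2 A + x h F.  As F, G and, for h = 0, A and B are nonzero, it is then also
   equal to deg B + 1 - deg G, by the homogeneity of x A G + y B F. *)
Definition formal_degree (h F A : R) : int :=
  if h == 0 then pdeg A + 1 - pdeg F else pdeg h.

End Graded.

Arguments gmul {K} M j k a m : rename.

(* Main.v *)
Require Import Defs.
From HB Require Import structures.
From mathcomp Require Import all_boot all_order all_algebra.
From mathcomp Require Import boolp classical_sets functions.
From mathcomp Require Import mpoly ring zify.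

Set Implicit Arguments.
Unset Strict Implicit.
Unset Printing Implicit Defensive.

Import Order.TTheory GRing.Theory Num.Theory.

Local Open Scope classical_set_scope.
Local Open Scope ring_scope.

(** Let [S = K[z, t]], let [g = x * A + h * F] and [k = y * B + h * G] be the
    equations of the parts of the curve in the planes [y = 0] and [x = 0], and let
    [q = x * A * G + y * B * F + h * F * G] be the last generator of the ideal [I].
    Modulo [x * y] a polynomial is a pair of restrictions to the two planes that
    agree on the line [x = y = 0].  The restrictions of [q] are [g * G] and [k * F],
    so the elements of [I] are the pairs [(g * al, k * be)] whose quotients restrict
    on the line to a multiple of [(G, F)] (lemmas [curve_ideal_restrict] and
    [curve_ideal_lift]).  If [F] and [G] are coprime, this condition on the line
    reads [F * al - G * be = 0].

    Hence [I / (x * y)] is the kernel of a map from the direct sum of two shifted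
    coordinate rings of planes to [S (- deg h)], whose image is the ideal [(F, G)]
    of [S].  On the line this ideal generates the structure sheaf, and line bundles
    on planes and on the space have no first cohomology, so the first cohomology of
    the ideal sheaf is the cokernel [S / (F, G)], shifted by the degree of [h].  This
    is carried out on cochains: a cocycle is the boundary of fractions
    [W i / X_i ^+ N] ([cocycle_num]); the standard cochain [rao_num], built from
    expressions of powers of [z] and [t] through [F] and [G], has a boundary in [I];
    its multiples give all classes ([rao_generates]), and the polynomials that
    annihilate its class form the ideal [(x, y, F, G)] ([rao_annihilator],
    [rao_kernel]).  The result is [hartshorne_rao_quotient].

    That [F] and [G] are coprime follows from the curve being locally
    Cohen-Macaulay: a common linear factor [l] would make [q / l] an element outside
    [I] that is annihilated by [x], [y] and [l] modulo [I], and the point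
    [x = y = l = 0] would be embedded ([no_common_factor]).  As the field is
    algebraically closed, forms in [z] and [t] without common linear factor generate
    a power of [z] and a power of [t] ([curve_bezout]).

    The quotient [S / (F, G)] is Gorenstein: its socle is spanned by a determinant of
    degree [deg F + deg G - 2], and the coefficient of this form induces a perfect
    pairing ([gorenstein_functional], [gorenstein_dual]).  For the degree of the
    curve, the ideal is the direct sum of the multiples of [x * y], [x * g], [y * k]
    and [q] by polynomials in all variables, in [x, z, t], in [y, z, t] and in
    [z, t] respectively ([curve_ideal_normal], [curve_ideal_dim]), which determines
    the Hilbert function ([curve_hilbert]). *)

(** * Ideals, substitutions and homogeneous components *)

Lemma ord4P (i : 'I_4) : [\/ i = ix, i = iy, i = iz | i = it].
Proof.
case: i => [[|[|[|[|//]]]] ?];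
  [constructor 1|constructor 2|constructor 3|constructor 4]; exact: val_inj.
Qed.

Section Ideals.
Variable T : comPzRingType.
Implicit Types (J : ideal T) (a b c d u v : T).

Lemma ideal_eq I J : ideal_set I = ideal_set J -> I = J.
Proof.
by case: I J => [I hI] [J hJ] /= E; subst J; congr Ideal; exact: Prop_irrelevance.
Qed.

Lemma ideal0 J : ideal_set J 0.
Proof. by case: (idealP J). Qed.

Lemma idealD J u v : ideal_set J u -> ideal_set J v -> ideal_set J (u + v).
Proof. by case: (idealP J) => _ _ + _; apply. Qed.

Lemma idealM J a u : ideal_set J u -> ideal_set J (a * u).
Proof. by case: (idealP J) => _ _ _; apply. Qed.

Lemma idealB J u v : ideal_set J u -> ideal_set J v -> ideal_set J (u - v).
Proof. by move=> Ju Jv; rewrite -mulN1r; apply: idealD => //; apply: idealM. Qed.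

Lemma gen1P a u : ideal_set (gen_ideal [:: a]) u <-> exists c, u = c * a.
Proof.
split=> [[c ->]|[c ->]]; first by exists (c 0%N); rewrite big_ord1.
by exists (fun=> c); rewrite big_ord1.
Qed.

Lemma gen3P a b c u : ideal_set (gen_ideal [:: a; b; c]) u <->
  exists e1 e2 e3, u = e1 * a + e2 * b + e3 * c.
Proof.
split=> [[e ->]|[e1 [e2 [e3 ->]]]].
  exists (e 0%N), (e 1%N), (e 2%N).
  by rewrite /= !big_ord_recl big_ord0 /= addr0 !addrA.
exists (nth 0 [:: e1; e2; e3]).
by rewrite /= !big_ord_recl big_ord0 /= addr0 !addrA.
Qed.

Lemma gen4P a b c d u : ideal_set (gen_ideal [:: a; b; c; d]) u <->
  exists e1 e2 e3 e4, u = e1 * a + e2 * b + e3 * c + e4 * d.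
Proof.
split=> [[e ->]|[e1 [e2 [e3 [e4 ->]]]]].
  exists (e 0%N), (e 1%N), (e 2%N), (e 3%N).
  by rewrite /= !big_ord_recl big_ord0 /= addr0 !addrA.
exists (nth 0 [:: e1; e2; e3; e4]).
by rewrite /= !big_ord_recl big_ord0 /= addr0 !addrA.
Qed.

End Ideals.

Section Substitution.
Variable K : fieldType.
Local Notation R := {mpoly K[4]}.
Implicit Types (p q r : R) (v w : 'I_4 -> R).

Definition subst v : R -> R := comp_mpoly [tuple v i | i < 4].
HB.instance Definition _ v :=
  GRing.RMorphism.copy (subst v) (comp_mpoly [tuple v i | i < 4]).
HB.instance Definition _ v :=
  GRing.Linear.copy (subst v) (comp_mpoly [tuple v i | i < 4]).

Lemma substX v i : subst v 'X_i = v i.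
Proof. by rewrite /subst comp_mpolyXU -tnth_nth tnth_mktuple. Qed.

Lemma substXm v (m : 'X_{1..4}) : subst v 'X_[m] = \prod_i v i ^+ m i.
Proof.
by rewrite /subst comp_mpolyX; apply: eq_bigr => i _; rewrite tnth_mktuple.
Qed.

Lemma substE v p : subst v p = \sum_(m <- msupp p) p@_m *: \prod_i v i ^+ m i.
Proof.
rewrite {1}[p]mpolyE linear_sum; apply: eq_bigr => m _.
by rewrite linearZ /= substXm.
Qed.

Lemma subst_id p : subst (fun i => 'X_i) p = p.
Proof. exact: comp_mpoly_id. Qed.

Lemma eq_subst_in v w p :
  (forall m i, m \in msupp p -> m i != 0%N -> v i = w i) ->
  subst v p = subst w p.
Proof.
move=> vw; rewrite !substE; apply: eq_big_seq => m mp; congr (_ *: _).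
apply: eq_bigr => i _; have [->//|mi] := eqVneq (m i) 0%N.
by rewrite (vw m i mp mi).
Qed.

Lemma subst_comp v w p : subst v (subst w p) = subst (fun i => subst v (w i)) p.
Proof.
rewrite [subst w p]substE linear_sum substE; apply: eq_bigr => m _.
rewrite linearZ /= rmorph_prod; congr (_ *: _).
by apply: eq_bigr => i _; rewrite rmorphXn.
Qed.

Lemma eq_subst v w p : v =1 w -> subst v p = subst w p.
Proof. by move=> vw; apply: eq_subst_in => m i _ _; apply: vw. Qed.

Lemma subst_congr (J : ideal R) v w p :
  (forall i, ideal_set J (v i - w i)) -> ideal_set J (subst v p - subst w p).
Proof.
move=> vw.
elim/mpolyind: p => [|c m p _ _ IH]; first by rewrite !raddf0 addr0; apply: ideal0.
rewrite ![subst _ (_ + _)]linearP /= opprD addrACA; apply: idealD => //.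
rewrite -scalerBr -mul_mpolyC !substXm; apply: idealM.
suff H (s : seq 'I_4) :
    ideal_set J (\prod_(i <- s) v i ^+ m i - \prod_(i <- s) w i ^+ m i).
  exact: H.
elim: s => [|i s IHs]; first by rewrite !big_nil subrr; apply: ideal0.
rewrite !big_cons.
set a := v i ^+ _; set b := \prod_(_ <- _) _.
set a' := w i ^+ _; set b' := \prod_(_ <- _) _.
have -> : a * b - a' * b' = a * (b - b') + b' * (a - a') by ring.
apply: idealD; apply: idealM => //.
by rewrite /a /a' subrXX mulrC; apply: idealM.
Qed.

Lemma zhomog_sum d (T : Type) (s : seq T) (P : pred T) (f : T -> R) :
  (forall i, P i -> zhomog d (f i)) -> zhomog d (\sum_(i <- s | P i) f i).
Proof. by move=> hf; exact: (rpred_sum (S := zhomog d : {pred R})). Qed.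

Lemma zhomogD d p q : zhomog d p -> zhomog d q -> zhomog d (p + q).
Proof. by move=> hp hq; rewrite -[p]scale1r; apply: zhomogP. Qed.

Lemma zhomogZ d (c : K) p : zhomog d p -> zhomog d (c *: p).
Proof.
by move=> hp; rewrite -[_ *: _]addr0; apply: zhomogP => //; exact: zhomog0.
Qed.

Lemma zhomogN d p : zhomog d p -> zhomog d (- p).
Proof. by move=> hp; rewrite -scaleN1r; apply: zhomogZ. Qed.

Lemma zhomogB d p q : zhomog d p -> zhomog d q -> zhomog d (p - q).
Proof. by move=> hp hq; apply: zhomogD => //; exact: zhomogN. Qed.

Lemma zhomogX i : zhomog 1 ('X_i : R).
Proof. by rewrite /= dhomogX /= mdeg1. Qed.

Lemma zhomogXX i n : zhomog n%:Z ('X_i ^+ n : R).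
Proof. by rewrite -[n%:Z]mul1r; apply: zhomogXn; exact: zhomogX. Qed.

Lemma subst_homog v d p :
  (forall i, zhomog 1 (v i)) -> zhomog d p -> zhomog d (subst v p).
Proof.
move=> hv; case: d => n; last by move=> /eqP ->; rewrite raddf0; exact: zhomog0.
move=> hp; rewrite substE big_seq; apply: zhomog_sum => m mp.
apply: zhomogZ; have <- := dhomogP _ _ _ hp m mp.
rewrite /= mdegE; move: (index_enum _) => r.
elim: r => [|i r IH]; first by rewrite !big_nil dhomog1.
rewrite !big_cons; apply: dhomogM IH; have := zhomogXn (m i) (hv i).
by rewrite mul1r.
Qed.

Definition zpi (d : int) (p : R) : R :=
  if d is Posz n then pihomog mdeg n p else 0.

Lemma zpi_is_linear d : linear (zpi d).
Proof.
case: d => n c p q /=; first by rewrite linearP.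
by rewrite scaler0 addr0.
Qed.
HB.instance Definition _ d :=
  GRing.isLinear.Build K R R _ (zpi d) (zpi_is_linear d).

Lemma zpiP d p : zhomog d (zpi d p).
Proof. by case: d => n /=; first exact: pihomogP. Qed.

Lemma zhomog_uniq d e p : p != 0 -> zhomog d p -> zhomog e p -> d = e.
Proof.
move=> p0; case: d => n; last by move=> /= /eqP p00; rewrite p00 eqxx in p0.
case: e => m; last by move=> _ /= /eqP p00; rewrite p00 eqxx in p0.
by move=> hn hm; rewrite (dhomog_uniq p0 hn hm).
Qed.

Lemma zpi_homog d e p : zhomog e p -> zpi d p = if d == e then p else 0.
Proof.
move=> hp; case: eqVneq => [de|de].
  by subst e; case: d hp => n /= => [|/eqP ->//]; apply: pihomog_dE.
have [->|p0] := eqVneq p 0; first exact: raddf0.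
apply/eqP/negPn/negP => zp0.
have := zpiP d p; case: d e de hp zp0 => [n|n] [m|m] //= nm hp zp0 hzp.
  by move: zp0; rewrite (pihomog_ne0 _ hp) ?eqxx // eq_sym.
- by rewrite hp in p0.
- by rewrite eqxx in zp0.
by rewrite eqxx in zp0.
Qed.

Lemma zpi_id d p : zhomog d p -> zpi d p = p.
Proof. by move=> hp; rewrite (zpi_homog _ hp) eqxx. Qed.

Lemma zpi_partition p : exists n, p = \sum_(i < n) zpi i p.
Proof. by exists (mmeasure mdeg p); apply: pihomog_partitionE. Qed.

Lemma zpiM e d a p : zhomog e a -> zpi (e + d) (a * p) = a * zpi d p.
Proof.
move=> ha; have [n pE] := zpi_partition p.
rewrite pE mulr_sumr !linear_sum mulr_sumr; apply: eq_bigr => i _ /=.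
rewrite (zpi_homog _ (zhomogM ha (zpiP i p))) (zpi_homog _ (zpiP i p)).
rewrite (inj_eq (addrI _)).
by case: eqP => // _; rewrite mulr0.
Qed.

Lemma zpiM_sub e d a p : zhomog e a -> zpi d (a * p) = a * zpi (d - e) p.
Proof. by move=> ha; rewrite -(zpiM _ _ ha) addrC subrK. Qed.

Lemma zpiD d (p q : R) : zpi d (p + q) = zpi d p + zpi d q.
Proof. exact: linearD. Qed.

Lemma zpiMr_sub e d (a p : R) : zhomog e a -> zpi d (p * a) = zpi (d - e) p * a.
Proof. by move=> ha; rewrite mulrC (zpiM_sub _ _ ha) mulrC. Qed.

Lemma zpi_subst v d p : (forall i, zhomog 1 (v i)) ->
  zpi d (subst v p) = subst v (zpi d p).
Proof.
move=> hv; have [n ->] := zpi_partition p.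
rewrite [subst v _]linear_sum [LHS]linear_sum [zpi d _ in RHS]linear_sum [RHS]linear_sum.
apply: eq_bigr => i _ /=.
rewrite (zpi_homog d (subst_homog hv (zpiP i p))) (zpi_homog d (zpiP i p)).
by case: ifP => _ //; rewrite raddf0.
Qed.

Lemma zhomog_cancel e d a p : a != 0 -> zhomog e a -> zhomog d (a * p) ->
  zhomog (d - e) p.
Proof.
move=> a0 ha /zpi_id; rewrite (zpiM_sub _ _ ha) => /(mulfI a0) <-.
exact: zpiP.
Qed.

Lemma homogZ p : p \is homog mdeg -> zhomog (pdeg p) p.
Proof. by rewrite homog_msize. Qed.

Lemma pdegE d p : p != 0 -> zhomog d p -> d = pdeg p.
Proof.
move=> p0 hp; apply: (zhomog_uniq p0) => //; apply: homogZ.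
by case: d hp => n /= hp; [apply: homogE hp | rewrite (eqP hp) eqxx in p0].
Qed.

Lemma X_neq0 i : ('X_i : R) != 0.
Proof. by rewrite -msupp_eq0 msuppX. Qed.

End Substitution.

(** Locked, so that rewriting does not look for ring operations behind an
    application of [kill]. *)
HB.lock Definition kill (K : fieldType) (i : 'I_4) : {mpoly K[4]} -> {mpoly K[4]} :=
  subst (fun j => if j == i then 0 else 'X_j).

Section Kill.
Variable K : fieldType.
Local Notation R := {mpoly K[4]}.
Implicit Types (p q : R) (i j : 'I_4).

Lemma killD i p q : kill i (p + q) = kill i p + kill i q.
Proof. by rewrite kill.unlock rmorphD. Qed.
Lemma killB i p q : kill i (p - q) = kill i p - kill i q.
Proof. by rewrite kill.unlock rmorphB. Qed.
Lemma killN i p : kill i (- p) = - kill i p.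
Proof. by rewrite kill.unlock rmorphN. Qed.
Lemma killM i p q : kill i (p * q) = kill i p * kill i q.
Proof. by rewrite kill.unlock rmorphM. Qed.
Lemma killXn i p n : kill i (p ^+ n) = kill i p ^+ n.
Proof. by rewrite kill.unlock rmorphXn. Qed.
Lemma killZ i c p : kill i (c *: p) = c *: kill i p.
Proof. by rewrite kill.unlock linearZ. Qed.
Lemma kill0 i : kill i 0 = 0 :> R.
Proof. by rewrite kill.unlock rmorph0. Qed.
Definition killE := (killD, killB, killN, killM, killXn, kill0).

Lemma killX i j : kill i 'X_j = if j == i then 0 else 'X_j :> R.
Proof. by rewrite kill.unlock substX. Qed.

Lemma kill_homog i d p : zhomog d p -> zhomog d (kill i p).
Proof.
rewrite kill.unlock; apply: subst_homog => j.
by case: ifP => _; [exact: zhomog0 | exact: zhomogX].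
Qed.

Lemma zpi_kill i d (p : R) : zpi d (kill i p) = kill i (zpi d p).
Proof.
rewrite kill.unlock; apply: zpi_subst => j.
by case: ifP => _; [exact: zhomog0 | exact: zhomogX].
Qed.

Lemma killC i j p : kill i (kill j p) = kill j (kill i p).
Proof.
have kE (l : 'I_4) (r : R) : subst (fun j => if j == l then 0 else 'X_j) r = kill l r.
  by rewrite kill.unlock.
rewrite -!kE !subst_comp; apply: eq_subst => l.
by rewrite !kE; case: ifP => li; case: ifP => lj;
  rewrite ?kill0 ?killX ?li ?lj.
Qed.

Lemma kill_ex i p : exists q, p = kill i p + 'X_i * q.
Proof.
have /gen1P [c E] : ideal_set (gen_ideal [:: 'X_i]) (p - kill i p).
  rewrite -{1}[p]subst_id kill.unlock; apply: subst_congr => j.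
  apply/gen1P; case: ifP => [/eqP ->|_]; first by exists 1; rewrite subr0 mul1r.
  by exists 0; rewrite subrr mul0r.
by exists c; rewrite mulrC -E addrC subrK.
Qed.

Lemma kill_id i p : (forall m, m \in msupp p -> m i = 0%N) -> kill i p = p.
Proof.
move=> hp; rewrite -[RHS]subst_id kill.unlock; apply: eq_subst_in => m j mp.
by case: (j =P i) => [->|//]; rewrite hp.
Qed.

Lemma poly_in_kill s i p : poly_in s p -> i \notin s -> kill i p = p.
Proof. by move=> hp hi; apply: kill_id => m mp; apply: hp hi. Qed.

Lemma killK i p : kill i (kill i p) = kill i p.
Proof.
have [q pE] := kill_ex i p.
by rewrite {2}pE killD killM killX eqxx mul0r addr0.
Qed.

End Kill.

(** * Coprime elements and Koszul exactness *)

Section RegularPairs.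
Variable R : idomainType.
Implicit Types a b f g u v : R.

(** For [f] and [g] nonzero this is a symmetric condition, and it says that [f]
    and [g] have no common factor when the ring is factorial. *)
Definition regular_pair f g : Prop :=
  forall u v, f * u = g * v -> exists w, v = f * w.

Lemma regular_pairP f g u v : f != 0 -> regular_pair f g -> f * u = g * v ->
  exists w, u = g * w /\ v = f * w.
Proof.
move=> f0 fg E; have [w vE] := fg _ _ E; exists w; split=> //.
by apply: (mulfI f0); rewrite E vE; ring.
Qed.

Lemma regular_pairC f g : f != 0 -> regular_pair f g -> regular_pair g f.
Proof. by move=> f0 fg u v /esym /(regular_pairP f0 fg) [w [-> _]]; exists w. Qed.

Lemma regular_pairMr f a b :
  regular_pair f a -> regular_pair f b -> regular_pair f (a * b).
Proof.
move=> fa fb u v; rewrite -mulrA => /fa [w E].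
by apply: fb (esym E).
Qed.

Lemma regular_pairXr f g n : regular_pair f g -> regular_pair f (g ^+ n).
Proof.
move=> fg; elim: n => [|n IH]; last by rewrite exprS; apply: regular_pairMr.
by move=> u v; rewrite mul1r => <-; exists u.
Qed.

Lemma regular_pairX f g m n : f != 0 -> g != 0 ->
  regular_pair f g -> regular_pair (f ^+ m) (g ^+ n).
Proof.
move=> f0 g0 fg; apply: regular_pairC; first by rewrite expf_neq0.
by apply: regular_pairXr; apply: regular_pairC => //; apply: regular_pairXr.
Qed.

(** Sections extend over a subset of codimension two: the fraction [u / c] has
    the denominator [a] and also the denominator [b], which are coprime. *)
Lemma dvd_of_charts a b c u v v' : c != 0 -> a != 0 -> regular_pair a b ->
  a * u = c * v -> b * u = c * v' -> exists w, u = c * w.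
Proof.
move=> c0 a0 ab E E'.
have /(regular_pairP a0 ab) [w [_ vE]] : a * v' = b * v.
  by apply: (mulfI c0); rewrite mulrCA -E' mulrCA [RHS]mulrCA -E.
by exists w; apply: (mulfI a0); rewrite E vE; ring.
Qed.

(** The Koszul complex of a family [f] containing a regular sequence
    [f z0, f t0, f j] of length three is exact at its second step.  For powers of
    variables this is the vanishing of the first cohomology of line bundles on
    projective spaces of dimension at least two.  The relation between the indices
    [z0], [t0], [j] puts [c z0 t0] in the ideal of [f z0] and [f t0]; the
    relations between [z0], [t0], [i] then provide [d i]. *)
Lemma koszul_exact (T : Type) (P : T -> Prop) (f : T -> R) (c : T -> T -> R)
    (z0 t0 j : T) :
  P z0 -> P t0 -> P j -> f z0 != 0 ->
  regular_pair (f z0) (f t0) ->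
  (forall u a b, f j * u = f z0 * a + f t0 * b ->
     exists a' b', u = f z0 * a' + f t0 * b') ->
  (forall i k l, P i -> P k -> P l ->
     f i * c k l - f k * c i l + f l * c i k = 0) ->
  exists d : T -> R, forall i k, P i -> P k -> c i k = f i * d k - f k * d i.
Proof.
move=> Pz Pt Pj fz0 zt jzt cP.
have [dt [e czt]] : exists dt e, c z0 t0 = f z0 * dt + f t0 * e.
  apply: (jzt _ (- c t0 j) (c z0 j)).
  apply/eqP; rewrite -subr_eq0 -[X in _ == X](cP z0 t0 j) //; apply/eqP; ring.
have dP i : exists d, P i -> c z0 i = f i * e + f z0 * d.
  have [Pi|nPi] := pselect (P i); last by exists 0.
  have /zt [d dE] : f z0 * (c t0 i + f i * dt) = f t0 * (c z0 i - f i * e).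
    have E : f z0 * c t0 i = f t0 * c z0 i - f i * c z0 t0.
      apply/eqP; rewrite -subr_eq0 -[X in _ == X](cP z0 t0 i) //; apply/eqP; ring.
    by rewrite mulrDr E czt; ring.
  by exists d => _; rewrite -dE; ring.
have [d {}dP] := choice dP.
exists d => i k Pi Pk; apply: (mulfI fz0).
have E : f z0 * c i k = f i * c z0 k - f k * c z0 i.
  apply/eqP; rewrite -subr_eq0 -[X in _ == X](cP z0 i k) //; apply/eqP; ring.
by rewrite E !dP //; ring.
Qed.

End RegularPairs.

Section Variables.
Variable K : fieldType.
Local Notation R := {mpoly K[4]}.
Implicit Types (i j l : 'I_4) (p q u v : R).

Lemma regular_pair_of_kill j u : kill j u != 0 -> regular_pair ('X_j : R) u.
Proof.
move=> ku a b /(congr1 (kill j)); rewrite !killM killX eqxx mul0r.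
move=> /esym/eqP; rewrite mulf_eq0 (negbTE ku) /= => /eqP kb.
by have [c bE] := kill_ex j b; exists c; rewrite bE kb add0r.
Qed.

Lemma regular_pair_Xn i j m n : i != j ->
  regular_pair ('X_i ^+ m : R) ('X_j ^+ n).
Proof.
move=> ij; apply: regular_pairX; rewrite ?X_neq0 //.
by apply: regular_pair_of_kill; rewrite killX [j == i]eq_sym (negbTE ij) X_neq0.
Qed.

Lemma regular_triple_Xn i j l n u a b : i != l -> j != l ->
  'X_l ^+ n * u = 'X_i ^+ n * a + 'X_j ^+ n * b ->
  exists a' b', u = 'X_i ^+ n * a' + 'X_j ^+ n * b' :> R.
Proof.
move=> il jl; elim: n {2 3 4 5}n u a b => [|m IH] n u a b.
  by rewrite mul1r => ->; exists a, b.
rewrite exprSr -mulrA => /IH [a' [b' E]].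
have [a1 aE] := kill_ex l a'; have [b1 bE] := kill_ex l b'.
exists a1, b1; apply: (mulfI (X_neq0 _ l)).
have := congr1 (kill l) E; rewrite killD !killM !killXn !killX eqxx.
rewrite (negbTE il) (negbTE jl) mul0r => E0.
by rewrite E {1}aE {1}bE !mulrDr addrACA -E0 add0r; ring.
Qed.

Lemma koszul_Xn (P : 'I_4 -> Prop) n (c : 'I_4 -> 'I_4 -> R) (a b j : 'I_4) :
  P a -> P b -> P j -> a != b -> a != j -> b != j ->
  (forall i k l, P i -> P k -> P l ->
     'X_i ^+ n * c k l - 'X_k ^+ n * c i l + 'X_l ^+ n * c i k = 0) ->
  exists d : 'I_4 -> R,
    forall i k, P i -> P k -> c i k = 'X_i ^+ n * d k - 'X_k ^+ n * d i.
Proof.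
move=> Pa Pb Pj ab aj bj.
apply: (@koszul_exact R _ P (fun i => 'X_i ^+ n) c a b j) => //.
- by rewrite expf_neq0 // X_neq0.
- exact: regular_pair_Xn.
- by move=> u a' b'; apply: regular_triple_Xn.
Qed.

End Variables.

(** * The ideal of the curve and its standard cochain *)

(** [plane_eqn ix h F A] is the equation of the part of the curve in the plane
    [y = 0], and [plane_eqn iy h G B] of the part in the plane [x = 0].  They are
    locked, so that substitutions are not pushed inside them. *)
HB.lock Definition plane_eqn (K : fieldType) (i : 'I_4) (h F A : {mpoly K[4]}) :=
  'X_i * A + h * F.

(** The last generator of the ideal; its restrictions to the two planes are the
    equations of the two parts multiplied by [G] and [F]. *)
HB.lock Definition link_eqn (K : fieldType) (h F G A B : {mpoly K[4]}) :=
  'X_ix * A * G + 'X_iy * B * F + h * F * G.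

Section PlaneSections.
Variable K : fieldType.
Local Notation R := {mpoly K[4]}.

(** In the plane [X_v = 0], a cocycle with values in the ideal generated by [f]
    is [f] times a coboundary, because the plane is a projective space of
    dimension two. *)
Lemma plane_sections (v o : 'I_4) (f : R) N (V : 'I_4 -> R) (c : 'I_4 -> 'I_4 -> R) :
  [&& v != iz, v != it, o != v, iz != o & it != o] -> f != 0 -> kill v f = f ->
  (forall i j, i != v -> j != v ->
     'X_i ^+ N * kill v (V j) - 'X_j ^+ N * kill v (V i) = f * c i j) ->
  exists r (D : 'I_4 -> R), [/\ kill v r = r, forall i, kill v (D i) = D i &
    forall i, i != v -> kill v (V i) = f * D i + 'X_i ^+ N * r].
Proof.
move=> /and5P[vz vt ov zo to] f0 fv cE.
have [zv tv] : iz != v /\ it != v by rewrite ![_ == v]eq_sym.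
have Xz0 : 'X_iz ^+ N != 0 :> R by rewrite expf_neq0 ?X_neq0.
have [|D DE] := @koszul_Xn K (fun i => i != v) N c iz it o zv tv ov isT zo to.
  move=> i j l iNv jNv lNv; apply: (mulfI f0).
  by rewrite mulr0 mulrDr mulrBr ![f * ('X_ _ ^+ _ * _)]mulrCA -!cE //; ring.
have E i : i != v -> 'X_iz ^+ N * (kill v (V i) - f * D i) =
    'X_i ^+ N * (kill v (V iz) - f * D iz).
  move=> iNv; have := cE iz i zv iNv; rewrite DE // => H.
  apply/eqP; rewrite -subr_eq0; apply/eqP.
  transitivity ('X_iz ^+ N * kill v (V i) - 'X_i ^+ N * kill v (V iz) -
    f * ('X_iz ^+ N * D i - 'X_i ^+ N * D iz)); first ring.
  by rewrite H subrr.
have [r [_ rE]] := regular_pairP Xz0 (@regular_pair_Xn K iz it N N isT) (E it tv).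
have VE i : i != v -> kill v (V i) = f * D i + 'X_i ^+ N * r.
  move=> iNv; rewrite -[LHS](subrK (f * D i)) addrC; congr (_ + _).
  by apply: (mulfI Xz0); rewrite E // rE; ring.
exists (kill v r), (fun i => kill v (D i)); split=> [|i|i iNv]; rewrite ?killK //.
have := congr1 (kill v) (VE i iNv).
by rewrite killK killD !killM killXn fv killX (negbTE iNv).
Qed.

End PlaneSections.

(** The standard 0-cochain of rational functions whose boundary generates the
    first cohomology of the ideal sheaf, given by its numerators over
    [X_i ^+ n].  Where the variable [X_i] is [z] or [t], the identity
    [X_i ^+ n = F * al i - G * be i] expresses that [F] and [G] generate the unit
    ideal on the line [x = y = 0]; the other two fractions are [0] and [h].  The
    choice of [plane_eqn * al i + y * B * be i] makes the restrictions to the planes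
    [y = 0] and [x = 0] differ from [0] and from [h] by multiples of the equations
    of the two parts of the curve. *)
HB.lock Definition rao_num (K : fieldType) (h F G A B : {mpoly K[4]}) (n : nat)
    (al be : 'I_4 -> {mpoly K[4]}) (i : 'I_4) : {mpoly K[4]} :=
  if i == iy then 'X_iy ^+ n * h
  else plane_eqn ix h F A * al i + 'X_iy * B * be i.

Section CurveIdeal.
Variable K : fieldType.
Local Notation R := {mpoly K[4]}.
Local Notation x := ('X_ix : R).
Local Notation y := ('X_iy : R).
Local Notation ex := (kill ix).
Local Notation ey := (kill iy).
Variables h F G A B : R.
Hypotheses (hx : ex h = h) (hy : ey h = h) (Fx : ex F = F) (Fy : ey F = F).
Hypotheses (Gx : ex G = G) (Gy : ey G = G) (Ay : ey A = A) (Bx : ex B = B).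
Local Notation g := (plane_eqn ix h F A).
Local Notation k := (plane_eqn iy h G B).
Local Notation q := (link_eqn h F G A B).
Hypotheses (g0 : g != 0) (k0 : k != 0) (F0 : F != 0).
Local Notation I := (gen_ideal (curve_generators h F G A B)).
Local Notation e0 p := (ex (ey p)).

Let killXE := (@killX K).
Let morE := (killD, killB, killN, killM, killXn, kill0).
Let e0K : (forall p : R, e0 (ey p) = e0 p) * (forall p : R, e0 (ex p) = e0 p).
Proof. by split=> p; rewrite ?killK // [ey _]killC killK. Qed.
Let varE : (ex x = 0) * (ex y = y) * (ey x = x) * (ey y = 0).
Proof. by rewrite !killXE. Qed.

Lemma curve_idealP u : ideal_set I u <->
  exists e1 e2 e3 e4, u = e1 * (x * y) + e2 * (x * g) + e3 * (y * k) + e4 * q.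
Proof.
split=> [/gen4P|] [e1 [e2 [e3 [e4 ->]]]]; last apply/gen4P;
  exists e1, e2, e3, e4; rewrite plane_eqn.unlock link_eqn.unlock; ring.
Qed.

Lemma ey_g : ey g = g. Proof. by rewrite plane_eqn.unlock !morE !varE Ay hy Fy. Qed.
Lemma ex_k : ex k = k. Proof. by rewrite plane_eqn.unlock !morE !varE Bx hx Gx. Qed.
Lemma ex_g : ex g = h * F.
Proof. by rewrite plane_eqn.unlock !morE !varE hx Fx mul0r add0r. Qed.
Lemma ey_k : ey k = h * G.
Proof. by rewrite plane_eqn.unlock !morE !varE hy Gy mul0r add0r. Qed.
Lemma ey_q : ey q = g * G.
Proof. by rewrite link_eqn.unlock ?plane_eqn.unlock !morE !varE Ay hy Fy Gy; ring. Qed.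
Lemma ex_q : ex q = k * F.
Proof. by rewrite link_eqn.unlock ?plane_eqn.unlock !morE !varE Bx hx Fx Gx; ring. Qed.

(** Dividing the restrictions of an element of [I] to the two planes by the
    equations [g] and [k] gives two polynomials; on the line [x = y = 0] only the
    multiples of [q] contribute to them, so there they are proportional to [G] and
    [F]. *)
Lemma curve_ideal_restrict v al be :
  ideal_set I v -> ey v = g * al -> ex v = k * be ->
  exists s, e0 al = G * s /\ e0 be = F * s.
Proof.
move=> /curve_idealP [e1 [e2 [e3 [e4 ->]]]].
rewrite !morE !varE ey_g ex_k ey_q ex_q => Ey Ex.
have alE : al = ey e2 * x + ey e4 * G.
  by apply: (mulfI g0); rewrite -Ey; ring.
have beE : be = ex e3 * y + ex e4 * F.
  by apply: (mulfI k0); rewrite -Ex; ring.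
exists (e0 e4); rewrite alE beE !morE !varE Fy Gy !morE Fx Gx !e0K.
by split; ring.
Qed.

Lemma kill_xy0 u : ex u = 0 -> ey u = 0 -> exists w, u = w * (x * y).
Proof.
have [u1 ->] := kill_ex iy u => E1 E2.
have E : kill iy u = 0 by move: E2; rewrite !morE !varE killK mul0r addr0.
move: E1; rewrite E add0r !morE !varE => /eqP.
rewrite mulf_eq0 (negbTE (X_neq0 _ _)) /= => /eqP E1.
have [u2 ->] := kill_ex ix u1; exists u2; rewrite E1; ring.
Qed.

Hypothesis FG : regular_pair F G.

(** The converse: since [F] and [G] are coprime, the hypothesis makes the quotients
    proportional to [G] and [F] on the line.  Subtracting a multiple of [q] makes
    them vanish there; then subtracting multiples of [x * g] and [y * k] leaves an
    element that vanishes on both planes. *)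
Lemma curve_ideal_lift v al be :
  ey v = g * al -> ex v = k * be -> F * e0 al = G * e0 be -> ideal_set I v.
Proof.
move=> Ey Ex /(regular_pairP F0 FG) [s0 [Ea Eb]].
pose s := e0 s0.
have sx : ex s = s by rewrite /s killK.
have sy : ey s = s by rewrite /s killC killK.
have {}Ea : e0 al = G * s.
  have := congr1 (fun p => e0 p) Ea; rewrite !morE Gy Gx -/s => <-.
  by rewrite [ey (ex _)]killC !killK.
have {}Eb : e0 be = F * s.
  have := congr1 (fun p => e0 p) Eb; rewrite !morE Fy Fx -/s => <-.
  by rewrite [ey (ex _)]killC !killK.
have [a1 a1E] := kill_ex ix (ey al); have [b1 b1E] := kill_ex iy (ex be).
have {}a1E : ey al = G * s + x * ey a1.
  by have := congr1 ey a1E; rewrite !morE killK varE [ey (ex _)]killC killK Ea.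
have {}b1E : ex be = F * s + y * ex b1.
  have := congr1 ex b1E; rewrite !morE killK varE [ey (ex _)]killC killK.
  by rewrite Eb.
have [|| w wE] := @kill_xy0 (v - q * s - x * g * ey a1 - y * k * ex b1).
- rewrite !morE !varE ex_q sx ex_k killK Ex.
  by have := congr1 ex Ex; rewrite !morE killK ex_k Ex => ->; rewrite b1E; ring.
- rewrite !morE !varE ey_q sy ey_g killK Ey.
  by have := congr1 ey Ey; rewrite !morE killK ey_g Ey => ->; rewrite a1E; ring.
apply/curve_idealP; exists w, (ey a1), (ex b1), s.
by rewrite -wE; ring.
Qed.

Variables (n : nat) (al be : 'I_4 -> R).
Hypotheses (alx : forall i, ex (al i) = al i) (aly : forall i, ey (al i) = al i).
Hypotheses (bex : forall i, ex (be i) = be i) (bey : forall i, ey (be i) = be i).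
Hypothesis be1 : be iy = 0.
Hypothesis bezout : forall i, i != ix -> i != iy ->
  'X_i ^+ n = F * al i - G * be i.

Local Notation W := (rao_num h F G A B n al be).

Lemma ey_rao i : i != iy -> ey (W i) = g * al i.
Proof.
by rewrite rao_num.unlock => /negbTE ->; rewrite !morE ey_g aly !varE; ring.
Qed.

Lemma ex_rao i : i != ix -> ex (W i) = k * be i + h * 'X_i ^+ n.
Proof.
move=> iNx; rewrite rao_num.unlock; case: eqVneq => [->|iNy].
  by rewrite be1 !morE !varE hx; ring.
rewrite bezout // !morE ex_g !varE alx bex Bx ?plane_eqn.unlock; ring.
Qed.

Lemma e0X i : (i == ix) || (i == iy) -> e0 ('X_i : R) = 0.
Proof. by case/orP => /eqP ->; rewrite !varE ?kill0. Qed.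

Lemma exX i : i != ix -> ex 'X_i = 'X_i :> R.
Proof. by rewrite killX => /negbTE ->. Qed.
Lemma eyX i : i != iy -> ey 'X_i = 'X_i :> R.
Proof. by rewrite killX => /negbTE ->. Qed.

Lemma e0X' i : i != ix -> i != iy -> e0 'X_i = 'X_i :> R.
Proof. by move=> hi hi'; rewrite eyX ?exX. Qed.

Let e0al i : e0 (al i) = al i. Proof. by rewrite aly alx. Qed.
Let e0be i : e0 (be i) = be i. Proof. by rewrite bey bex. Qed.
Let e0F : e0 F = F. Proof. by rewrite Fy Fx. Qed.
Let e0G : e0 G = G. Proof. by rewrite Gy Gx. Qed.
Let e0E := (e0al, e0be, e0F, e0G).

Lemma rao_cocycle i j :
  ideal_set I ('X_i * 'X_j * ('X_i ^+ n * W j - 'X_j ^+ n * W i)).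
Proof.
pose a := if (i == iy) || (j == iy) then 0 else
  'X_i * 'X_j * ('X_i ^+ n * al j - 'X_j ^+ n * al i).
pose b := if (i == ix) || (j == ix) then 0 else
  'X_i * 'X_j * ('X_i ^+ n * be j - 'X_j ^+ n * be i).
apply: (@curve_ideal_lift _ a b).
- rewrite /a; case: eqVneq => [->|iNy] /=.
    by rewrite !morE !varE; ring.
  case: eqVneq => [->|jNy]; first by rewrite !morE !varE; ring.
  by rewrite !morE !ey_rao // !eyX //; ring.
- rewrite /b; case: eqVneq => [->|iNx] /=.
    by rewrite !morE !varE; ring.
  case: eqVneq => [->|jNx]; first by rewrite !morE !varE; ring.
  by rewrite !morE !ex_rao // !exX //; ring.
have [hi|] := boolP ((i == ix) || (i == iy)).
  suff [-> ->] : e0 a = 0 /\ e0 b = 0 by rewrite !mulr0.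
  by rewrite /a /b; split; case: ifP => _; rewrite ?kill0 // !morE (e0X hi); ring.
have [hj|] := boolP ((j == ix) || (j == iy)).
  suff [-> ->] : e0 a = 0 /\ e0 b = 0 by rewrite !mulr0.
  by rewrite /a /b; split; case: ifP => _; rewrite ?kill0 // !morE (e0X hj); ring.
rewrite !negb_or => /andP[jx jy] /andP[iNx iNy].
rewrite /a /b !(negbTE jx) !(negbTE jy) !(negbTE iNx) !(negbTE iNy) /=.
rewrite !morE !e0X' // !e0E.
by rewrite (bezout jx jy) (bezout iNx iNy); ring.
Qed.

(** The global sections [0], [y * h], [g] and [- (y * B)] correct the multiples of
    the standard cochain by [x], [y], [F] and [G] to cochains of [I]. *)
Lemma rao_annihilator p : ideal_set (gen_ideal [:: x; y; F; G]) p ->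
  exists r, forall i, ideal_set I ('X_i * (p * W i - 'X_i ^+ n * r)).
Proof.
move=> /gen4P [c1 [c2 [c3 [c4 ->]]]].
exists (c2 * (y * h) + c3 * g - c4 * (y * B)) => i.
have h1 : ideal_set I ('X_i * (x * W i)).
  apply: (@curve_ideal_lift _ (if i == iy then 0 else 'X_i * (x * al i)) 0).
  - case: eqVneq => [->|iNy]; first by rewrite !morE !varE; ring.
    by rewrite !morE ey_rao // eyX // varE; ring.
  - by rewrite !morE varE; ring.
  - by case: ifP => _; rewrite ?kill0 ?mulr0 // !morE !varE; ring.
have h2 : ideal_set I ('X_i * (y * W i - 'X_i ^+ n * (y * h))).
  apply: (@curve_ideal_lift _ 0 (if i == ix then 0 else 'X_i * (y * be i))).
  - by rewrite !morE !varE; ring.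
  - case: eqVneq => [->|iNx]; first by rewrite !morE !varE; ring.
    by rewrite !morE ex_rao // exX // varE hx; ring.
  - by case: ifP => _; rewrite ?kill0 ?mulr0 // !morE !varE kill0; ring.
have h3 : ideal_set I ('X_i * (F * W i - 'X_i ^+ n * g)).
  apply: (@curve_ideal_lift _ (if i == iy then 0 else 'X_i * (F * al i - 'X_i ^+ n))
    (if i == ix then 0 else 'X_i * (F * be i))).
  - case: eqVneq => [->|iNy]; first by rewrite !morE !varE; ring.
    by rewrite !morE ey_rao // eyX // Fy ey_g; ring.
  - case: eqVneq => [->|iNx]; first by rewrite !morE !varE; ring.
    by rewrite !morE ex_rao // exX // ex_g Fx; ring.
  - have [hi|] := boolP ((i == ix) || (i == iy)).
      by do 2!case: ifP => _; rewrite ?kill0 ?mulr0 // !morE (e0X hi); ring.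
    rewrite negb_or => /andP[iNx iNy]; rewrite (negbTE iNx) (negbTE iNy).
    by rewrite !morE !e0X' // !e0E bezout //; ring.
have h4 : ideal_set I ('X_i * (G * W i + 'X_i ^+ n * (y * B))).
  apply: (@curve_ideal_lift _ (if i == iy then 0 else 'X_i * (G * al i))
    (if i == ix then 0 else 'X_i * (G * be i + 'X_i ^+ n))).
  - case: eqVneq => [->|iNy]; first by rewrite !morE !varE; ring.
    by rewrite !morE ey_rao // eyX // Gy varE; ring.
  - case: eqVneq => [->|iNx]; first by rewrite !morE !varE; ring.
    by rewrite !morE ex_rao // exX // varE Gx Bx ?plane_eqn.unlock; ring.
  - have [hi|] := boolP ((i == ix) || (i == iy)).
      by do 2!case: ifP => _; rewrite ?kill0 ?mulr0 // !morE (e0X hi); ring.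
    rewrite negb_or => /andP[iNx iNy]; rewrite (negbTE iNx) (negbTE iNy).
    by rewrite !morE !e0X' // !e0E bezout //; ring.
have -> : 'X_i * ((c1 * x + c2 * y + c3 * F + c4 * G) * W i -
      'X_i ^+ n * (c2 * (y * h) + c3 * g - c4 * (y * B))) =
    c1 * ('X_i * (x * W i)) + c2 * ('X_i * (y * W i - 'X_i ^+ n * (y * h))) +
    c3 * ('X_i * (F * W i - 'X_i ^+ n * g)) +
    c4 * ('X_i * (G * W i + 'X_i ^+ n * (y * B))) by ring.
by do !apply: idealD; apply: idealM.
Qed.

(** Compare the restrictions of [r]: on the chart of [z] and on that of [t] they
    are congruent to [0] modulo [g] and to [p * h] modulo [k], hence they are so
    globally, with quotients [a'] and [b'].  On the line, the condition for
    membership in [I] then reads [p = F * a' - G * b']. *)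
Lemma rao_kernel p r m :
  (forall i, ideal_set I ('X_i ^+ m * (p * W i - 'X_i ^+ n * r))) ->
  ideal_set (gen_ideal [:: x; y; F; G]) p.
Proof.
move=> Ip.
have rk i : exists a b,
   [/\ ey ('X_i ^+ m * (p * W i - 'X_i ^+ n * r)) = g * a &
       ex ('X_i ^+ m * (p * W i - 'X_i ^+ n * r)) = k * b].
  have /curve_idealP [e1 [e2 [e3 [e4 ->]]]] := Ip i.
  exists (ey e2 * x + ey e4 * G), (ex e3 * y + ex e4 * F).
  by rewrite !morE !varE ey_g ex_k ey_q ex_q; split; ring.
have [az [bz [azE bzE]]] := rk iz; have [at_ [bt [atE btE]]] := rk it.
have zt : regular_pair ('X_iz ^+ (m + n) : R) ('X_it ^+ (m + n)).
  exact: regular_pair_Xn.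
have Xz0 : 'X_iz ^+ (m + n) != 0 :> R by rewrite expf_neq0 ?X_neq0.
have [a' a'E] : exists a', ey r = g * a'.
  apply: (@dvd_of_charts _ _ _ _ _ ('X_iz ^+ m * (ey p * al iz) - az)
    ('X_it ^+ m * (ey p * al it) - at_) g0 Xz0 zt).
    move: azE; rewrite !morE ey_rao // eyX // => azE; rewrite [RHS]mulrBr -azE.
    by rewrite exprD; ring.
  move: atE; rewrite !morE ey_rao // eyX // => atE; rewrite [RHS]mulrBr -atE.
  by rewrite exprD; ring.
have [b' b'E] : exists b', ex r - ex p * h = k * b'.
  apply: (@dvd_of_charts _ _ _ _ _ ('X_iz ^+ m * (ex p * be iz) - bz)
    ('X_it ^+ m * (ex p * be it) - bt) k0 Xz0 zt).
    move: bzE; rewrite !morE ex_rao // exX // => bzE; rewrite [RHS]mulrBr -bzE.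
    by rewrite exprD; ring.
  move: btE; rewrite !morE ex_rao // exX // => btE; rewrite [RHS]mulrBr -btE.
  by rewrite exprD; ring.
have [||s [sa sb]] := curve_ideal_restrict (Ip iz)
  (al := 'X_iz ^+ m * (ey p * al iz - 'X_iz ^+ n * a'))
  (be := 'X_iz ^+ m * (ex p * be iz - 'X_iz ^+ n * b')).
- rewrite !morE ey_rao // eyX // a'E; ring.
- rewrite !morE ex_rao // exX // -[ex r](subrK (ex p * h)) b'E; ring.
have E : e0 p = F * e0 a' - G * e0 b'.
  apply: (mulfI (expf_neq0 (m + n) (X_neq0 K iz))).
  have : F * (G * s) = G * (F * s) by ring.
  rewrite -sa -sb !morE !e0X' // !e0E killK [ey (ex p)]killC killK => E.
  apply/eqP; rewrite -subr_eq0; apply/eqP.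
  rewrite exprD {2}(bezout (i := iz)) //.
  transitivity ('X_iz ^+ m * ((F * al iz - G * be iz) * e0 p
     - 'X_iz ^+ n * (F * e0 a' - G * e0 b'))).
    by rewrite -bezout //; ring.
  move/eqP: E; rewrite -subr_eq0 => /eqP <-; ring.
have [p1 p1E] := kill_ex ix (ey p); have [p2 ->] := kill_ex iy p.
apply/gen4P; exists p1, p2, (e0 a'), (- e0 b').
by rewrite p1E E; ring.
Qed.

(** A 0-cochain [V] with boundary in [I] is, on each plane, the sum of a global
    section [r1] or [r2] and of a cochain [D] or [E] multiplied by the equation of
    the curve.  On the line, [F * D i - G * E i] does not depend on the chart, so it
    comes from a polynomial [p].  Subtracting [p] times the standard cochain
    reduces to [p = 0]: then [r1] and [r2] agree on the line and come from a global
    section, and what is left is in [I] by [curve_ideal_lift]. *)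
Lemma rao_generates N (V : 'I_4 -> R) :
  (forall i j, ideal_set I ('X_i ^+ N * V j - 'X_j ^+ N * V i)) ->
  exists p r, forall i, ideal_set I
    ('X_i * ('X_i ^+ n * V i - 'X_i ^+ N * p * W i - 'X_i ^+ (N + n) * r)).
Proof.
move=> IV.
have XN0 i : 'X_i ^+ N != 0 :> R by rewrite expf_neq0 ?X_neq0.
have /choice [c cE] (ij : 'I_4 * 'I_4) : exists ab : R * R,
   let v := 'X_ij.1 ^+ N * V ij.2 - 'X_ij.2 ^+ N * V ij.1 in
   ey v = g * ab.1 /\ ex v = k * ab.2.
  have /curve_idealP [e1 [e2 [e3 [e4 vE]]]] := IV ij.1 ij.2.
  exists (ey e2 * x + ey e4 * G, ex e3 * y + ex e4 * F) => v.
  by rewrite /v vE !morE !varE ey_g ex_k ey_q ex_q; split; rewrite /=; ring.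
have [|||i j iNy jNy|r1 [D [r1y Dy DE]]] := @plane_sections K iy ix g N V
    (fun i j => (c (i, j)).1) => //; first exact: ey_g.
  by have [<- _] := cE (i, j); rewrite !morE !eyX.
have [|||i j iNx jNx|r2 [E [r2x Ex EE]]] := @plane_sections K ix iy k N V
    (fun i j => (c (i, j)).2) => //; first exact: ex_k.
  by have [_ <-] := cE (i, j); rewrite !morE !exX.
pose S i := F * ex (D i) - G * ey (E i).
have SE : 'X_iz ^+ N * S it = 'X_it ^+ N * S iz.
  have [||s [sa sb]] := curve_ideal_restrict (IV iz it)
    (al := 'X_iz ^+ N * D it - 'X_it ^+ N * D iz)
    (be := 'X_iz ^+ N * E it - 'X_it ^+ N * E iz).
  - by rewrite !morE !eyX // !DE //; ring.
  - by rewrite !morE !exX // !EE //; ring.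
  have : F * (G * s) = G * (F * s) by ring.
  rewrite -sa -sb !morE !e0X' // !Dy [ex (ey (E _))]killC ![ex (ey (E _))]killC !Ex => H.
  by apply/eqP; rewrite -subr_eq0; apply/eqP; rewrite /S;
    move/eqP: H; rewrite -subr_eq0 => /eqP <-; ring.
have [p [StE SzE]] := regular_pairP (XN0 iz)
  (@regular_pair_Xn K iz it N N isT) SE.
have px : ex p = p.
  apply: (mulfI (XN0 iz)); rewrite -SzE.
  have := congr1 ex SzE; rewrite /S !morE exX // => <-.
  by rewrite Fx Gx killK [ex (ey _)]killC !Ex.
have py : ey p = p.
  apply: (mulfI (XN0 iz)); rewrite -SzE.
  have := congr1 ey SzE; rewrite /S !morE eyX // => <-.
  by rewrite Fy Gy killK [ey (ex _)]killC !Dy.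
have SpE i : i != ix -> i != iy -> S i = 'X_i ^+ N * p.
  case: (ord4P i) => ->; first by rewrite eqxx.
  - by move=> _; rewrite eqxx.
  - by move=> _ _; apply: SzE.
  - by move=> _ _; apply: StE.
have hp : h * p = ey r2 - ex r1.
  apply: (mulfI (XN0 iz)); rewrite mulrCA -SzE.
  have : ex (ey (V iz)) = ey (ex (V iz)) by rewrite killC.
  rewrite DE // EE // !morE ex_g ey_k exX // eyX // /S => H.
  apply/eqP; rewrite -subr_eq0; apply/eqP.
  by move/eqP: H; rewrite -subr_eq0 => /eqP <-; ring.
exists p, (r1 + r2 - h * p - ex r1) => i.
apply: (@curve_ideal_lift _
  (if i == iy then 0 else 'X_i * ('X_i ^+ n * D i - 'X_i ^+ N * p * al i))
  (if i == ix then 0 else 'X_i * ('X_i ^+ n * E i - 'X_i ^+ N * p * be i))).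
- case: eqVneq => [->|iNy]; first by rewrite !morE !varE; ring.
  rewrite !morE ey_rao // !eyX // DE // r1y hy py [ey (ex r1)]killC r1y hp.
  by rewrite exprD; ring.
- case: eqVneq => [->|iNx]; first by rewrite !morE !varE; ring.
  rewrite !morE ex_rao // !exX // EE // r2x hx px killK.
  by rewrite exprD; ring.
have [hi|] := boolP ((i == ix) || (i == iy)).
  by do 2!case: ifP => _; rewrite ?kill0 ?mulr0 // !morE (e0X hi); ring.
rewrite negb_or => /andP[iNx iNy]; rewrite (negbTE iNx) (negbTE iNy).
rewrite !morE !e0X' // !e0E py px Dy [ex (ey (E i))]killC Ex.
have := SpE i iNx iNy; rewrite /S => H.
apply/eqP; rewrite -subr_eq0; apply/eqP.
transitivity ('X_i * ('X_i ^+ n * (F * ex (D i) - G * ey (E i)) -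
  'X_i ^+ N * p * (F * al i - G * be i))); first ring.
by rewrite H -bezout //; ring.
Qed.

End CurveIdeal.

(** * First cohomology through numerators *)

Lemma fracB (E : fieldType) (a b u v : E) n : a != 0 -> b != 0 ->
  u / b ^+ n - v / a ^+ n = (a ^+ n * u - b ^+ n * v) / (a * b) ^+ n.
Proof. by move=> a0 b0; rewrite exprMn; field; rewrite !expf_neq0. Qed.

Lemma frac_widen (E : fieldType) (a u : E) m n : a != 0 -> (m <= n)%N ->
  u / a ^+ m = a ^+ (n - m) * u / a ^+ n.
Proof.
move=> a0 mn; rewrite -{2}(subnK mn) exprD invfM mulrACA divff ?mul1r //.
by rewrite expf_neq0.
Qed.

Lemma frac_cocycle (E : fieldType) (a b d u v w : E) n :
  a != 0 -> b != 0 -> d != 0 ->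
  (a * b * d) ^+ n * (u / (b * d) ^+ n - v / (a * d) ^+ n + w / (a * b) ^+ n) =
  a ^+ n * u - b ^+ n * v + d ^+ n * w.
Proof. by move=> a0 b0 d0; rewrite !exprMn; field; rewrite !expf_neq0. Qed.

Lemma frac_addX (E : fieldType) (a u v : E) m n : a != 0 ->
  (a ^+ n * u - a ^+ m * v) / a ^+ (m + n) = u / a ^+ m - v / a ^+ n.
Proof. by move=> a0; rewrite exprD; field; rewrite !expf_neq0. Qed.

Section CechNumerators.
Variable K : fieldType.
Local Notation R := {mpoly K[4]}.
Variable J : ideal R.
Hypothesis Jhomog : homogeneous_ideal J.
Implicit Types (i k l : 'I_4) (W : 'I_4 -> R) (j : int).

Lemma toF_inj : injective (@toF K).
Proof.
by move=> p q /eqP; rewrite -subr_eq0 -rmorphB toF_eq0 subr_eq0 => /eqP.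
Qed.

Lemma toFX_neq0 i : toF ('X_i : R) != 0.
Proof. by rewrite toF_eq0 X_neq0. Qed.

Lemma ideal_zpi d p : ideal_set J p -> ideal_set J (zpi d p).
Proof. by case: d => n Jp; [apply: Jhomog | apply: ideal0]. Qed.

Definition num_boundary (N : nat) W (i k : 'I_4) : fracR K :=
  toF (W k) / toF 'X_k ^+ N - toF (W i) / toF 'X_i ^+ N.

Lemma num_boundaryE N W i k : num_boundary N W i k =
  toF ('X_i ^+ N * W k - 'X_k ^+ N * W i) / toF ('X_i * 'X_k) ^+ N.
Proof. by rewrite /num_boundary fracB ?toFX_neq0 // rmorphB !rmorphM !rmorphXn. Qed.

(** The fractions of a cocycle have numerators, over a common exponent, that
    satisfy the Koszul relations, so that [koszul_Xn] applies: line bundles on the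
    projective space have no first cohomology. *)
Lemma cocycle_num j c : c \in cocycle1 J j -> exists N W,
  [/\ forall i, zhomog (j + N%:Z) (W i),
      forall i k, ideal_set J ('X_i ^+ N * W k - 'X_k ^+ N * W i) &
      c = num_boundary N W].
Proof.
move=> /cocycle1P [hc zc].
have /choice [n /choice [p hp]] : forall ik : 'I_4 * 'I_4, exists n p,
    [/\ ideal_set J p, zhomog (j + 2%:Z * n%:Z) p &
      c ik.1 ik.2 = toF p / toF ('X_ik.1 * 'X_ik.2) ^+ n].
  by move=> ik; have [n [p hp]] := hc ik.1 ik.2; exists n, p.
pose N := (\max_ik n ik)%N.
have nN ik : (n ik <= N)%N by apply: (leq_bigmax ik).
pose P i k := ('X_i * 'X_k) ^+ (N - n (i, k)) * p (i, k).
have PJ i k : ideal_set J (P i k).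
  by apply: idealM; case: (hp (i, k)).
have Phom i k : zhomog (j + N%:Z + N%:Z) (P i k).
  have [_ hpik _] := hp (i, k).
  have -> : j + N%:Z + N%:Z = 2%:Z * (N - n (i, k))%N%:Z + (j + 2%:Z * (n (i, k))%:Z).
    by rewrite -(subzn (nN (i, k))); ring.
  apply: zhomogM => //; apply: zhomogXn.
  by apply: (@zhomogM _ 1 1); apply: zhomogX.
have cE i k : c i k = toF (P i k) / toF ('X_i * 'X_k) ^+ N.
  have [_ _ /= ->] := hp (i, k).
  have XX0 : toF ('X_i * 'X_k : R) != 0 by rewrite rmorphM mulf_neq0 ?toFX_neq0.
  by rewrite (frac_widen _ XX0 (nN (i, k))) -rmorphXn -rmorphM.
clearbody P.
have rel i k l : 'X_i ^+ N * P k l - 'X_k ^+ N * P i l + 'X_l ^+ N * P i k = 0.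
  apply: toF_inj; rewrite rmorph0 rmorphD rmorphB !rmorphM !rmorphXn.
  rewrite -(frac_cocycle _ _ _ _ (toFX_neq0 i) (toFX_neq0 k) (toFX_neq0 l)).
  have XXE a b : toF 'X_a * toF 'X_b = toF ('X_a * 'X_b : R) by rewrite rmorphM.
  rewrite [toF 'X_k * _]XXE [toF 'X_i * toF 'X_l]XXE [in X in _ + X]XXE.
  by rewrite -!cE zc mulr0.
have [d dE] := @koszul_Xn K (fun=> True) N P iz it ix I I I isT isT isT
  (fun i k l _ _ _ => rel i k l).
have PE i k : P i k =
    'X_i ^+ N * zpi (j + N%:Z) (d k) - 'X_k ^+ N * zpi (j + N%:Z) (d i).
  rewrite -[LHS](zpi_id (Phom i k)) dE // linearB /=.
  by rewrite !(zpiM_sub _ _ (zhomogXX _ _ _)) addrK.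
exists N, (fun i => zpi (j + N%:Z) (d i)); split=> [i|i k|].
- exact: zpiP.
- by rewrite -PE.
by apply/funext => i; apply/funext => k; rewrite num_boundaryE -PE.
Qed.

Lemma num_cocycle j N W m :
  (forall i, zhomog (j + N%:Z) (W i)) ->
  (forall i k, ideal_set J
     (('X_i * 'X_k) ^+ m * ('X_i ^+ N * W k - 'X_k ^+ N * W i))) ->
  num_boundary N W \in cocycle1 J j.
Proof.
move=> hW JW; apply/cocycle1P; split=> [i k|i k l]; last first.
  by rewrite /num_boundary; ring.
exists (m + N)%N, (('X_i * 'X_k) ^+ m * ('X_i ^+ N * W k - 'X_k ^+ N * W i)).
split=> //.
  have -> : j + 2%:Z * (m + N)%N%:Z = 2%:Z * m%:Z + (N%:Z + (j + N%:Z)).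
    by rewrite PoszD; ring.
  apply: zhomogM; last by apply: zhomogB; apply: zhomogM => //; apply: zhomogXX.
  by apply: zhomogXn; apply: (@zhomogM _ 1 1); apply: zhomogX.
have XX0 : toF ('X_i * 'X_k : R) != 0 by rewrite rmorphM mulf_neq0 ?toFX_neq0.
by rewrite num_boundaryE (frac_widen _ XX0 (leq_addl m N)) addnK -rmorphXn -rmorphM.
Qed.

(** If the boundary of [W i / X_i ^+ N] is that of a cochain [b] of the ideal, the
    differences [W i / X_i ^+ N - b i] glue to a polynomial [r]. *)
Lemma coboundary_num j N W : num_boundary N W \in coboundary1 J j ->
  exists r m, forall i, ideal_set J ('X_i ^+ m * (W i - 'X_i ^+ N * r)).
Proof.
move=> /coboundary1P [b hb bE].
have /choice [n /choice [p hp]] : forall i : 'I_4, exists n p,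
    [/\ ideal_set J p, zhomog (j + 1%:Z * n%:Z) p & b i = toF p / toF 'X_i ^+ n].
  by move=> i; have [n [p hp]] := hb i; exists n, p.
pose M := (\max_i n i)%N.
have nM i : (n i <= M)%N by apply: (leq_bigmax i).
pose Q i := 'X_i ^+ (M - n i) * p i.
have QJ i : ideal_set J (Q i) by apply: idealM; case: (hp i).
have bE' i : b i = toF (Q i) / toF 'X_i ^+ M.
  have [_ _ ->] := hp i.
  by rewrite (frac_widen _ _ (nM i)) ?toFX_neq0 // /Q rmorphM rmorphXn.
clearbody Q.
have [U UdE] : exists U : 'I_4 -> R, forall i, U i = 'X_i ^+ M * W i - 'X_i ^+ N * Q i.
  by eexists => i.
have UE i k : 'X_i ^+ (N + M) * U k = 'X_k ^+ (N + M) * U i.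
  have UF l : toF (U l) = toF 'X_l ^+ (N + M) * (toF (W l) / toF 'X_l ^+ N - b l).
    rewrite bE' -(frac_addX _ _ _ _ (toFX_neq0 l)) mulrC divfK.
      by rewrite UdE rmorphB !rmorphM !rmorphXn.
    by rewrite expf_neq0 // toFX_neq0.
  apply: toF_inj; rewrite !rmorphM !rmorphXn /= !UF mulrCA; congr (_ * (_ * _)).
  apply/eqP; rewrite -subr_eq0; apply/eqP.
  have /eqP := bE i k; rewrite -subr_eq0 => /eqP <-.
  by rewrite /num_boundary; ring.
have Xz0 : 'X_iz ^+ (N + M) != 0 :> R by rewrite expf_neq0 ?X_neq0.
have [r [_ rE]] := regular_pairP Xz0
  (@regular_pair_Xn K iz it (N + M) (N + M) isT) (UE iz it).
exists r, M => i.
have UrE : U i = 'X_i ^+ (N + M) * r.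
  by apply: (mulfI Xz0); rewrite UE rE mulrCA.
have -> : 'X_i ^+ M * (W i - 'X_i ^+ N * r) = 'X_i ^+ N * Q i.
  have -> : 'X_i ^+ M * (W i - 'X_i ^+ N * r) = 'X_i ^+ M * W i - 'X_i ^+ (N + M) * r.
    by rewrite exprD; ring.
  by rewrite -UrE UdE; ring.
exact: idealM.
Qed.

Lemma num_coboundary j N W r m : zhomog j r ->
  (forall i, zhomog (j + N%:Z) (W i)) ->
  (forall i, ideal_set J ('X_i ^+ m * (W i - 'X_i ^+ N * r))) ->
  num_boundary N W \in coboundary1 J j.
Proof.
move=> hr hW JW; apply/coboundary1P.
exists (fun i => toF (W i) / toF 'X_i ^+ N - toF r) => [i|i k]; last first.
  by rewrite /num_boundary; ring.
exists (N + m)%N, ('X_i ^+ m * (W i - 'X_i ^+ N * r)); split=> //.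
  have -> : j + 1%:Z * (N + m)%N%:Z = m%:Z + (j + N%:Z) by rewrite PoszD; ring.
  apply: zhomogM; first exact: zhomogXX.
  by apply: zhomogB => //; rewrite addrC; apply: zhomogM => //; apply: zhomogXX.
have -> : 'X_i ^+ m * (W i - 'X_i ^+ N * r) =
    'X_i ^+ m * W i - 'X_i ^+ N * ('X_i ^+ m * r).
  by ring.
rewrite rmorphB !rmorphM !rmorphXn frac_addX ?toFX_neq0 //.
by rewrite mulrAC divff ?mul1r // expf_neq0 // toFX_neq0.
Qed.

Lemma num_boundaryM N W p i k :
  toF p * num_boundary N W i k = num_boundary N (fun i => p * W i) i k.
Proof. by rewrite /num_boundary !rmorphM; ring. Qed.

Lemma num_boundaryB N n V W : num_boundary N V - num_boundary n W =
  num_boundary (N + n) (fun i => 'X_i ^+ n * V i - 'X_i ^+ N * W i).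
Proof.
apply/funext => i; apply/funext => k.
rewrite -[LHS]/(num_boundary N V i k - num_boundary n W i k) /num_boundary.
rewrite !rmorphB !rmorphM !rmorphXn !frac_addX ?toFX_neq0 //.
by rewrite !opprB addrACA [RHS]addrACA; congr (_ + _); rewrite addrC.
Qed.

End CechNumerators.

(** * The Hartshorne-Rao module as a quotient *)

Section LinearMaps.
Variable K : fieldType.

Lemma linear_of (V W : lmodType K) (f : V -> W) : linear f ->
  exists g : {linear V -> W}, g =1 f.
Proof.
move=> hf; pose m := GRing.isLinear.Build K V W *:%R f hf.
by exists (HB.pack_for {linear V -> W} f m).
Qed.

Lemma linear_inverse (V W : lmodType K) (f : {linear V -> W}) : bijective f ->
  exists g : {linear W -> V}, cancel f g /\ cancel g f.
Proof.
move=> [g fK gK]; have glin : linear g.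
  by move=> a u v; apply: (can_inj fK); rewrite linearP !gK.
have [g' g'E] := linear_of glin.
by exists g'; split=> u; rewrite g'E ?fK ?gK.
Qed.

Lemma submod_rpredB (V : lmodType K) (Z : submodClosed V) u v :
  u \in Z -> v \in Z -> u - v \in Z.
Proof. by move=> hu hv; rewrite -scaleN1r rpredD ?rpredZ. Qed.

Lemma subquot_iso (V V' : lmodType K) (Z B : submodClosed V)
    (Z' B' : submodClosed V') (T : V -> V') :
  linear T ->
  (forall v, v \in Z -> T v \in Z') ->
  (forall v, v \in Z -> (T v \in B') = (v \in B)) ->
  (forall w, w \in Z' -> exists2 v, v \in Z & w - T v \in B') ->
  exists f : {linear subquot Z B -> subquot Z' B'}, bijective f /\
    forall v, v \in Z -> f (subquot_class Z B v) = subquot_class Z' B' (T v).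
Proof.
move=> Tlin TZ TB Tsurj.
have TBB u v : T (u - v) = T u - T v.
  by rewrite addrC -scaleN1r Tlin scaleN1r addrC.
pose f (m : subquot Z B) := subquot_class Z' B' (T (subquot_repr m)).
have fE v : v \in Z -> f (subquot_class Z B v) = subquot_class Z' B' (T v).
  move=> hv; apply/subquot_classE; rewrite ?TZ ?subquot_reprP //.
  rewrite -TBB TB.
    exact: subquot_repr_class.
  by apply: submod_rpredB; rewrite ?subquot_reprP.
have flin : linear f.
  move=> a m m'; rewrite -{1}(subquot_reprK m) -{1}(subquot_reprK m').
  rewrite -subquot_classP ?subquot_reprP // fE ?rpredD ?rpredZ ?subquot_reprP //.
  by rewrite Tlin subquot_classP ?TZ ?subquot_reprP.
have [g gE] := linear_of flin; exists g; split=> [|v hv]; last by rewrite gE fE.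
have /choice [h hP] : forall m' : subquot Z' B', exists m, f m = m'.
  move=> m'; have [v hv hB] := Tsurj _ (subquot_reprP m').
  exists (subquot_class Z B v); rewrite fE // -[RHS]subquot_reprK.
  by apply/esym/subquot_classE; rewrite ?TZ ?subquot_reprP.
exists h => m; last by rewrite gE hP.
rewrite gE -[RHS]subquot_reprK -[LHS]subquot_reprK.
apply/subquot_classE; rewrite ?subquot_reprP //.
rewrite -TB; last by apply: submod_rpredB; rewrite ?subquot_reprP.
rewrite TBB; apply/(subquot_classE (Z := Z')); rewrite ?TZ ?subquot_reprP //.
exact: (hP (f m)).
Qed.

Lemma giso_sym (M N : gradedModule K) : giso M N -> giso N M.
Proof.
move=> [phi [phi_bij phiE]].
pose psi j := projT1 (cid (linear_inverse (phi_bij j))).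
have psiP j : cancel (phi j) (psi j) /\ cancel (psi j) (phi j).
  exact: projT2 (cid (linear_inverse (phi_bij j))).
exists psi; split=> [j|j k a m ha].
  by have [h1 h2] := psiP j; exists (phi j).
have [h1 _] := psiP k; have [_ h2] := psiP j.
by rewrite -{1}[m]h2 -phiE // h1.
Qed.

Local Notation R := {mpoly K[4]}.

Lemma quotient_mulE (J : ideal R) j k a v : zhomog (k - j) a -> zhomog j v ->
  gmul (quotient_module J) j k a
    (subquot_class (zhomog j : {pred R}) (ideal_pred J) v) =
  subquot_class (zhomog k : {pred R}) (ideal_pred J) (a * v).
Proof.
move=> ha hv; apply: gsubquot_mulE => //.
- by move=> b c p q; rewrite mulrDr scalerAr.
- by move=> b d i p hb hp; apply: zhomogM.
- move=> b d i p _ /ideal_predP hp; apply/ideal_predP; exact: idealM.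
Qed.

Lemma H1_mulE (J : ideal R) j k a c : zhomog (k - j) a -> c \in cocycle1 J j ->
  gmul (H1_star J) j k a (subquot_class (cocycle1 J j) (coboundary1 J j) c) =
  subquot_class (cocycle1 J k) (coboundary1 J k) (fun i l => toF a * c i l).
Proof.
move=> ha hc; apply: (@gsubquot_mulE _ _ (fun a c i k => toF a * c i k)
  (fun j => cocycle1 J j) (fun j => coboundary1 J j)) => //.
- move=> b e u v; apply/funext => i; apply/funext => l.
  rewrite -[LHS]/(toF b * (toF e%:MP * u i l + v i l)).
  by rewrite mulrDr mulrCA.
- move=> b d i u hb /cocycle1P[hu zu]; apply/cocycle1P.
  split=> [l m|l m n]; first exact: loc_partM.
  by rewrite -mulrBr -mulrDr zu mulr0.
- move=> b d i u hb /coboundary1P[w hw wE]; apply/coboundary1P.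
  exists (fun i => toF b * w i) => [l|l m]; first exact: loc_partM.
  by rewrite wE mulrBr.
Qed.

End LinearMaps.

Section RaoModule.
Variable K : fieldType.
Local Notation R := {mpoly K[4]}.
Local Notation x := ('X_ix : R).
Local Notation y := ('X_iy : R).
Local Notation ex := (kill ix).
Local Notation ey := (kill iy).
Variables h F G A B : R.
Hypotheses (hx : ex h = h) (hy : ey h = h) (Fx : ex F = F) (Fy : ey F = F).
Hypotheses (Gx : ex G = G) (Gy : ey G = G) (Ay : ey A = A) (Bx : ex B = B).
Local Notation g := (plane_eqn ix h F A).
Local Notation k := (plane_eqn iy h G B).
Hypotheses (g0 : g != 0) (k0 : k != 0) (F0 : F != 0) (FG : regular_pair F G).
Local Notation I := (gen_ideal (curve_generators h F G A B)).
Local Notation J := (gen_ideal [:: x; y; F; G]).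
Hypothesis Ihomog : homogeneous_ideal I.
Variables (dh dF dG : int).
Hypotheses (h_homog : zhomog dh h) (F_homog : zhomog dF F) (G_homog : zhomog dG G).
Hypotheses (g_homog : zhomog (dh + dF) g) (yB_homog : zhomog (dh + dG) (y * B)).

(** Multiplying the boundary [c] of the standard cochain by polynomials maps [R],
    shifted by the degree of [h], onto the cohomology by [rao_generates]; by
    [rao_annihilator] and [rao_kernel] the polynomials sent to coboundaries are the
    elements of [J]. *)
Lemma hartshorne_rao_quotient n (al be : 'I_4 -> R) :
  (forall i, i != ix -> i != iy -> 'X_i ^+ n = F * al i - G * be i) ->
  giso (H1_star I) (gshift (quotient_module J) (- dh)).
Proof.
move=> bezout; apply: giso_sym.
(* The coefficients are replaced by homogeneous ones free of x and y, which keeps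
   the relation since it is homogeneous and free of x and y. *)
pose nrm d (a : 'I_4 -> R) i :=
  if (i == ix) || (i == iy) then 0 else ex (ey (zpi (n%:Z - d) (a i))).
have nrmx d a i : ex (nrm d a i) = nrm d a i.
  by rewrite /nrm; case: ifP; rewrite ?kill0 ?killK.
have nrmy d a i : ey (nrm d a i) = nrm d a i.
  by rewrite /nrm; case: ifP; rewrite ?kill0 // [ey (ex _)]killC killK.
have nrm_homog d a i : zhomog (n%:Z - d) (nrm d a i).
  rewrite /nrm; case: ifP => _; first exact: zhomog0.
  by do 2!apply: kill_homog; exact: zpiP.
have nrm1 d a : nrm d a iy = 0 by rewrite /nrm eqxx.
pose al' := nrm dF al; pose be' := nrm dG be.
have {}bezout i : i != ix -> i != iy -> 'X_i ^+ n = F * al' i - G * be' i.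
  move=> hi hi'; rewrite /al' /be' /nrm (negbTE hi) (negbTE hi') /=.
  have := congr1 (fun p => ex (ey (zpi n p))) (bezout i hi hi').
  rewrite linearB /= -!/(zpi n%:Z _).
  rewrite (zpiM_sub _ _ F_homog) (zpiM_sub _ _ G_homog).
  rewrite (zpi_id (zhomogXX _ i n)) !killE Fy Gy Fx Gx => <-.
  by rewrite !killX (negbTE hi') killX (negbTE hi).
pose W := rao_num h F G A B n al' be'.
have W_homog i : zhomog (dh + n%:Z) (W i).
  rewrite /W rao_num.unlock; case: ifP => _.
    by rewrite addrC; apply: zhomogM => //; exact: zhomogXX.
  apply: zhomogD.
    have -> : dh + n%:Z = dh + dF + (n%:Z - dF) by ring.
    by apply: zhomogM => //; apply: nrm_homog.
  have -> : dh + n%:Z = dh + dG + (n%:Z - dG) by ring.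
  by apply: zhomogM => //; apply: nrm_homog.
have W_cocycle := rao_cocycle hx hy Fx Fy Gx Gy Ay Bx F0 FG
  (nrmx dF al) (nrmy dF al) (nrmx dG be) (nrmy dG be)
  (nrm1 dG be) bezout.
have W_annihilator := rao_annihilator hx hy Fx Fy Gx Gy Ay Bx F0 FG
  (nrmx dF al) (nrmy dF al) (nrmx dG be) (nrmy dG be)
  (nrm1 dG be) bezout.
have W_kernel := rao_kernel hx hy Fx Fy Gx Gy Ay Bx g0 k0
  (nrmx dF al) (nrmy dF al) (nrmx dG be) (nrmy dG be)
  (nrm1 dG be) bezout.
have W_generates := rao_generates hx hy Fx Fy Gx Gy Ay Bx g0 k0 F0 FG
  (nrmx dF al) (nrmy dF al) (nrmx dG be) (nrmy dG be)
  (nrm1 dG be) bezout.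
rewrite -/W in W_cocycle W_annihilator W_kernel W_generates.
pose c := num_boundary n W.
pose T p : 'I_4 -> 'I_4 -> fracR K := fun i l => toF p * c i l.
have TE p : T p = num_boundary n (fun i => p * W i).
  by apply/funext => i; apply/funext => l; rewrite /T /c num_boundaryM.
have Tlin : linear T.
  move=> a p q; apply/funext => i; apply/funext => l.
  rewrite -[RHS]/(toF a%:MP * (toF p * c i l) + toF q * c i l).
  by rewrite /T -mul_mpolyC rmorphD rmorphM mulrDl mulrA.
have pW_homog j p : zhomog (- dh + j) p ->
    forall i, zhomog (j + n%:Z) (p * W i).
  move=> hp i; have -> : j + n%:Z = - dh + j + (dh + n%:Z) by ring.
  exact: zhomogM.
have TZ j p : p \in (zhomog (- dh + j) : {pred R}) -> T p \in cocycle1 I j.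
  move=> hp; rewrite TE; apply: (@num_cocycle _ _ _ _ _ 1) => [|i l].
    exact: pW_homog.
  have -> : ('X_i * 'X_l) ^+ 1 * ('X_i ^+ n * (p * W l) - 'X_l ^+ n * (p * W i)) =
     p * ('X_i * 'X_l * ('X_i ^+ n * W l - 'X_l ^+ n * W i)) by ring.
  exact: idealM.
have TB j p : p \in (zhomog (- dh + j) : {pred R}) ->
    (T p \in coboundary1 I j) = (p \in ideal_pred J).
  move=> hp; rewrite TE; apply/idP/idP.
    move=> /coboundary_num [r [m hr]]; apply/ideal_predP.
    exact: (W_kernel p r m).
  move=> /ideal_predP /W_annihilator [r hr].
  apply: (@num_coboundary _ _ _ _ _ (zpi j r) 1); first exact: zpiP.
    exact: pW_homog.
  move=> i; have := ideal_zpi Ihomog (1 + (j + n%:Z)) (hr i).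
  rewrite (zpiM _ _ (zhomogX _ i)) linearB /= (zpi_id (pW_homog _ _ hp i)).
  by rewrite (zpiM_sub _ _ (zhomogXX _ i n)) addrK expr1.
have TS j w : w \in cocycle1 I j ->
    exists2 p, p \in (zhomog (- dh + j) : {pred R}) & w - T p \in coboundary1 I j.
  move=> /cocycle_num [N [V [V_homog IV ->]]].
  have [p [r hr]] := W_generates N V IV.
  exists (zpi (- dh + j) p); first exact: zpiP.
  rewrite TE num_boundaryB.
  apply: (@num_coboundary _ _ _ _ _ (zpi j r) 1); first exact: zpiP.
    have E : j + (N + n)%N%:Z = n%:Z + (j + N%:Z) by rewrite PoszD; ring.
    have E' : j + (N + n)%N%:Z = N%:Z + (j + n%:Z) by rewrite PoszD; ring.
    move=> i; apply: zhomogB; first by rewrite E; apply: zhomogM => //; exact: zhomogXX.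
    by rewrite E'; apply: zhomogM; [exact: zhomogXX | apply: pW_homog; exact: zpiP].
  move=> i; have := ideal_zpi Ihomog (1 + (n%:Z + (j + N%:Z))) (hr i).
  have XW_homog : zhomog (N%:Z + (dh + n%:Z)) ('X_i ^+ N * W i).
    by apply: zhomogM => //; exact: zhomogXX.
  rewrite (zpiM _ _ (zhomogX _ i)) !linearB /=.
  rewrite (zpi_id (zhomogM (zhomogXX _ i n) (V_homog i))).
  rewrite (zpiM_sub _ _ (zhomogXX _ i (N + n))).
  have -> : 'X_i ^+ N * p * W i = 'X_i ^+ N * W i * p by ring.
  rewrite (zpiM_sub _ _ XW_homog).
  have -> : n%:Z + (j + N%:Z) - (N%:Z + (dh + n%:Z)) = - dh + j by ring.
  have -> : n%:Z + (j + N%:Z) - (N + n)%N%:Z = j by rewrite PoszD; ring.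
  by rewrite expr1 [zpi _ p * W i]mulrC mulrA.
pose phi j := cid (subquot_iso Tlin (TZ j) (TB j) (TS j)).
exists (fun j => projT1 (phi j)); split=> [j|j l a m ha].
  by case: (projT2 (phi j)).
have [_ phij] := projT2 (phi j); have [_ phil] := projT2 (phi l).
rewrite -(subquot_reprK m).
have hv := subquot_reprP m.
rewrite phij // H1_mulE ?TZ //.
rewrite -[gmul _ j l a _]/(gmul (quotient_module J) (- dh + j) (- dh + l) a _).
rewrite quotient_mulE ?shift_degree // phil.
  by congr (subquot_class _ _ _); apply/funext => i; apply/funext => l';
    rewrite /T rmorphM mulrA.
rewrite -(subrK (- dh + j) (- dh + l)); apply: zhomogM => //.
by rewrite shift_degree.
Qed.

End RaoModule.

(** * Binary forms without common factor *)

Section BinaryForms.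
Variable K : fieldType.
Local Notation R := {mpoly K[4]}.
Variables (a b : 'I_4).
Hypothesis ab : a != b.

Definition in_vars (F : R) : Prop :=
  forall m i, m \in msupp F -> i != a -> i != b -> m i = 0%N.

Definition dehomog (F : R) : {poly K} :=
  \sum_(m <- msupp F) F@_m *: 'X^(m b).

Lemma in_vars_prod F m (S : comNzRingType) (v : 'I_4 -> S) :
  in_vars F -> m \in msupp F -> \prod_i v i ^+ m i = v a ^+ m a * v b ^+ m b.
Proof.
move=> hF hm; rewrite (bigD1 a) //= (bigD1 b) 1?eq_sym //= big1 ?mulr1 //.
by move=> i /andP[ia ib]; rewrite (hF m i) ?expr0.
Qed.

Lemma in_vars_mdeg F m : in_vars F -> m \in msupp F -> mdeg m = (m a + m b)%N.
Proof.
move=> hF hm; rewrite mdegE (bigD1 a) //= (bigD1 b) 1?eq_sym //= big1 ?addn0 //.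
by move=> i /andP[ia ib]; apply: hF hm ia ib.
Qed.

(** Evaluating a form of degree [d] at a point of the line amounts to evaluating
    its dehomogenization at the ratio [s] of the coordinates; this is used with
    values in the polynomial ring and in its field of fractions. *)
Lemma mmap_dehomog (S : comNzRingType) (th : {rmorphism K -> S}) (v : 'I_4 -> S)
    (s : S) (F : R) d : in_vars F -> F \is d.-homog -> v b = s * v a ->
  mmap th v F = v a ^+ d * (map_poly th (dehomog F)).[s].
Proof.
move=> hF /dhomogP dF vb; rewrite /mmap /dehomog raddf_sum horner_sum mulr_sumr.
apply: eq_big_seq => m hm; rewrite /mmap1 (in_vars_prod _ hF hm) vb.
rewrite /= map_polyZ hornerZ map_polyXn hornerXn.
have <- : mdeg m = d := dF m hm.
by rewrite (in_vars_mdeg hF hm) exprD exprMn; ring.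
Qed.

End BinaryForms.

Section Bezout.
Variable K : closedFieldType.
Local Notation R := {mpoly K[4]}.
Variables (a b : 'I_4).
Hypothesis ab : a != b.

(** A common root of the dehomogenizations is a common zero of the forms, hence
    gives a common linear factor; otherwise a Bezout relation between the
    dehomogenizations is homogenized by substituting [X_b / X_a]. *)
Lemma bezout_or_common_factor (F G : R) dF dG :
  in_vars a b F -> in_vars a b G -> F \is dF.-homog -> G \is dG.-homog ->
  (exists n u v, 'X_a ^+ n = u * F + v * G) \/
  exists l F' G', F = ('X_b - l *: 'X_a) * F' /\ G = ('X_b - l *: 'X_a) * G'.
Proof.
move=> Fv Gv Fh Gh.
set f := dehomog b F; set g := dehomog b G.
have [fg|] := boolP (coprimep f g).
  left; have /Bezout_eq1_coprimepP [[u v] /= uv] := fg.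
  pose th : {rmorphism K -> fracR K} := @toF K \o @mpolyC 4 K.
  pose s : fracR K := toF 'X_b / toF 'X_a.
  pose ev (p : {poly K}) := (map_poly th p).[s].
  have Xa0 : toF ('X_a : R) != 0 by apply: toFX_neq0.
  have evP p : exists N P, toF ('X_a : R) ^+ N * ev p = toF P.
    elim/poly_ind: p => [|p c [N [P E]]].
      by exists 0%N, 0; rewrite /ev rmorph0 horner0 mulr0 rmorph0.
    exists N.+1, (P * 'X_b + c%:MP * 'X_a ^+ N.+1).
    rewrite /ev rmorphD rmorphM /= map_polyX map_polyC hornerMXaddC.
    rewrite mulrDr rmorphD !rmorphM rmorphXn /= -E; congr (_ + _); last first.
      by rewrite mulrC.
    rewrite -/(ev p) exprSr /s.
    rewrite -!mulrA; congr (_ * _); rewrite mulrCA; congr (_ * _).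
    by rewrite mulrC divfK.
  have evF (H : R) d : in_vars a b H -> H \is d.-homog ->
      toF H = toF 'X_a ^+ d * ev (dehomog b H).
    move=> Hv Hh; rewrite /ev -(mmap_dehomog ab _ (v := fun i => toF 'X_i) Hv Hh).
      rewrite {1}[H]mpolyE raddf_sum /mmap; apply: eq_bigr => m _.
      rewrite -mul_mpolyC /= rmorphM; congr (_ * _).
      by rewrite mpolyXE_id rmorph_prod; apply: eq_bigr => i _; rewrite rmorphXn.
    by rewrite divfK.
  have [N1 [P1 E1]] := evP u; have [N2 [P2 E2]] := evP v.
  exists (N1 + N2 + dF + dG)%N, (P1 * 'X_a ^+ (N2 + dG)), (P2 * 'X_a ^+ (N1 + dF)).
  apply: toF_inj; rewrite rmorphD !rmorphM !rmorphXn /= -E1 -E2.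
  rewrite (evF _ _ Fv Fh) (evF _ _ Gv Gh).
  transitivity (toF ('X_a : R) ^+ (N1 + N2 + dF + dG) * ev (u * f + v * g)).
    by rewrite uv /ev rmorph1 hornerC mulr1.
  rewrite /ev rmorphD !rmorphM hornerD !hornerM -!/(ev _) -/f -/g.
  by rewrite !exprD; ring.
rewrite coprimep_def => /closed_rootP [l]; rewrite root_gcd => /andP[fl gl].
right; exists l.
pose w i : R := if i == b then l *: 'X_a else 'X_i.
have factor (H : R) d : in_vars a b H -> H \is d.-homog -> root (dehomog b H) l ->
    exists H', H = ('X_b - l *: 'X_a) * H'.
  move=> Hv Hh /eqP root_l.
  have /gen1P [c E] : ideal_set (gen_ideal [:: 'X_b - l *: 'X_a]) (H - subst w H).
    rewrite -{1}[H]subst_id; apply: subst_congr => i; apply/gen1P; rewrite /w.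
    case: eqVneq => [->|_]; first by exists 1; rewrite mul1r.
    by exists 0; rewrite subrr mul0r.
  exists c; rewrite mulrC -E -[LHS]subr0; congr (_ - _).
  have -> : subst w H = mmap (@mpolyC 4 K) w H.
    rewrite substE /mmap; apply: eq_bigr => m _; rewrite -mul_mpolyC.
    by congr (_ * _).
  rewrite (mmap_dehomog ab _ (s := l%:MP) Hv Hh).
    rewrite horner_map /= root_l mpolyC0 mulr0 //.
  by rewrite /w eqxx (negbTE ab) mul_mpolyC.
have [F' FE] := factor F dF Fv Fh fl; have [G' GE] := factor G dG Gv Gh gl.
by exists F', G'.
Qed.

End Bezout.

(** * Curves have no embedded points *)

Section NoEmbeddedPoint.
Variable K : fieldType.
Local Notation R := {mpoly K[4]}.
Variables (C : closedSubscheme K) (P : set R).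
Hypothesis P_point : proj_point P.

(** The degree zero part of a localization at [P], as in [ideal_stalk]. *)
Definition hloc (Q : set R) : set (fracR K) :=
  [set u | exists (d : nat) (a b : R),
     [/\ Q a, a \is d.-homog, b \is d.-homog, ~ P b & u = toF a / toF b]].

Let P_prime : prime_in [set: R] P. Proof. by case: P_point. Qed.

Let P0 : P 0. Proof. by case: P_prime => -[]. Qed.
Let P1 : ~ P 1. Proof. by case: P_prime. Qed.
Let PM a b : ~ P a -> ~ P b -> ~ P (a * b).
Proof. by case: P_prime => _ _ H na nb /(H _ _ I I) []. Qed.
Let P_neq0 b : ~ P b -> toF b != 0.
Proof. by move=> nb; rewrite toF_eq0; apply/eqP => b0; rewrite b0 in nb. Qed.

Lemma hloc_prime (Q : set R) : prime_in [set: R] Q -> Q `<=` P ->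
  prime_in (proj_local_ring P) (hloc Q).
Proof.
move=> [[_ Q0 QD QM] _ Qp] QP; split.
- split=> [u [d [a [b [_ ha hb nb ->]]]]|||].
  + by exists d, a, b.
  + exists 0%N, 0, 1; split=> //; first exact: dhomog0.
      exact: dhomog1.
    by rewrite rmorph0 mul0r.
  + move=> _ _ [d [a [b [Qa ha hb nb ->]]]] [e [a' [b' [Qa' ha' hb' nb' ->]]]].
    exists (d + e)%N, (b' * a + b * a'), (b * b'); split.
    * by apply: (QD); apply: (QM).
    * by apply: dhomogD; [rewrite addnC|]; apply: dhomogM.
    * exact: dhomogM.
    * exact: PM.
    by rewrite addf_div ?P_neq0 // !(rmorphD, rmorphM) /=; congr (_ / _); ring.
  + move=> _ _ [e [a' [b' [ha' hb' nb' ->]]]] [d [a [b [Qa ha hb nb ->]]]].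
    exists (e + d)%N, (a' * a), (b' * b); split.
    * exact: (QM).
    * exact: dhomogM.
    * exact: dhomogM.
    * exact: PM.
    by rewrite !rmorphM mulf_div.
- move=> [d [a [b [Qa _ _ nb]]]] /esym E; apply: nb; apply: QP.
  suff <- : a = b by [].
  by apply: toF_inj; apply: divr1_eq.
- move=> _ _ [d [a [b [ha hb nb ->]]]] [e [a' [b' [ha' hb' nb' ->]]]].
  move=> [l [a'' [b'' [Qa'' _ _ nb'']]]].
  move/eqP; rewrite mulf_div eqr_div ?mulf_neq0 ?P_neq0 // -!rmorphM => /eqP /toF_inj E.
  have /(Qp _ _ I I) [|/QP //] : Q (a * a' * b'').
    by rewrite E mulrC; apply: (QM).
  move/(Qp _ _ I I) => [Qa|Qa']; [left; exists d, a, b | right; exists e, a', b'];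
    by [].
Qed.

(** The local ring of [C] at a point [P] that specializes another point [Q] has
    positive dimension, hence positive depth: some element of its maximal ideal is
    not a zero divisor, and therefore an element [u] annihilated by [P] is zero in
    the stalk. *)
Lemma no_embedded_point (u : R) d Q :
  locally_CM C -> point_of C P -> point_of C Q -> Q `<=` P -> Q <> P ->
  u \is d.-homog -> (forall a, P a -> ideal_set C (a * u)) ->
  exists b, ~ P b /\ ideal_set C (b * u).
Proof.
move=> CCM CP [[Qprime Qhomog _] CQ] QP QneP hu Pu.
have [n [[_ kdim] [[s [size_s s_nonunit [_ s_reg _]]] _]]] := CCM P CP.
have [i0 Xi0] : exists i, ~ P 'X_i by case: P_point.
have nPX m : ~ P ('X_i0 ^+ m).
  by elim: m => [|m IH]; [rewrite expr0 | rewrite exprS; apply: PM].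
have [p [Pp np [e hp]]] : exists p, [/\ P p, ~ Q p & exists e, p \is e.-homog].
  have [p Pp np] : exists2 p, P p & ~ Q p.
    apply: contrapT => H; apply: QneP; apply/seteqP; split=> // p Pp.
    by apply: contrapT => np; apply: H; exists p.
  apply: contrapT => H; apply: np.
  have [Qz QD] : Q 0 /\ forall a b, Q a -> Q b -> Q (a + b).
    by case: Qprime => -[].
  have [m ->] := zpi_partition p; apply: big_ind => // i _.
  apply: contrapT => nQi; apply: H; exists (zpi i p); split=> //.
    by case: P_point => _ Phomog _; apply: Phomog.
  by exists i; exact: pihomogP.
case: n size_s kdim => [|n] size_s kdim.
  exfalso; apply: kdim; exists (fun i => if i == 0%N then hloc Q else hloc P).
  split=> [[|i] _ /=|[|//] _ /=].
  - split; first exact: hloc_prime.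
    by move=> _ [d' [a [b [Ca ha hb nb ->]]]]; exists d', a, b; split=> //; apply: CQ.
  - split; first exact: hloc_prime.
    move=> _ [d' [a [b [Ca ha hb nb ->]]]]; exists d', a, b; split=> //.
    by case: CP => _; apply.
  split=> [|H].
    by move=> _ [d' [a [b [Qa ha hb nb ->]]]]; exists d', a, b; split=> //; apply: QP.
  have /H [d' [a [b [Qa ha hb nb]]]] : hloc P (toF p / toF ('X_i0 ^+ e)).
    exists e, p, ('X_i0 ^+ e); split=> //.
    exact: (zhomogXX K i0 e).
  move/eqP; rewrite eqr_div ?P_neq0 // -!rmorphM => /eqP /toF_inj E.
  case: Qprime => -[_ _ _ QM] _ Qp.
  have /(Qp _ _ I I) [//|/QP //] : Q (p * b).
  by rewrite E mulrC; apply: (QM).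
have s0 : s`_0 \in s by rewrite mem_nth // size_s.
have [[d0 [a [b [ha hb nb s0E]]]] s0_nonunit] := s_nonunit _ s0.
have Pa : P a.
  apply: contrapT => na; apply: s0_nonunit; exists (toF b / toF a).
    by exists d0, b, a.
  by rewrite s0E mulf_div [toF b * _]mulrC divff // mulf_neq0 ?P_neq0.
pose v := toF u / toF ('X_i0 ^+ d).
have hX : 'X_i0 ^+ d \is d.-homog := zhomogXX K i0 d.
have Sv : proj_local_ring P v by exists d, u, ('X_i0 ^+ d).
have add0 w : add_gens (proj_local_ring P) (ideal_stalk C P) (take 0 s) w <->
    ideal_stalk C P w.
  rewrite take0; split=> [[w' [c [hw' _ ->]]]|hw]; first by rewrite big_ord0 addr0.
  exists w, (fun=> 0); split=> [//|i|]; last by rewrite big_ord0 addr0.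
  by exists 0%N, 0, 1; rewrite dhomog0 dhomog1 rmorph0 mul0r.
have := s_reg 0%N v; rewrite size_s => /(_ isT Sv) H.
have /add0 [d' [a' [b' [Ca' ha' hb' nb']]]] :
    add_gens (proj_local_ring P) (ideal_stalk C P) (take 0 s) v.
  apply: H; apply/add0; exists (d0 + d)%N, (a * u), (b * 'X_i0 ^+ d); split.
  - exact: Pu.
  - exact: dhomogM.
  - exact: dhomogM.
  - exact: PM.
  by rewrite s0E mulf_div !rmorphM.
move/eqP; rewrite eqr_div ?P_neq0 // -!rmorphM => /eqP /toF_inj E.
by exists b'; split=> //; rewrite mulrC E mulrC; apply: idealM.
Qed.

End NoEmbeddedPoint.

Section RationalPoints.
Variable K : fieldType.
Local Notation R := {mpoly K[4]}.
Variables (a : 'I_4) (l : 'I_4 -> K).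
Hypothesis la : l a = 1.

Local Notation rho := (subst (fun i => l i *: 'X_a : R)).

(** The homogeneous ideal of the point with coordinates [l]: the substitution
    restricts polynomials to the line through the origin and [l]. *)
Definition point_ideal : set R := [set p | rho p = 0].

Let lX i : zhomog 1 (l i *: 'X_a : R).
Proof. by apply: zhomogZ; exact: zhomogX. Qed.

Let rhoX i : rho 'X_i = l i *: 'X_a. Proof. exact: substX. Qed.

Let rhoK p : rho (rho p) = rho p.
Proof.
by rewrite subst_comp; apply: eq_subst => i; rewrite linearZ /= substX la scale1r.
Qed.

Let rho_homog n p : p \is n.-homog -> exists c, rho p = c *: 'X_a ^+ n.
Proof.
move=> /dhomogP hp; rewrite substE.
exists (\sum_(m <- msupp p) p@_m * \prod_i l i ^+ m i); rewrite scaler_suml.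
apply: eq_big_seq => m mp; rewrite -scalerA; congr (_ *: _).
have <- : mdeg m = n := hp m mp.
rewrite mdegE -prodrXr -scaler_prod; apply: eq_bigr => i _.
by rewrite exprZn.
Qed.

Lemma point_ideal_gens p (J : ideal R) : point_ideal p ->
  (forall i, ideal_set J ('X_i - l i *: 'X_a)) -> ideal_set J p.
Proof.
move=> hp hJ; rewrite -[p]subr0 -[0 in X in _ - X]hp -{1}[p]subst_id.
exact: subst_congr.
Qed.

Lemma point_ideal_point : proj_point point_ideal.
Proof.
split.
- split=> [||p q _ _].
  + split=> //=; rewrite /point_ideal /=; first exact: raddf0.
      by move=> p q hp hq; rewrite raddfD /= hp hq addr0.
    by move=> p q _ hq; rewrite rmorphM /= hq mulr0.
  + by rewrite /point_ideal /= rmorph1 => /eqP; rewrite oner_eq0.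
  rewrite /point_ideal /= rmorphM => /eqP; rewrite mulf_eq0.
  by case/orP => /eqP; [left|right].
- move=> d p hp; have := zpi_subst d p lX; rewrite hp /=.
  by rewrite pihomog0 /point_ideal /= => <-.
by exists a; rewrite /point_ideal /= rhoX la scale1r; apply/eqP; exact: X_neq0.
Qed.

(** A form is a multiple of a power of [X_a] modulo the ideal of the point. *)
Lemma point_ideal_max Q : proj_point Q -> point_ideal `<=` Q -> Q `<=` point_ideal.
Proof.
move=> [[[_ Q0 QD QM] Q1 Qp] Qhomog [i nQi]] PQ p Qp'.
have QXa : ~ Q 'X_a.
  move=> QXa; apply: nQi; rewrite -['X_i](subrK (l i *: 'X_a)); apply: (QD).
    by apply: PQ; rewrite /point_ideal /= linearB linearZ /= !rhoX la scale1r subrr.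
  by rewrite -mul_mpolyC; apply: (QM).
have QXan n : ~ Q ('X_a ^+ n).
  elim: n => [|n IH]; first by rewrite expr0.
  by rewrite exprS => /(Qp _ _ I I) [].
have Qrho : Q (rho p).
  rewrite -[rho p](subrK p); apply: (QD) => //; apply: PQ.
  by rewrite /point_ideal /= linearB /= rhoK subrr.
have [n rE] := zpi_partition (rho p).
rewrite /point_ideal /= rE big1 // => i' _.
have := Qhomog i' _ Qrho; rewrite -/(zpi (Posz i') (rho p)) zpi_subst //.
have [c ->] := rho_homog (pihomogP mdeg i' p : zpi (Posz i') p \is i'.-homog).
have [->|c0] := eqVneq c 0; first by rewrite scale0r.
move=> H; exfalso; apply: (QXan i').
by rewrite -[_ ^+ _]scale1r -(mulVf c0) -scalerA -mul_mpolyC; apply: (QM).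
Qed.

(** A closed point is not generic, for there would be no chain of length one above
    it. *)
Lemma point_ideal_not_generic (C : closedSubscheme K) :
  pure_one_dimensional C -> point_of C point_ideal ->
  exists Q, [/\ point_of C Q, Q `<=` point_ideal & Q <> point_ideal].
Proof.
move=> [_ pure] CP; apply: contrapT => nex.
have /pure [[c [cP c_lt]] _] : generic_point C point_ideal.
  split=> // Q CQ QP; apply: contrapT => neq; apply: nex; by exists Q.
have [[_ sub0] [c1_point _]] := (cP 0%N isT, cP 1%N isT).
have [c01 nc10] := c_lt 0%N isT.
apply: nc10 => p /(point_ideal_max c1_point) H; apply: (sub0); apply: H.
by move=> q /sub0; apply: c01.
Qed.

End RationalPoints.

(** * Coprimality of the two forms *)

Section Coprimality.
Variable K : fieldType.
Local Notation R := {mpoly K[4]}.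
Local Notation x := ('X_ix : R).
Local Notation y := ('X_iy : R).
Local Notation ex := (kill ix).
Local Notation ey := (kill iy).
Variables (C : closedSubscheme K) (h F G A B : R) (e : int).
Hypotheses (hy : ey h = h) (Fx : ex F = F) (Fy : ey F = F).
Hypotheses (Gx : ex G = G) (Gy : ey G = G) (Ay : ey A = A).
Local Notation g := (plane_eqn ix h F A).
Local Notation k := (plane_eqn iy h G B).
Local Notation q := (link_eqn h F G A B).
Hypotheses (g0 : g != 0) (G0 : G != 0) (q_homog : zhomog e q).
Hypothesis C_curve : is_curve C.
Hypothesis CE : ideal_set C = gen_ideal (curve_generators h F G A B).

(** Let [l] be a common linear factor of [F] and [G].  The quotient of the last
    generator [q] of the ideal by [l] is multiplied into the ideal by [x], [y]
    and [l], but is not in it: the point [x = y = l = 0] would be embedded. *)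
Lemma no_common_factor (a b : 'I_4) (c : K) F' G' :
  (forall i, [\/ i = ix, i = iy, i = a | i = b]) ->
  b != a -> [&& a != ix, a != iy, b != ix & b != iy] ->
  F = ('X_b - c *: 'X_a) * F' -> G = ('X_b - c *: 'X_a) * G' -> False.
Proof.
move=> iP /negbTE ab /and4P[ax ay bx b_y] FE GE.
set l := 'X_b - c *: 'X_a in FE GE.
have lx : ex l = l by rewrite /l killB killZ !killX (negbTE ax) (negbTE bx).
have ly : ey l = l by rewrite /l killB killZ !killX (negbTE ay) (negbTE b_y).
have l0 : l != 0 by apply: contra_neq G0 => l0; rewrite GE l0 mul0r.
wlog [G'x G'y] : F' G' FE GE / ex G' = G' /\ ey G' = G'.
  move=> /(_ (ex (ey F')) (ex (ey G'))); apply.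
  - by have := congr1 (fun p => ex (ey p)) FE; rewrite !killM ly lx Fy Fx.
  - by have := congr1 (fun p => ex (ey p)) GE; rewrite !killM ly lx Gy Gx.
  by rewrite killK [ey (ex _)]killC killK.
have G'0 : G' != 0 by apply: contra_neq G0 => l0'; rewrite GE l0' mulr0.
pose u := x * A * G' + y * B * F' + h * F' * G.
have qE : q = l * u by rewrite link_eqn.unlock /u FE {1}GE; ring.
have eyu : ey u = g * G'.
  have -> : u = x * A * G' + y * B * F' + h * F * G' by rewrite /u FE GE; ring.
  rewrite !(killD, killM) Ay hy Fy G'y !killX /= plane_eqn.unlock; ring.
have u0 : u != 0.
  apply/eqP => u0; have := eyu; rewrite u0 kill0 => /esym/eqP.
  by rewrite mulf_eq0 (negbTE g0) (negbTE G'0).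
have [d hu] : exists d, u \is d.-homog.
  have l_homog : zhomog 1 l.
    apply: zhomogB; first exact: zhomogX.
    by apply: zhomogZ; exact: zhomogX.
  have := zhomog_cancel l0 l_homog; move=> /(_ e u); rewrite -qE => /(_ q_homog).
  by case: (e - 1) => d /=; [exists d | rewrite (negbTE u0)].
pose pt i : K := if i == a then 1 else if i == b then c else 0.
have pta : pt a = 1 by rewrite /pt eqxx.
have ptb : pt b = c by rewrite /pt eqxx ab.
have ptx : pt ix = 0 by rewrite /pt ![ix == _]eq_sym (negbTE ax) (negbTE bx).
have pty : pt iy = 0 by rewrite /pt ![iy == _]eq_sym (negbTE ay) (negbTE b_y).
have P_point := point_ideal_point pta.
have Pmul p r : point_ideal a pt r -> point_ideal a pt (p * r).
  by rewrite /point_ideal /= => E; rewrite rmorphM /= E mulr0.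
have Padd p r : point_ideal a pt p -> point_ideal a pt r -> point_ideal a pt (p + r).
  by rewrite /point_ideal /= => E E'; rewrite raddfD /= E E' addr0.
have Px : point_ideal a pt x by rewrite /point_ideal /= substX ptx scale0r.
have Py : point_ideal a pt y by rewrite /point_ideal /= substX pty scale0r.
have Pl : point_ideal a pt l.
  by rewrite /point_ideal /= linearB linearZ /= !substX ptb pta scale1r subrr.
have PC : point_of C (point_ideal a pt).
  split=> // p; rewrite CE => /curve_idealP [e1 [e2 [e3 [e4 ->]]]].
  rewrite qE; do !apply: (Padd); apply: (Pmul).
  - exact: Pmul.
  - by rewrite mulrC; apply: Pmul.
  - by rewrite mulrC; apply: Pmul.
  - by rewrite mulrC; apply: Pmul.
have [pure CM] := C_curve.
have [Q [CQ QP QneP]] := point_ideal_not_generic pta pure PC.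
have IE p : ideal_set C p <->
  exists e1 e2 e3 e4, p = e1 * (x * y) + e2 * (x * g) + e3 * (y * k) + e4 * q.
  by rewrite CE; exact: curve_idealP.
have Pu p : point_ideal a pt p -> ideal_set C (p * u).
  move=> hp; have /gen3P [e1 [e2 [e3 ->]]] : ideal_set (gen_ideal [:: x; y; l]) p.
    apply: (point_ideal_gens hp) => i; apply/gen3P.
    case: (iP i) => ->.
    - by exists 1, 0, 0; rewrite ptx scale0r; ring.
    - by exists 0, 1, 0; rewrite pty scale0r; ring.
    - by exists 0, 0, 0; rewrite pta scale1r; ring.
    - by exists 0, 0, 1; rewrite ptb !mul0r !add0r mul1r.
  apply/IE; exists (e1 * B * F' + e2 * A * G'), (e1 * G'), (e2 * F'), e3.
  have FG' : F' * G = F * G' by rewrite FE GE; ring.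
  rewrite qE /u !plane_eqn.unlock; apply/eqP; rewrite -subr_eq0; apply/eqP.
  transitivity (e1 * x * h * (F' * G - F * G')); first by ring.
  by rewrite FG' subrr mulr0.
have [r [Pr /IE [e1 [e2 [e3 [e4 E]]]]]] :=
  no_embedded_point P_point CM PC CQ QP QneP hu Pu.
apply: Pr; have [r' rE] : exists r', r = r' + e4 * l by exists (r - e4 * l); ring.
have {}E : r' * u = e1 * (x * y) + e2 * (x * g) + e3 * (y * k).
  apply: (addIr (e4 * q)); rewrite -E rE qE; ring.
have eyr' : ey r' * G' = ey e2 * x.
  apply: (mulfI g0); have := congr1 ey E.
  rewrite !killD !killM eyu !killX eqxx (ey_g hy Fy Ay) /= => H.
  transitivity (ey r' * (g * G')); first ring.
  by rewrite H; ring.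
have e0r' : ex (ey r') = 0.
  have /eqP := congr1 ex eyr'; rewrite !killM killX eqxx mulr0 G'x.
  by rewrite mulf_eq0 (negbTE G'0) orbF => /eqP.
rewrite rE.
have [r1 ->] := kill_ex iy r'; have [r2 ->] := kill_ex ix (ey r').
rewrite e0r' add0r; do !apply: (Padd); last exact: Pmul.
  by rewrite mulrC; apply: Pmul.
by rewrite mulrC; apply: Pmul.
Qed.

End Coprimality.

Section CurveBezout.
Variable K : closedFieldType.
Local Notation R := {mpoly K[4]}.
Local Notation x := ('X_ix : R).
Local Notation y := ('X_iy : R).
Local Notation ex := (kill ix).
Local Notation ey := (kill iy).
Variables (C : closedSubscheme K) (h F G A B : R) (e : int) (dF dG : nat).
Hypotheses (hy : ey h = h) (Fx : ex F = F) (Fy : ey F = F).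
Hypotheses (Gx : ex G = G) (Gy : ey G = G) (Ay : ey A = A).
Hypotheses (Fzt : poly_in [:: iz; it] F) (Gzt : poly_in [:: iz; it] G).
Hypotheses (F_homog : F \is dF.-homog) (G_homog : G \is dG.-homog).
Local Notation g := (plane_eqn ix h F A).
Local Notation k := (plane_eqn iy h G B).
Local Notation q := (link_eqn h F G A B).
Hypotheses (g0 : g != 0) (F0 : F != 0) (G0 : G != 0) (q_homog : zhomog e q).
Hypothesis C_curve : is_curve C.
Hypothesis CE : ideal_set C = gen_ideal (curve_generators h F G A B).

Lemma curve_bezout : exists n (al be : 'I_4 -> R),
  forall i, i != ix -> i != iy -> 'X_i ^+ n = F * al i - G * be i.
Proof.
have bez (a b : 'I_4) :
    (forall i, [\/ i = ix, i = iy, i = a | i = b]) -> a != b ->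
    [&& a != ix, a != iy, b != ix & b != iy] ->
    exists n u v, 'X_a ^+ n = u * F + v * G.
  move=> iP ab abxy.
  have in_ab (H : R) : poly_in [:: iz; it] H -> in_vars a b H.
    move=> hH m i hm ia ib; apply: (hH m i hm).
    by case: (iP i) ia ib => -> //; rewrite eqxx.
  have [//|[c [F' [G' [FE GE]]]]] := bezout_or_common_factor ab
    (in_ab F Fzt) (in_ab G Gzt) F_homog G_homog.
  have ba : b != a by rewrite eq_sym.
  exfalso; exact: (no_common_factor hy Fx Fy Gx Gy Ay g0 G0 q_homog C_curve CE
    iP ba abxy FE GE).
have [n1 [u1 [v1 E1]]] := bez iz it ord4P isT isT.
have [|n2 [u2 [v2 E2]]] := bez it iz _ isT isT.
  by move=> i; case: (ord4P i) => ->;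
    [constructor 1|constructor 2|constructor 4|constructor 3].
exists (n1 + n2)%N,
  (fun i => if i == iz then 'X_i ^+ n2 * u1 else 'X_i ^+ n1 * u2),
  (fun i => - (if i == iz then 'X_i ^+ n2 * v1 else 'X_i ^+ n1 * v2)) => i.
case: (ord4P i) => -> //= _ _.
  by rewrite exprD E1; ring.
by rewrite exprD E2; ring.
Qed.

End CurveBezout.

Lemma regular_pair_of_bezout (K : fieldType) (F G : {mpoly K[4]}) n
    (al be : 'I_4 -> {mpoly K[4]}) : F != 0 ->
  (forall i, i != ix -> i != iy -> 'X_i ^+ n = F * al i - G * be i) ->
  regular_pair F G.
Proof.
move=> F0 bez u v E.
have H i : i != ix -> i != iy ->
    'X_i ^+ n * v = F * (al i * v - be i * u).
  by move=> hi hi'; rewrite bez // mulrBl mulrBr [F * (be i * u)]mulrCA E; ring.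
apply: (dvd_of_charts F0 _ _ (H iz isT isT) (H it isT isT)).
  by rewrite expf_neq0 ?X_neq0.
exact: regular_pair_Xn.
Qed.

(** * Finite spanning families and pairings *)

Section FiniteSpan.
Variable K : fieldType.

Definition fin_span (V : lmodType K) : Prop :=
  exists n (v : 'I_n -> V), forall u, exists c : 'I_n -> K, u = \sum_i c i *: v i.

Lemma fin_span_onto (V W : lmodType K) (f : {linear V -> W}) :
  (forall w, exists v, f v = w) -> fin_span V -> fin_span W.
Proof.
move=> fs [n [v vP]]; exists n, (f \o v) => w; have [u <-] := fs w.
have [c ->] := vP u; exists c; rewrite linear_sum.
by apply: eq_bigr => i _; rewrite linearZ.
Qed.

(** With finite spanning families the pairing is a matrix and the functional a
    row.  A column annihilated by the matrix gives a vector orthogonal to [W], hence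
    zero, so the row annihilates it too and is in the row space. *)
Lemma pairing_represents (V W : lmodType K) (b : W -> V -> K) (f : V -> K) :
  fin_span V -> fin_span W ->
  (forall v c w w', b (c *: w + w') v = c * b w v + b w' v) ->
  (forall w c v v', b w (c *: v + v') = c * b w v + b w v') ->
  (forall c v v', f (c *: v + v') = c * f v + f v') ->
  (forall v, (forall w, b w v = 0) -> v = 0) ->
  exists w, forall v, b w v = f v.
Proof.
move=> [n [v vP]] [m [w wP]] bl br fl b0.
have lin0 (U : lmodType K) (g : U -> K) :
    (forall c u u', g (c *: u + u') = c * g u + g u') -> g 0 = 0.
  move=> gl; have := gl 1 0 0; rewrite scaler0 addr0 mul1r => /eqP.
  by rewrite -subr_eq0 opprD addNKr oppr_eq0 => /eqP.
have sum_lin (U : lmodType K) (g : U -> K) :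
    (forall c u u', g (c *: u + u') = c * g u + g u') ->
    forall p (c : 'I_p -> K) (u : 'I_p -> U),
      g (\sum_i c i *: u i) = \sum_i c i * g (u i).
  move=> gl p c u.
  elim/big_rec2: _ => [|i r q _ IH]; first exact: lin0 gl.
  by rewrite gl IH.
pose P := \matrix_(i, j) b (w i) (v j) : 'M[K]_(m, n).
pose fr := \row_j f (v j) : 'rV[K]_n.
have /submxP [D DE] : (fr <= P)%MS.
  rewrite submxE; apply/eqP/matrixP => i j; rewrite !mxE.
  pose u := \sum_l cokermx P l j *: v l.
  have u0 : u = 0.
    apply: b0 => w0; have [c ->] := wP w0.
    rewrite (sum_lin _ (fun w => b w u)) // big1 // => l _.
    rewrite (sum_lin _ (b (w l))) //.
    have := congr1 (fun A : 'M[K]_(m, n) => A l j) (mulmx_coker P); rewrite !mxE => E.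
    rewrite -[RHS](mulr0 (c l)) -[in RHS]E; congr (_ * _).
    by apply: eq_bigr => r _; rewrite !mxE mulrC.
  transitivity (f u); last by rewrite u0 (lin0 _ f fl).
  by rewrite /u (sum_lin _ f) //; apply: eq_bigr => l _; rewrite !mxE mulrC.
exists (\sum_i D 0 i *: w i) => u; have [c ->] := vP u.
rewrite (sum_lin _ (fun w => b w _)) // (sum_lin _ f) //.
transitivity (\sum_l c l * \sum_i D 0 i * b (w i) (v l)).
  under eq_bigr => i _ do rewrite (sum_lin _ (b (w i))) // mulr_sumr.
  rewrite exchange_big; apply: eq_bigr => l _; rewrite mulr_sumr.
  by apply: eq_bigr => i _; rewrite mulrCA.
apply: eq_bigr => l _; congr (_ * _).
have := congr1 (fun A : 'rV[K]_n => A 0 l) DE; rewrite !mxE => ->.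
by apply: eq_bigr => i _; rewrite !mxE.
Qed.

End FiniteSpan.

Lemma subquot_class0 (K : fieldType) (V : lmodType K) (Z B : submodClosed V) :
  subquot_class Z B 0 = 0.
Proof.
have := subquot_classP B (-1) (rpred0 Z) (rpred0 Z).
by rewrite scaler0 addr0 scaleN1r addNr.
Qed.

Section QuotientMap.
Variable K : fieldType.
Local Notation R := {mpoly K[4]}.
Variable J : ideal R.

Lemma quotient_map n : exists f : {linear dhomog 4 K n -> quotient_module J n%:Z},
  (forall p, f p = 0 <-> ideal_set J (val p)) /\ (forall m, exists p, f p = m).
Proof.
pose cl (p : R) := subquot_class (zhomog n : {pred R}) (ideal_pred J) p.
pose f (p : dhomog 4 K n) : quotient_module J n%:Z := cl (val p).
have flin : linear f.
  by move=> a p q; rewrite /f linearP /cl subquot_classP //; apply: dhomog_is_dhomog.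
have [g gE] := linear_of flin; exists g; split=> [p|m].
  rewrite gE /f -(subquot_class0 (zhomog n : {pred R}) (ideal_pred J)) /cl; split.
    move=> /subquot_classE; rewrite subr0 => H; apply/ideal_predP; apply: H.
      exact: dhomog_is_dhomog.
    exact: zhomog0.
  move=> Jp; apply/subquot_classE; rewrite ?subr0; last exact/ideal_predP.
    exact: dhomog_is_dhomog.
  exact: zhomog0.
exists (DHomog (subquot_reprP m)).
by rewrite gE /f /cl subquot_reprK.
Qed.

Lemma quotient_fin_span j : fin_span (quotient_module J j).
Proof.
case: j => n.
  have [f [_ fs]] := quotient_map n; apply: (fin_span_onto fs).
  pose b := vbasis {:dhomog 4 K n}.
  exists (\dim {:dhomog 4 K n}), (fun i : 'I_(\dim {:dhomog 4 K n}) => tnth b i) => u.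
  exists (fun i => coord b i u); rewrite {1}(coord_vbasis (memvf u)).
  by apply: eq_bigr => i _; rewrite (tnth_nth 0).
exists 0%N, (fun=> 0) => u; exists (fun=> 0); rewrite big_ord0 -(subquot_reprK u).
have /eqP := subquot_reprP u => ->.
exact: subquot_class0.
Qed.

End QuotientMap.

(** * Gorenstein duality for a complete intersection of binary forms *)

Section CompleteIntersection.
Variable K : fieldType.
Local Notation R := {mpoly K[4]}.
Local Notation x := ('X_ix : R).
Local Notation y := ('X_iy : R).
Local Notation z := ('X_iz : R).
Local Notation t := ('X_it : R).
Local Notation e0 p := (kill ix (kill iy p)).

Lemma kill_xy_var : (e0 x = 0) * (e0 y = 0) * (e0 z = z) * (e0 t = t).
Proof. by rewrite !killX /= ?killX ?kill0. Qed.

Lemma homog_pos_gens d (p : R) : zhomog d p -> d != 0 ->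
  exists p1 p2 p3 p4, p = p1 * x + p2 * y + p3 * z + p4 * t.
Proof.
case: d => [d|d]; last first.
  by move=> /eqP -> _; exists 0, 0, 0, 0; rewrite !mul0r !addr0.
move=> hp d0; apply/gen4P.
have -> : p = p - subst (fun=> 0) p.
  suff -> : subst (fun=> 0) p = 0 by rewrite subr0.
  rewrite substE big_seq big1 // => m mp.
  have md : mdeg m = d := dhomogP _ _ _ hp m mp.
  by rewrite prodrXr -mdegE md expr0n; case: d d0 {hp md} => // d _; rewrite scaler0.
rewrite -{1}[p]subst_id; apply: subst_congr => i; rewrite subr0; apply/gen4P.
case: (ord4P i) => ->.
- by exists 1, 0, 0, 0; ring.
- by exists 0, 1, 0, 0; ring.
- by exists 0, 0, 1, 0; ring.
- by exists 0, 0, 0, 1; ring.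
Qed.

Lemma binary_form_split d (p : R) : zhomog d p -> d != 0 -> e0 p = p ->
  exists p1 p2, [/\ zhomog (d - 1) p1, zhomog (d - 1) p2 & p = z * p1 + t * p2].
Proof.
move=> hp d0 pE; have [p1 [p2 [p3 [p4 E]]]] := homog_pos_gens hp d0.
exists (zpi (d - 1) (e0 p3)), (zpi (d - 1) (e0 p4)); split; try exact: zpiP.
rewrite -!(zpiM_sub _ _ (zhomogX K _)) -raddfD -[LHS](zpi_id hp) -{1}pE {1}E.
by congr (zpi _ _); rewrite !killE !kill_xy_var; ring.
Qed.

Lemma zhomog0C (p : R) : zhomog 0 p -> exists c, p = c%:MP.
Proof.
move=> hp; have [->|p0] := eqVneq p 0; first by exists 0; rewrite mpolyC0.
exists p@_0%MM; apply: msize1_polyC.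
by have := pdegE p0 hp; rewrite /pdeg => -[]; case: (msize p) => [|[]].
Qed.

Variables F G : R.
Hypotheses (Fe : e0 F = F) (Ge : e0 G = G).
Variables dF dG : int.
Hypotheses (F_homog : zhomog dF F) (G_homog : zhomog dG G).
Hypotheses (dF_gt0 : 0 < dF) (dG_gt0 : 0 < dG).
Hypotheses (F0 : F != 0) (FG : regular_pair F G).
Variables (n : nat) (al be : 'I_4 -> R).
Hypothesis bezout : forall i, i != ix -> i != iy ->
  'X_i ^+ n = F * al i - G * be i.

Local Notation J := (gen_ideal [:: x; y; F; G]).
Local Notation s := (dF + dG - 2).

Lemma ci_homogeneous : homogeneous_ideal J.
Proof.
move=> d p /gen4P [c1 [c2 [c3 [c4 ->]]]]; apply/gen4P.
exists (zpi (d%:Z - 1) c1), (zpi (d%:Z - 1) c2),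
  (zpi (d%:Z - dF) c3), (zpi (d%:Z - dG) c4).
rewrite -[pihomog _ _ _]/(zpi d%:Z _) !zpiD.
rewrite !(zpiMr_sub _ _ (zhomogX K _)).
by rewrite (zpiMr_sub _ _ F_homog) (zpiMr_sub _ _ G_homog).
Qed.

Lemma ci_x : ideal_set J x. Proof. by apply/gen4P; exists 1, 0, 0, 0; ring. Qed.
Lemma ci_y : ideal_set J y. Proof. by apply/gen4P; exists 0, 1, 0, 0; ring. Qed.
Lemma ci_F : ideal_set J F. Proof. by apply/gen4P; exists 0, 0, 1, 0; ring. Qed.
Lemma ci_G : ideal_set J G. Proof. by apply/gen4P; exists 0, 0, 0, 1; ring. Qed.

Lemma ci_kill_xy p : ideal_set J (p - e0 p).
Proof.
have [p1 E1] := kill_ex iy p; have [p2 E2] := kill_ex ix (kill iy p).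
apply/gen4P; exists p2, p1, 0, 0.
by rewrite {1}E1 {1}E2; ring.
Qed.

Lemma ci_kill_xyP p : ideal_set J p <-> exists u v, e0 p = u * F + v * G.
Proof.
split=> [/gen4P [c1 [c2 [c3 [c4 ->]]]]|[u [v E]]].
  exists (e0 c3), (e0 c4); rewrite !killE !kill_xy_var Fe Ge; ring.
rewrite -[p](subrK (e0 p)); apply: idealD; first exact: ci_kill_xy.
by apply/gen4P; exists 0, 0, u, v; rewrite E; ring.
Qed.

Lemma ci_proper : ~ ideal_set J 1.
Proof.
move=> /(ideal_zpi ci_homogeneous 0) H.
have h1 : zhomog 0 (1 : R) by exact: dhomog1.
move: (H); move=> /gen4P [c1 [c2 [c3 [c4 E]]]].
have {}E := congr1 (zpi 0) E; move: E.
rewrite !(zpi_id h1) !zpiD.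
rewrite !(zpiMr_sub _ _ (zhomogX K _)) (zpiMr_sub _ _ F_homog) (zpiMr_sub _ _ G_homog).
have neg d p : d < 0 -> zpi d p = 0 :> R by case: d.
rewrite !neg; [|lia|lia|lia|lia].
by rewrite !mul0r !addr0 => /eqP; rewrite oner_eq0.
Qed.

(** The form [D] is the determinant of a matrix expressing [F] and [G] through [z]
    and [t].  Two expressions of [z * a] and [t * a] through [F] and [G] yield a
    syzygy, and solving it successively with the regular pairs [F, G] and [z, t]
    shows that [a] is a multiple of [D]. *)
Lemma socle_generator : exists D, [/\ zhomog s D, ideal_set J (z * D),
   ideal_set J (t * D) &
   forall a, ideal_set J (z * a) -> ideal_set J (t * a) ->
     exists w, ideal_set J (a - w * D)].
Proof.
have [|F1 [F2 [F1h F2h FE]]] := binary_form_split F_homog _ Fe; first by lia.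
have [|G1 [G2 [G1h G2h GE]]] := binary_form_split G_homog _ Ge; first by lia.
have zt : regular_pair z t by have := @regular_pair_Xn K iz it 1 1 isT.
have zD : z * (F1 * G2 - F2 * G1) = G2 * F - F2 * G by rewrite FE GE; ring.
exists (F1 * G2 - F2 * G1); split.
- have -> : s = dF - 1 + (dG - 1) by ring.
  by apply: zhomogB; apply: zhomogM.
- by rewrite zD; apply: idealB; apply: idealM; [exact: ci_F | exact: ci_G].
- have -> : t * (F1 * G2 - F2 * G1) = F1 * G - G1 * F by rewrite FE GE; ring.
  by apply: idealB; apply: idealM; [exact: ci_G | exact: ci_F].
move=> a /ci_kill_xyP [u [v E]] /ci_kill_xyP [u' [v' E']].
have {}E : z * e0 a = u * F + v * G by rewrite -E !killE !kill_xy_var.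
have {}E' : t * e0 a = u' * F + v' * G by rewrite -E' !killE !kill_xy_var.
have /(regular_pairP F0 FG) [w [w1 w2]] : F * (t * u - z * u') = G * (z * v' - t * v).
  apply/eqP; rewrite -subr_eq0; apply/eqP.
  transitivity (t * (u * F + v * G) - z * (u' * F + v' * G)); first ring.
  by rewrite -E -E'; ring.
have /zt [p pE] : z * (u' + w * G1) = t * (u - w * G2).
  apply/eqP; rewrite -subr_eq0; apply/eqP.
  transitivity (G * w - (t * u - z * u')); last by rewrite w1 subrr.
  by rewrite {1}GE; ring.
have /zt [r rE] : z * (v' - w * F1) = t * (v + w * F2).
  apply/eqP; rewrite -subr_eq0; apply/eqP.
  transitivity (z * v' - t * v - F * w); last by rewrite w2 subrr.
  by rewrite {1}FE; ring.
exists w; rewrite -[a](subrK (e0 a)) -addrA; apply: idealD; first exact: ci_kill_xy.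
apply/gen4P; exists 0, 0, p, r; apply: (mulfI (X_neq0 K iz)).
by rewrite mulrBr E mulrCA zD -[u](subrK (w * G2)) -[v](addrK (w * F2)) pE rE; ring.
Qed.

Lemma ci_top d p : zhomog d p -> (n + n)%N%:Z <= d -> ideal_set J p.
Proof.
have JX i : i != ix -> i != iy -> ideal_set J ('X_i ^+ n).
  move=> hi hi'; rewrite bezout //; apply/gen4P.
  by exists 0, 0, (al i), (- be i); ring.
suff H m a b q : zhomog m%:Z q -> (n + n <= a + b + m)%N ->
    ideal_set J (z ^+ a * t ^+ b * q).
  case: d => d; last by lia.
  move=> hp hd; have := H d 0%N 0%N p hp; rewrite !mul1r; apply; lia.
elim: m a b q => [|m IH] a b q hq hab.
  have [na|an] := leqP n a.
    have -> : z ^+ a * t ^+ b * q = (z ^+ (a - n) * t ^+ b * q) * z ^+ n.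
      by rewrite -{1}(subnK na) exprD; ring.
    by apply: idealM; apply: JX.
  have nb : (n <= b)%N by lia.
  have -> : z ^+ a * t ^+ b * q = (z ^+ a * t ^+ (b - n) * q) * t ^+ n.
    by rewrite -{1}(subnK nb) exprD; ring.
  by apply: idealM; apply: JX.
have [q1 [q2 [q3 [q4 qE]]]] := homog_pos_gens hq isT.
have {}qE : q = zpi m q1 * x + zpi m q2 * y + zpi m q3 * z + zpi m q4 * t.
  have E : m%:Z = m.+1%:Z - 1 by lia.
  rewrite -[LHS](zpi_id hq) {1}qE !zpiD.
  by rewrite !(zpiMr_sub _ _ (zhomogX K _)) -E.
rewrite {1}qE !mulrDr; apply: idealD; [apply: idealD; [apply: idealD|]|].
- by rewrite mulrA; apply: idealM; exact: ci_x.
- by rewrite mulrA; apply: idealM; exact: ci_y.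
- have -> : z ^+ a * t ^+ b * (zpi m q3 * z) = z ^+ a.+1 * t ^+ b * zpi m q3.
    by rewrite exprS; ring.
  by apply: IH; [exact: zpiP | lia].
- have -> : z ^+ a * t ^+ b * (zpi m q4 * t) = z ^+ a * t ^+ b.+1 * zpi m q4.
    by rewrite exprS; ring.
  by apply: IH; [exact: zpiP | lia].
Qed.

(** The socle of [R / J] is spanned by the form [D] of degree [s].  Descending
    induction on the degree shows that the quotient is zero above degree [s], that
    [D] is not in [J], and that every nonzero class has a multiple of degree [s]
    that is nonzero; the functional reads the coefficient of [D] in degree [s]. *)
Lemma gorenstein_functional : exists lam : R -> K,
  [/\ forall c p q, lam (c *: p + q) = c * lam p + lam q,
      forall p, ideal_set J p -> lam p = 0 &
      forall i p, zhomog i p -> (forall q, zhomog (s - i) q -> lam (p * q) = 0) ->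
        ideal_set J p].
Proof.
have [D [Dh zD tD socle]] := socle_generator.
have socle_h i a : zhomog i a -> ideal_set J (z * a) -> ideal_set J (t * a) ->
    exists2 w, zhomog (i - s) w & ideal_set J (a - w * D).
  move=> ha za ta; have [w Jw] := socle a za ta.
  exists (zpi (i - s) w); first exact: zpiP.
  have := ideal_zpi ci_homogeneous i Jw; rewrite linearB /= (zpi_id ha).
  by rewrite (zpiMr_sub _ _ Dh).
have above i p : zhomog i p -> s < i -> ideal_set J p.
  move: {2}`|(n + n)%N%:Z - i|%N (leqnn `|(n + n)%N%:Z - i|) => m.
  elim: m i p => [|m IH] i p hm hp si; first by apply: (ci_top hp); lia.
  have [le|lt] := leP ((n + n)%N%:Z) i; first exact: (ci_top hp).
  have [||w hw Jw] := socle_h i p hp.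
  - by apply: (IH (1 + i)); [lia| apply: zhomogM => //; exact: zhomogX | lia].
  - by apply: (IH (1 + i)); [lia| apply: zhomogM => //; exact: zhomogX | lia].
  have [|w1 [w2 [w3 [w4 wE]]]] := homog_pos_gens hw; first by lia.
  rewrite -[p](subrK (w * D)); apply: idealD => //; rewrite wE.
  have -> : (w1 * x + w2 * y + w3 * z + w4 * t) * D =
    w1 * D * x + w2 * D * y + w3 * (z * D) + w4 * (t * D) by ring.
  do !apply: idealD; apply: idealM => //; [exact: ci_x | exact: ci_y].
have nJD : ~ ideal_set J D.
  move=> JD; apply: ci_proper.
  suff H m i p : zhomog i p -> (n + n)%N%:Z <= i + m%:Z -> ideal_set J p.
    by apply: (H (n + n)%N 0); [exact: dhomog1 | lia].
  elim: m i p => [|m IH] i p hp hm; first by apply: (ci_top hp); lia.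
  have [||w hw Jw] := socle_h i p hp.
  - by apply: (IH (1 + i)); [apply: zhomogM => //; exact: zhomogX | lia].
  - by apply: (IH (1 + i)); [apply: zhomogM => //; exact: zhomogX | lia].
  by rewrite -[p](subrK (w * D)); apply: idealD => //; apply: idealM.
have coefD p : exists c, ideal_set J (zpi s p - c%:MP * D).
  have [||w hw Jw] := socle_h s (zpi s p) (zpiP _ _).
  - apply: (above (1 + s)); last by lia.
    by apply: zhomogM; [exact: zhomogX | exact: zpiP].
  - apply: (above (1 + s)); last by lia.
    by apply: zhomogM; [exact: zhomogX | exact: zpiP].
  by move: hw; rewrite subrr => /zhomog0C [c cE]; exists c; rewrite -cE.
have [lam lamP] := choice coefD.
have uniq c : ideal_set J (c%:MP * D) -> c = 0.
  move=> Jc; apply/eqP/negPn/negP => c0; apply: nJD.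
  have -> : D = c^-1%:MP * (c%:MP * D) by rewrite mulrA -mpolyCM mulVf // mul1r.
  exact: idealM.
have lamJ p c : ideal_set J (zpi s p - c%:MP * D) -> lam p = c.
  move=> Jc; apply/eqP; rewrite -subr_eq0; apply/eqP/uniq.
  have := idealB Jc (lamP p); rewrite opprB addrC addrA subrK.
  by rewrite -mulrBl -mpolyCB.
exists lam; split=> [c p q|p Jp|i p hp].
- apply: lamJ; rewrite linearP mpolyCD mpolyCM.
  have -> : c *: zpi s p + zpi s q - (c%:MP * (lam p)%:MP + (lam q)%:MP) * D =
    c%:MP * (zpi s p - (lam p)%:MP * D) + (zpi s q - (lam q)%:MP * D).
    by rewrite -mul_mpolyC; ring.
  by apply: idealD => //; apply: idealM.
- apply: lamJ; rewrite mpolyC0 mul0r subr0; exact: ideal_zpi ci_homogeneous _ _ Jp.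
have [|le] := ltP s i; first by move=> si _; apply: (above i).
have [m mE] : exists m : nat, m%:Z = s - i by exists `|s - i|%N; lia.
elim: m i p hp le mE => [|m IH] i p hp le mE lam0.
  have si : i = s by lia.
  have := lam0 1; rewrite mulr1 si subrr => /(_ (dhomog1 _ _)) lp.
  by have := lamP p; rewrite lp mpolyC0 mul0r subr0 -si zpi_id.
have next j : ideal_set J ('X_j * p).
  apply: (IH (1 + i)); [by apply: zhomogM => //; exact: zhomogX | lia | lia |].
  move=> q hq; rewrite mulrAC mulrC; apply: lam0.
  have -> : s - i = 1 + (s - (1 + i)) by ring.
  by apply: zhomogM => //; exact: zhomogX.
have [w hw Jw] := socle_h i p hp (next iz) (next it).
have w0 : w = 0.
  move: hw; have : i - s < 0 by lia.
  by case: (i - s) => // k _ /eqP.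
by move: Jw; rewrite w0 mul0r subr0.
Qed.

End CompleteIntersection.

Section GorensteinDual.
Variable K : fieldType.
Local Notation R := {mpoly K[4]}.
Variables (M : gradedModule K) (J : ideal R) (a s e : int) (lam : R -> K).
Hypothesis phi_iso : giso M (gshift (quotient_module J) a).
Hypothesis eE : e = s - (a + a).
Hypothesis lam_lin : forall c p q, lam (c *: p + q) = c * lam p + lam q.
Hypothesis lam_J : forall p, ideal_set J p -> lam p = 0.
Hypothesis lam_perfect : forall i p, zhomog i p ->
  (forall q, zhomog (s - i) q -> lam (p * q) = 0) -> ideal_set J p.

Lemma lam_congr p q : ideal_set J (p - q) -> lam p = lam q.
Proof.
by move=> /lam_J H; rewrite -[p](subrK q) -[p - q]scale1r lam_lin H mulr0 add0r.
Qed.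

(** Polynomials representing the elements of [M], compatible with the operations
    up to [J]: products of elements of arbitrary degrees can then be formed without
    transport along equalities of degrees. *)
Lemma module_lifts : exists rp : forall j, M j -> R,
  [/\ forall j m, zhomog (a + j) (rp j m),
      forall j c m m', ideal_set J (rp j (c *: m + m') - (c *: rp j m + rp j m')),
      forall j k b m, zhomog (k - j) b ->
        ideal_set J (rp k (gmul M j k b m) - b * rp j m),
      forall j m, ideal_set J (rp j m) -> m = 0 &
      forall j q, zhomog (a + j) q -> exists m, ideal_set J (rp j m - q)].
Proof.
have [phi [phi_bij phiE]] := phi_iso.
pose N := quotient_module J.
have NE i (u v : N i) : ideal_set J (subquot_repr u - subquot_repr v) -> u = v.
  move=> /ideal_predP H; rewrite -(subquot_reprK u) -(subquot_reprK v).
  by apply/subquot_classE; rewrite ?subquot_reprP.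
have NEcl i p : zhomog i p -> ideal_set J
    (subquot_repr (subquot_class (zhomog i : {pred R}) (ideal_pred J) p) - p).
  by move=> hp; apply/ideal_predP; apply: subquot_repr_class.
exists (fun j m => subquot_repr (phi j m)).
have hom j m : zhomog (a + j) (subquot_repr (phi j m)) by apply: subquot_reprP.
split=> //.
- move=> j c m m'; rewrite linearP.
  rewrite -{1}(subquot_reprK (phi j m)) -{1}(subquot_reprK (phi j m')).
  rewrite -subquot_classP ?subquot_reprP //; apply: NEcl.
  by apply: zhomogP; apply: hom.
- move=> j k b m hb; rewrite phiE //.
  rewrite -{1}(subquot_reprK (phi j m)).
  rewrite -[gmul _ j k b _]/(gmul N (a + j) (a + k) b _) quotient_mulE ?shift_degree //.
  apply: NEcl; rewrite -(subrK (a + j) (a + k)); apply: zhomogM => //.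
  by rewrite shift_degree.
- move=> j m Jm; apply: (bij_inj (phi_bij j)); rewrite raddf0.
  rewrite -(subquot_reprK (phi j m)).
  rewrite -[RHS](subquot_class0 (zhomog (a + j) : {pred R}) (ideal_pred J)).
  apply/subquot_classE; rewrite ?subquot_reprP ?subr0 //; first exact: zhomog0.
  exact/ideal_predP.
- move=> j q hq; have [g gK phiK] := phi_bij j.
  exists (g (subquot_class (zhomog (a + j) : {pred R}) (ideal_pred J) q)).
  by rewrite phiK; apply: NEcl.
Qed.

Lemma module_fin_span j : fin_span (M j).
Proof.
have [psi [psi_bij _]] := giso_sym phi_iso.
apply: (fin_span_onto (f := psi j)); last exact: quotient_fin_span.
by move=> w; have [g _ gK] := psi_bij j; exists (g w); rewrite gK.
Qed.

(** The pairing of [m] and [m'] is the value of [lam] at the product of their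
    lifts; the degrees [a + (e + j)] and [a - j] of the lifts add up to [s]. *)
Theorem gorenstein_dual : giso (gdual M) (gshift M e).
Proof.
apply: giso_sym; have [rp [rp_hom rp_lin rp_mul rp_inj rp_onto]] := module_lifts.
pose b j (m : M (e + j)) (m' : M (- j)) : K := lam (rp _ m * rp _ m').
have bl j c m1 m2 m' : b j (c *: m1 + m2) m' = c * b j m1 m' + b j m2 m'.
  rewrite /b -lam_lin; apply: lam_congr; rewrite scalerAl -mulrDl -mulrBl mulrC.
  exact: idealM.
have br j m c m1 m2 : b j m (c *: m1 + m2) = c * b j m m1 + b j m m2.
  rewrite /b -lam_lin; apply: lam_congr; rewrite scalerAr -mulrDr -mulrBr.
  exact: idealM.
have b_mul j k p m m' : zhomog (k - j) p ->
    b k (gmul M (e + j) (e + k) p m) m' = b j m (gmul M (- k) (- j) p m').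
  move=> hp; rewrite /b.
  rewrite (@lam_congr _ (p * rp _ m * rp _ m')); last first.
    by rewrite -mulrBl mulrC; apply: idealM; apply: rp_mul; rewrite shift_degree.
  symmetry; rewrite (@lam_congr _ (rp _ m * (p * rp _ m'))).
    by rewrite mulrCA mulrA.
  by rewrite -mulrBr; apply: idealM; apply: rp_mul; rewrite opprK addrC.
have b_lin j m : linear (b j m : M (- j) -> K^o).
  by move=> c u v; rewrite br.
pose th j m : dual_space (M (- j)) := DualSpace (introT (linear_formP _) (b_lin j m)).
have th_lin j : linear (th j).
  by move=> c u v; apply: dual_ext; apply/funext => m'; rewrite dual_valP; apply: bl.
pose thL j := projT1 (cid (linear_of (th_lin j))).
have thE j : thL j =1 th j := projT2 (cid (linear_of (th_lin j))).
exists thL; split=> [j|j k p m hp]; last first.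
  rewrite !thE; apply: dual_ext; rewrite gdual_mulE //.
  by apply/funext => m'; apply: b_mul.
have left_nd m : (forall m', b j m m' = 0) -> m = 0.
  move=> bm; apply: rp_inj; apply: (lam_perfect (rp_hom _ m)) => q.
  have -> : s - (a + (e + j)) = a + - j by rewrite eE; ring.
  move=> /rp_onto [m' hm'].
  rewrite -(bm m'); apply/esym/lam_congr; rewrite -mulrBr; exact: idealM.
have right_nd m' : (forall m, b j m m' = 0) -> m' = 0.
  move=> bm; apply: rp_inj; apply: (lam_perfect (rp_hom _ m')) => q.
  have -> : s - (a + - j) = a + (e + j) by rewrite eE; ring.
  move=> /rp_onto [m hm].
  rewrite -(bm m); apply/esym/lam_congr; rewrite mulrC -mulrBr; exact: idealM.
have inj : injective (thL j).
  move=> u v /eqP; rewrite -subr_eq0 -linearB thE => /eqP H.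
  apply/eqP; rewrite -subr_eq0; apply/eqP/left_nd => m'.
  by have := congr1 (fun f : dual_space _ => dual_val f m') H.
have /choice [g gP] : forall f, exists m, thL j m = f.
  move=> f; have [||m hm] := pairing_represents (f := f : _ -> K)
    (module_fin_span (- j)) (module_fin_span (e + j)) _ (br j) _ right_nd.
  - by move=> v c w w'; apply: bl.
  - by move=> c v v'; apply: dual_linear.
  by exists m; rewrite thE; apply: dual_ext; apply/funext.
by exists g => [m|f //]; apply: inj; rewrite gP.
Qed.

End GorensteinDual.

(** * The Hilbert function of the curve *)

Section Dimensions.
Variable K : fieldType.
Local Notation R := {mpoly K[4]}.
Local Notation H := (dhomog 4 K).

Lemma has_dim_quotient (V : vectType K) (Q : lmodType K) (f : {linear V -> Q})
    (U : {vspace V}) : (forall q, exists v, f v = q) ->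
  (forall v, f v = 0 <-> v \in U) -> has_dim Q (dim V - \dim U).
Proof.
move=> fs fker; pose W := (U^C)%VS; pose d := \dim W.
have dE : (dim V - \dim U)%N = d by rewrite /d dimv_compl dimvf.
rewrite dE; pose w : d.-tuple V := vbasis W.
pose r (c : 'rV[K]_d) := f (\sum_i c 0 i *: w`_i).
have rlin : linear r.
  move=> a c c'; rewrite /r -linearP; congr (f _).
  rewrite scaler_sumr -big_split; apply: eq_bigr => i _ /=.
  by rewrite !mxE scalerDl scalerA.
have [g gE] := linear_of rlin; exists g.
have inW (c : 'rV[K]_d) : \sum_i c 0 i *: w`_i \in W.
  apply: rpred_sum => i _; apply: rpredZ; apply: vbasis_mem.
  by rewrite mem_nth ?size_tuple.
have inj : injective g.
  move=> c c'; rewrite !gE => /eqP; rewrite -subr_eq0 -raddfB /= => /eqP /fker mU.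
  have : \sum_i c 0 i *: w`_i - \sum_i c' 0 i *: w`_i \in (U :&: W)%VS.
    by rewrite memv_cap mU rpredB.
  rewrite capv_compl memv0 subr_eq0 => /eqP E.
  apply/rowP => i; have /freeP fr := basis_free (vbasisP W).
  apply/eqP; rewrite -subr_eq0; apply/eqP.
  apply: (fr (fun i => c 0 i - c' 0 i)) => //.
  rewrite -[RHS](subrr (\sum_i c' 0 i *: w`_i)) -{1}E -sumrB.
  by apply: eq_bigr => j _; rewrite scalerBl.
have /choice [k kP] : forall q, exists c, g c = q.
  move=> q; have [v vq] := fs q.
  have : v \in (U + W)%VS by rewrite addv_complf memvf.
  move=> /memv_addP [u uU [v' v'W vE]].
  exists (\row_i coord w i v'); rewrite gE /r -vq vE raddfD /=.
  have /fker -> := uU; rewrite add0r; congr (f _).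
  by rewrite {2}(coord_vbasis v'W); apply: eq_bigr => i _; rewrite mxE.
by exists k => [c|q //]; apply: inj; rewrite kP.
Qed.

Lemma lfun_of (V W : vectType K) (f : V -> W) : linear f ->
  exists g : 'Hom(V, W), forall v, g v = f v.
Proof.
by move=> hf; have [g gE] := linear_of hf; exists (linfun g) => v; rewrite lfunE gE.
Qed.

Lemma mul_lfun (f : R) d m n : f \is d.-homog -> n = (d + m)%N ->
  exists T : 'Hom(H m, H n), forall p, val (T p) = f * val p.
Proof.
move=> hf ->.
have hT (p : H m) : f * val p \is (d + m).-homog.
  by apply: dhomogM => //; apply: dhomog_is_dhomog.
have [|T TE] := @lfun_of (H m) (H (d + m)) (fun p => DHomog (hT p)).
  by move=> c p q; apply: val_inj; rewrite /= mulrDr scalerAr.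
by exists T => p; rewrite TE.
Qed.

Lemma kill_lfun i n : exists E : 'End(H n), forall p, val (E p) = kill i (val p).
Proof.
have hE (p : H n) : kill i (val p) \is n.-homog.
  by apply: (@kill_homog _ i n); apply: dhomog_is_dhomog.
have [|E EE] := @lfun_of (H n) (H n) (fun p => DHomog (hE p)).
  by move=> c p q; apply: val_inj; rewrite /= killD killZ.
by exists E => p; rewrite EE.
Qed.

Lemma dim_mul_image (f : R) d m n (U : {vspace H m}) : f != 0 ->
  f \is d.-homog -> n = (d + m)%N ->
  exists W : {vspace H n}, \dim W = \dim U /\
    forall p, p \in W <-> exists2 u, u \in U & val p = f * val u.
Proof.
move=> f0 hf nE; have [T TE] := mul_lfun hf nE.
exists (T @: U)%VS; split.
  apply: limg_dim_eq; apply/eqP; rewrite -subv0; apply/subvP => u.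
  rewrite memv_cap memv_ker memv0 => /andP[_ /eqP Tu].
  have := TE u; rewrite Tu => /esym/eqP.
  rewrite linear0 mulf_eq0 (negbTE f0) /= => /eqP u0.
  by apply/eqP/val_inj.
move=> p; split=> [/memv_imgP [u uU ->]|[u uU E]]; first by exists u.
by apply/memv_imgP; exists u => //; apply: val_inj; rewrite TE.
Qed.

Lemma dim_H m : \dim {:H m} = 'C(m + 3, 3).
Proof. by rewrite dimvf -[LHS]/'C(m + 3, m) -bin_sub ?leq_addr // addKn. Qed.

(** Setting [X_i] to zero projects the forms onto those in which [X_i] does not
    occur, with kernel the multiples of [X_i]. *)
Lemma dim_killed i m : exists U : {vspace H m.+1}, \dim U = 'C(m + 3, 2) /\
  forall p, p \in U <-> kill i (val p) = val p.
Proof.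
have [E EE] := kill_lfun i m.+1; exists (limg E); split.
  have [W [Wdim WP]] :=
    @dim_mul_image 'X_i 1 m m.+1 fullv (X_neq0 _ _) (zhomogX _ _) erefl.
  have kerE : lker E = W.
    apply/vspaceP => p; apply/idP/idP; rewrite memv_ker.
      move=> /eqP Ep; apply/WP.
      have [q pE] := kill_ex i (val p).
      have {}pE : val p = 'X_i * q by rewrite pE -EE Ep add0r.
      have hq : pihomog mdeg m q \is m.-homog by apply: pihomogP.
      exists (DHomog hq); rewrite ?memvf //= -/(zpi m%:Z q).
      have -> : m%:Z = m.+1%:Z - 1 by lia.
      by rewrite -(zpiM_sub _ _ (zhomogX _ _)) -pE zpi_id //; apply: dhomog_is_dhomog.
    move=> /WP [u _ pE]; apply/eqP/val_inj.
    by rewrite EE pE killM killX eqxx mul0r linear0.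
  have := limg_ker_dim E fullv; rewrite capfv kerE Wdim !dim_H.
  have -> : (m.+1 + 3 = (m + 3).+1)%N by [].
  rewrite (binS (m + 3) 2) => /eqP; rewrite eqn_add2l => /eqP //.
move=> p; split=> [/memv_imgP [u _ ->]|pE]; first by rewrite EE killK.
by apply/memv_imgP; exists p; rewrite ?memvf //; apply: val_inj; rewrite EE.
Qed.

Lemma dim_killed2 i j m : i != j -> exists U : {vspace H m.+2},
  \dim U = (m + 3)%N /\
  forall p, p \in U <-> kill i (val p) = val p /\ kill j (val p) = val p.
Proof.
move=> ij; have [U1 [U1dim U1P]] := dim_killed j m.+1.
have [U0 [U0dim U0P]] := dim_killed j m.
have [E EE] := kill_lfun i m.+2; exists (E @: U1)%VS; split.
  have [W [Wdim WP]] :=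
    @dim_mul_image 'X_i 1 m.+1 m.+2 U0 (X_neq0 _ _) (zhomogX _ _) erefl.
  have kerE : (U1 :&: lker E)%VS = W.
    apply/vspaceP => p; apply/idP/idP; rewrite memv_cap memv_ker.
      move=> /andP[/U1P pj /eqP Ep]; apply/WP.
      have [q pE] := kill_ex i (val p).
      have {}pE : val p = 'X_i * kill j q.
        rewrite -[LHS]pj pE -EE Ep killD killM killX (negbTE ij).
        by rewrite linear0 kill0 add0r.
      have hq : pihomog mdeg m.+1 (kill j q) \is m.+1.-homog by apply: pihomogP.
      have {}hqE : val p = 'X_i * pihomog mdeg m.+1 (kill j q).
        rewrite -/(zpi m.+1%:Z (kill j q)).
        have -> : m.+1%:Z = m.+2%:Z - 1 by lia.
        by rewrite -(zpiM_sub _ _ (zhomogX _ _)) -pE zpi_id //; apply: dhomog_is_dhomog.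
      exists (DHomog hq) => //; apply/U0P => /=.
      apply: (mulfI (X_neq0 K i)); rewrite -hqE -[RHS]pj hqE killM killX.
      by rewrite (negbTE ij).
    move=> /WP [u /U0P uj pE]; apply/andP; split.
      by apply/U1P; rewrite pE killM killX (negbTE ij) uj.
    by apply/eqP/val_inj; rewrite EE pE killM killX eqxx mul0r linear0.
  have := limg_ker_dim E U1; rewrite kerE Wdim U1dim U0dim.
  have -> : (m.+1 + 3 = (m + 3).+1)%N by [].
  by rewrite (binS (m + 3) 1) bin1 => /eqP; rewrite eqn_add2l => /eqP.
move=> p; split=> [/memv_imgP [u /U1P uj ->]|[pi_ pj]].
  by rewrite EE killK killC uj.
by apply/memv_imgP; exists p; [apply/U1P | apply: val_inj; rewrite EE].
Qed.

End Dimensions.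

Section HilbertFunction.
Variable K : fieldType.
Local Notation R := {mpoly K[4]}.
Local Notation H := (dhomog 4 K).
Local Notation x := ('X_ix : R).
Local Notation y := ('X_iy : R).
Local Notation ex := (kill ix).
Local Notation ey := (kill iy).
Variables h F G A B : R.
Hypotheses (hx : ex h = h) (hy : ey h = h) (Fx : ex F = F) (Fy : ey F = F).
Hypotheses (Gx : ex G = G) (Gy : ey G = G) (Ay : ey A = A) (Bx : ex B = B).
Local Notation g := (plane_eqn ix h F A).
Local Notation k := (plane_eqn iy h G B).
Local Notation q := (link_eqn h F G A B).
Hypotheses (g0 : g != 0) (k0 : k != 0) (G0 : G != 0).
Local Notation I := (gen_ideal (curve_generators h F G A B)).
Variables dg dk dq : nat.
Hypotheses (g_homog : g \is dg.-homog) (k_homog : k \is dk.-homog).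
Hypothesis (q_homog : q \is dq.-homog).

(** Modulo the relations [x * q = x * y * B * F + x * g * G] and
    [y * q = x * y * A * G + y * k * F], the coefficients of the generators can
    be freed of superfluous variables. *)
Lemma curve_ideal_normal v : ideal_set I v -> exists p u1 u2 u3,
  [/\ v = (x * y) * p + (x * g) * u1 + (y * k) * u2 + q * u3,
      ey u1 = u1, ex u2 = u2, ex u3 = u3 & ey u3 = u3].
Proof.
move=> /curve_idealP [e1 [e2 [e3 [e4 ->]]]].
have [r2 e4E] := kill_ex iy e4; have [r1 e4E'] := kill_ex ix (ey e4).
have [s1 E2] := kill_ex iy (e2 + r1 * G); have [s2 E3] := kill_ex ix (e3 + r2 * F).
exists (e1 + r1 * B * F + r2 * A * G + g * s1 + k * s2),
  (ey (e2 + r1 * G)), (ex (e3 + r2 * F)), (ex (ey e4)).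
split; rewrite ?killK // ?[ey (ex _)]killC ?killK //.
rewrite {1}e4E {1}e4E'.
transitivity ((x * y) * (e1 + r1 * B * F + r2 * A * G) + (x * g) * (e2 + r1 * G)
   + (y * k) * (e3 + r2 * F) + q * ex (ey e4)).
  by rewrite link_eqn.unlock plane_eqn.unlock; ring.
by rewrite {1}E2 {1}E3; ring.
Qed.

(** The four summands of [curve_ideal_normal] are in direct sum, as one sees by
    restricting to the planes [x = 0] and [y = 0]. *)
Lemma curve_ideal_dim n m0 m1 m2 m3 :
  n = (2 + m0)%N -> n = (1 + dg + m1.+1)%N -> n = (1 + dk + m2.+1)%N ->
  n = (dq + m3.+2)%N ->
  exists W : {vspace H n}, (forall p, p \in W <-> ideal_set I (val p)) /\
    \dim W = ('C(m0 + 3, 3) + 'C(m1 + 3, 2) + 'C(m2 + 3, 2) + (m3 + 3))%N.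
Proof.
move=> n0 n1 n2 n3.
have z0 : n%:Z - 2 = m0%:Z by lia.
have z1 : n%:Z - (1 + dg)%N%:Z = m1.+1%:Z by lia.
have z2 : n%:Z - (1 + dk)%N%:Z = m2.+1%:Z by lia.
have z3 : n%:Z - dq%:Z = m3.+2%:Z by lia.
have [Uy [Uy_dim UyP]] := dim_killed K iy m1.
have [Ux [Ux_dim UxP]] := dim_killed K ix m2.
have [U [U_dim UP]] := @dim_killed2 K ix iy m3 isT.
have Xh i : ('X_i : R) \is 1.-homog := zhomogX K i.
have X0 := X_neq0 K.
have q0 : q != 0.
  apply: contra_neq g0 => q0; have := ey_q B hy Fy Gy Ay.
  by rewrite q0 kill0 => /esym/eqP; rewrite mulf_eq0 (negbTE G0) orbF => /eqP.
have xy0 : x * y != 0 by rewrite mulf_neq0.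
have xg0 : x * g != 0 by rewrite mulf_neq0.
have yk0 : y * k != 0 by rewrite mulf_neq0.
have xyh : x * y \is 2.-homog := dhomogM (Xh ix) (Xh iy).
have xgh : x * g \is (1 + dg).-homog := dhomogM (Xh ix) g_homog.
have ykh : y * k \is (1 + dk).-homog := dhomogM (Xh iy) k_homog.
have [W0 [W0_dim W0P]] := dim_mul_image fullv xy0 xyh n0.
have [W1 [W1_dim W1P]] := dim_mul_image Uy xg0 xgh n1.
have [W2 [W2_dim W2P]] := dim_mul_image Ux yk0 ykh n2.
have [W3 [W3_dim W3P]] := dim_mul_image U q0 q_homog n3.
have varE : (ex x = 0) * (ex y = y) * (ey x = x) * (ey y = 0) by rewrite !killX.
have eyg := ey_g hy Fy Ay; have exk := ex_k hx Gx Bx.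
have eyq := ey_q B hy Fy Gy Ay.
have vD (p p' : H n) : val (p + p') = val p + val p' by [].
have d01 : (W0 :&: W1 = 0)%VS.
  apply/eqP; rewrite -subv0; apply/subvP => v; rewrite memv_cap memv0.
  move=> /andP[/W0P [p _ E] /W1P [u1 /UyP u1y E1]]; apply/eqP/val_inj.
  have := congr1 ey E; rewrite E1 !killM !varE eyg u1y mulr0 mul0r => -> //.
have d012 : ((W0 + W1) :&: W2 = 0)%VS.
  apply/eqP; rewrite -subv0; apply/subvP => v; rewrite memv_cap memv0.
  move=> /andP[/memv_addP [v0 /W0P [p _ E0] [v1 /W1P [u1 _ E1] vE]]].
  move=> /W2P [u2 /UxP u2x E2]; apply/eqP/val_inj.
  have := congr1 ex E2; rewrite {1}vE vD E0 E1 E2 !(killD, killM) !varE exk u2x.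
  by rewrite !mul0r add0r => <-.
have d0123 : ((W0 + W1 + W2) :&: W3 = 0)%VS.
  apply/eqP; rewrite -subv0; apply/subvP => v; rewrite memv_cap memv0.
  move=> /andP[/memv_addP [v01
    /memv_addP [v0 /W0P [p _ E0] [v1 /W1P [u1 /UyP u1y E1] v01E]]
    [v2 /W2P [u2 _ E2] vE]]].
  move=> /W3P [u3 /UP [u3x u3y] E3]; apply/eqP/val_inj; rewrite E3.
  have E : g * (x * val u1) = g * (G * val u3).
    have := congr1 ey E3; rewrite {1}vE vD v01E vD E0 E1 E2 !(killD, killM).
    rewrite !varE eyg eyq u1y u3y => E; transitivity (x * g * val u1); first ring.
    transitivity (g * G * val u3); last ring.
    by rewrite -E; ring.
  have /eqP := congr1 ex (mulfI g0 E); rewrite !killM varE mul0r Gx u3x eq_sym.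
  by rewrite mulf_eq0 (negbTE G0) /= => /eqP ->; rewrite mulr0.
exists (W0 + W1 + W2 + W3)%VS; split; last first.
  rewrite !dimv_disjoint_sum // W0_dim W1_dim W2_dim W3_dim.
  by rewrite dim_H Uy_dim Ux_dim U_dim.
move=> v; split.
  move=> /memv_addP [v012 /memv_addP [v01 /memv_addP [v0 /W0P [p _ E0]
    [v1 /W1P [u1 _ E1] v01E]] [v2 /W2P [u2 _ E2] v012E]] [v3 /W3P [u3 _ E3] vE]].
  apply/curve_idealP; exists (val p), (val u1), (val u2), (val u3).
  by rewrite vE v012E v01E !vD E0 E1 E2 E3; ring.
have vh : zhomog n (val v) by apply: dhomog_is_dhomog.
move=> /curve_ideal_normal [p [u1 [u2 [u3 [vE u1y u2x u3x u3y]]]]].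
have hp m (r : R) : pihomog mdeg m r \is m.-homog by apply: pihomogP.
have {}vE : val v = (x * y) * zpi m0 p + (x * g) * zpi m1.+1 u1 +
    (y * k) * zpi m2.+1 u2 + q * zpi m3.+2 u3.
  have := congr1 (zpi n) vE; rewrite (zpi_id vh) !zpiD.
  rewrite (zpiM_sub n p (xyh : zhomog 2 _)).
  rewrite (zpiM_sub n u1 (xgh : zhomog (1 + dg)%N _)).
  rewrite (zpiM_sub n u2 (ykh : zhomog (1 + dk)%N _)).
  rewrite (zpiM_sub n u3 (q_homog : zhomog dq _)).
  by rewrite z0 z1 z2 z3.
pose P0 : H m0 := DHomog (hp m0 p); pose P1 : H m1.+1 := DHomog (hp m1.+1 u1).
pose P2 : H m2.+1 := DHomog (hp m2.+1 u2); pose P3 : H m3.+2 := DHomog (hp m3.+2 u3).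
have h0 : x * y * val P0 \is n.-homog by rewrite n0; exact: (dhomogM xyh (hp m0 p)).
have h1 : x * g * val P1 \is n.-homog by rewrite n1; exact: (dhomogM xgh (hp m1.+1 u1)).
have h2 : y * k * val P2 \is n.-homog by rewrite n2; exact: (dhomogM ykh (hp m2.+1 u2)).
have h3 : q * val P3 \is n.-homog by rewrite n3; exact: (dhomogM q_homog (hp m3.+2 u3)).
have -> : v = DHomog h0 + DHomog h1 + DHomog h2 + DHomog h3 by apply: val_inj.
apply: memv_add; [apply: memv_add; [apply: memv_add|]|].
- by apply/W0P; exists P0; rewrite ?memvf.
- apply/W1P; exists P1 => //; apply/UyP.
  by rewrite -[val P1]/(zpi m1.+1 u1) -zpi_kill u1y.
- apply/W2P; exists P2 => //; apply/UxP.
  by rewrite -[val P2]/(zpi m2.+1 u2) -zpi_kill u2x.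
- apply/W3P; exists P3 => //; apply/UP; rewrite -[val P3]/(zpi m3.+2 u3) -!zpi_kill.
  by rewrite u3x u3y.
Qed.

Lemma bin2_double m : 2%:Z * 'C(m, 2)%:Z = m%:Z * (m%:Z - 1).
Proof.
elim: m => [|m IH]; first by rewrite bin0n.
by rewrite (binS m 1) bin1 PoszD mulrDr IH intS; ring.
Qed.

(** The Hilbert function is [(n + 1) ^ 2], that of the two planes, minus the
    dimensions of the last three summands of the ideal. *)
Lemma curve_hilbert : exists (e : int) (n0 : nat), forall n : nat, (n0 <= n)%N ->
  exists2 r : nat, has_dim (quotient_module I n%:Z) r &
    r%:Z = (dg + dk)%N%:Z * n%:Z + e.
Proof.
exists (dq%:Z - 'C(dg, 2)%:Z - 'C(dk, 2)%:Z), (dg + dk + dq + 4)%N => n hn.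
pose m0 := (n - 2)%N; pose m1 := (n - dg - 2)%N; pose m2 := (n - dk - 2)%N.
pose m3 := (n - dq - 2)%N.
have [||||W [WP W_dim]] := @curve_ideal_dim n m0 m1 m2 m3; [lia|lia|lia|lia|].
have [f [fker fonto]] := quotient_map I n.
have fW p : f p = 0 <-> p \in W.
  by split=> [/fker/WP|/WP/fker].
exists (dim (H n) - \dim W)%N; first exact: (has_dim_quotient fonto fW).
have Wle : (\dim W <= dim (H n))%N by rewrite -dimvf dimvS ?subvf.
rewrite -subzn // W_dim -dimvf dim_H.
have -> : 'C(n + 3, 3) = ('C(m0 + 3, 3) + 'C(m0 + 3, 2) + 'C(m0 + 4, 2))%N.
  have -> : (n + 3 = (m0 + 3).+2)%N by lia.
  by rewrite (binS (m0 + 3).+1 2) (binS (m0 + 3) 2) [(m0 + 4)%N]addnS.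
have E0 := bin2_double (m0 + 3); have E0' := bin2_double (m0 + 4).
have E1 := bin2_double (m1 + 3); have E2 := bin2_double (m2 + 3).
have Ea := bin2_double dg; have Eb := bin2_double dk.
have M0 : m0%:Z = n%:Z - 2 by lia.
have M1 : m1%:Z = n%:Z - dg%:Z - 2 by lia.
have M2 : m2%:Z = n%:Z - dk%:Z - 2 by lia.
have M3 : m3%:Z = n%:Z - dq%:Z - 2 by lia.
move: E0 E0' E1 E2; rewrite !PoszD M0 M1 M2 M3 => E0 E0' E1 E2.
apply: (@mulfI _ 2%:Z) => //.
move: E0 E0' E1 E2 Ea Eb; move: 'C(m0 + 3, 3)%:Z 'C(m0 + 3, 2)%:Z 'C(m0 + 4, 2)%:Z
  'C(m1 + 3, 2)%:Z 'C(m2 + 3, 2)%:Z 'C(dg, 2)%:Z 'C(dk, 2)%:Z.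
move=> t0 t1 t2 t3 t4 t5 t6 E0 E0' E1 E2 Ea Eb.
transitivity (2 * t1 + 2 * t2 - 2 * t3 - 2 * t4 - 2 * (n%:Z - dq%:Z + 1)).
  by ring.
rewrite E0 E0' E1 E2 !mulrDr !mulrN Ea Eb; ring.
Qed.

End HilbertFunction.

(** * Degrees of the equations, and the theorem *)

Lemma pdeg_gt0 (K : fieldType) (p : {mpoly K[4]}) :
  p \is homog mdeg -> (forall c : K, p <> c%:MP) -> 0 < pdeg p.
Proof.
move=> /homogZ; rewrite /pdeg; case: (msize p).-1 => [|//] /zhomog0C [c pE] /(_ c).
by rewrite pE.
Qed.

Section CurveDegrees.
Variable K : fieldType.
Local Notation R := {mpoly K[4]}.
Local Notation x := ('X_ix : R).
Local Notation y := ('X_iy : R).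
Local Notation ex := (kill ix).
Local Notation ey := (kill iy).
Variables h F G A B : R.
Hypotheses (hx : ex h = h) (hy : ey h = h) (Fx : ex F = F) (Fy : ey F = F).
Hypotheses (Gx : ex G = G) (Gy : ey G = G) (Ay : ey A = A) (Bx : ex B = B).
Local Notation g := (plane_eqn ix h F A).
Local Notation k := (plane_eqn iy h G B).
Local Notation q := (link_eqn h F G A B).
Local Notation dh := (formal_degree h F A).
Hypotheses (hh : h \is homog mdeg) (Fh : F \is homog mdeg) (Gh : G \is homog mdeg).
Hypotheses (Ah : A \is homog mdeg) (F0 : F != 0) (G0 : G != 0).
Hypothesis AB0 : h = 0 -> A * B <> 0.
Hypothesis gens_homog :
  forall u, u \in curve_generators h F G A B -> u \is homog mdeg.

Lemma plane_eqns_neq0 : g != 0 /\ k != 0.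
Proof.
split; apply/eqP => E.
  have h0 : h = 0.
    have /eqP := congr1 ex E; rewrite (ex_g A hx Fx) kill0 mulf_eq0 (negbTE F0) orbF.
    by move=> /eqP.
  apply: (AB0 h0); move/eqP: E; rewrite plane_eqn.unlock h0 mul0r addr0 mulf_eq0.
  by rewrite (negbTE (X_neq0 _ _)) => /eqP ->; rewrite mul0r.
have h0 : h = 0.
  have /eqP := congr1 ey E; rewrite (ey_k B hy Gy) kill0 mulf_eq0 (negbTE G0) orbF.
  by move=> /eqP.
apply: (AB0 h0); move/eqP: E; rewrite plane_eqn.unlock h0 mul0r addr0 mulf_eq0.
by rewrite (negbTE (X_neq0 _ _)) => /eqP ->; rewrite mulr0.
Qed.

Lemma homog_zhomog (p : R) : p \is homog mdeg -> exists d, zhomog d p.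
Proof. by move=> /homogP [d hd]; exists d%:Z. Qed.

Lemma h_degree : zhomog dh h.
Proof.
rewrite /formal_degree; case: eqVneq => [->|_]; first exact: zhomog0.
exact: homogZ.
Qed.

(** The degree of [k] is obtained from that of [g] through [q], whose
    restrictions to the two planes are [g * G] and [k * F]; this also covers
    [h = 0], where the formal degree is defined by [A] alone. *)
Lemma curve_degrees :
  [/\ zhomog (dh + pdeg F) g, zhomog (dh + pdeg G) k,
      zhomog (dh + pdeg F + pdeg G) q & zhomog (dh + pdeg G) (y * B)].
Proof.
have [g0 k0] := plane_eqns_neq0.
have plane_homog i (H C : R) : ('X_i ^+ 2 * C + 'X_i * h * H) \is homog mdeg ->
    exists d, zhomog d (plane_eqn i h H C).
  move=> /homog_zhomog [d].
  have -> : 'X_i ^+ 2 * C + 'X_i * h * H = 'X_i * plane_eqn i h H C.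
    by rewrite plane_eqn.unlock; ring.
  by move=> /(zhomog_cancel (X_neq0 _ _) (zhomogX _ _)); exists (d - 1).
have [D gD] : exists d, zhomog d g.
  by apply: plane_homog; apply: gens_homog; rewrite !inE eqxx orbT.
have [D' kD'] : exists d, zhomog d k.
  by apply: plane_homog; apply: gens_homog; rewrite !inE eqxx !orbT.
have [E qE] : exists d, zhomog d q.
  by apply: homog_zhomog; apply: gens_homog; rewrite link_eqn.unlock !inE eqxx !orbT.
have FZ := homogZ Fh; have GZ := homogZ Gh.
have gG : D + pdeg G = E.
  have gG0 : g * G != 0 by rewrite mulf_neq0.
  apply: (zhomog_uniq gG0); first exact: zhomogM.
  by rewrite -(ey_q B hy Fy Gy Ay); apply: kill_homog.
have kF : D' + pdeg F = E.
  have kF0 : k * F != 0 by rewrite mulf_neq0.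
  apply: (zhomog_uniq kF0); first exact: zhomogM.
  by rewrite -(ex_q A hx Fx Gx Bx); apply: kill_homog.
have DE : D = dh + pdeg F.
  have [h0|h0] := eqVneq h 0.
    rewrite /formal_degree h0 eqxx subrK addrC.
    have gE : g = x * A by rewrite plane_eqn.unlock h0 mul0r addr0.
    apply: (zhomog_uniq g0 gD); rewrite gE; apply: zhomogM; first exact: zhomogX.
    exact: homogZ.
  have hF0 : h * F != 0 by rewrite mulf_neq0.
  apply: (zhomog_uniq hF0); last by apply: zhomogM => //; exact: h_degree.
  by rewrite -(ex_g A hx Fx); apply: kill_homog.
have D'E : D' = dh + pdeg G.
  by apply: (addIr (pdeg F)); rewrite kF -gG DE addrAC.
rewrite -DE -D'E; split=> //; first by rewrite gG.
have -> : y * B = k - h * G by rewrite plane_eqn.unlock addrK.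
apply: zhomogB => //; rewrite D'E; apply: zhomogM => //; exact: h_degree.
Qed.

End CurveDegrees.

Theorem corollary2p4 (K : closedFieldType) (C : closedSubscheme K)
    (h F G A B : {mpoly K[4]}) :
  is_curve C ->
  gen_ideal [:: 'X_ix * 'X_iy : {mpoly K[4]}] `<=` C ->
  ~ arithmetically_CM C ->
  poly_in [:: iz; it] h -> poly_in [:: iz; it] F -> poly_in [:: iz; it] G ->
  poly_in [:: ix; iz; it] A -> poly_in [:: iy; iz; it] B ->
  h \is homog mdeg -> F \is homog mdeg -> G \is homog mdeg ->
  A \is homog mdeg -> B \is homog mdeg ->
  (forall c : K, F <> c%:MP) -> (forall c : K, G <> c%:MP) ->
  (h = 0 -> A * B <> 0) ->
  (forall g, g \in curve_generators h F G A B -> g \is homog mdeg) ->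
  ideal_set C = gen_ideal (curve_generators h F G A B) ->
  let d_h := formal_degree h F A in
  let d := 2 * d_h + pdeg F + pdeg G in
  let M := hartshorne_rao C in
  [/\ has_degree C d,
      giso M (gshift (quotient_module (gen_ideal [:: 'X_ix; 'X_iy; F; G])) (- d_h)),
      self_dual M &
      giso (gdual M) (gshift M (d - 2))].
Proof.
move=> C_curve _ _ h_in F_in G_in A_in B_in hh Fh Gh Ah _ Fnc Gnc AB0 gens_homog CE.
move=> d_h d M.
have hx := poly_in_kill h_in (isT : ix \notin [:: iz; it]).
have hy := poly_in_kill h_in (isT : iy \notin [:: iz; it]).
have Fx := poly_in_kill F_in (isT : ix \notin [:: iz; it]).
have Fy := poly_in_kill F_in (isT : iy \notin [:: iz; it]).
have Gx := poly_in_kill G_in (isT : ix \notin [:: iz; it]).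
have Gy := poly_in_kill G_in (isT : iy \notin [:: iz; it]).
have Ay := poly_in_kill A_in (isT : iy \notin [:: ix; iz; it]).
have Bx := poly_in_kill B_in (isT : ix \notin [:: iy; iz; it]).
have F0 : F != 0 by apply/eqP => F0; apply: (Fnc 0); rewrite mpolyC0.
have G0 : G != 0 by apply/eqP => G0; apply: (Gnc 0); rewrite mpolyC0.
have dF_gt0 := pdeg_gt0 Fh Fnc; have dG_gt0 := pdeg_gt0 Gh Gnc.
have [g0 k0] := plane_eqns_neq0 hx hy Fx Gy F0 G0 AB0.
have [g_homog k_homog q_homog yB_homog] :=
  curve_degrees hx hy Fx Fy Gx Gy Ay Bx hh Fh Gh Ah F0 G0 AB0 gens_homog.
have h_homog : zhomog d_h h := h_degree F A hh.
have FZ := homogZ Fh; have GZ := homogZ Gh.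
have [n [al [be bezout]]] := curve_bezout hy Fx Fy Gx Gy Ay F_in G_in Fh Gh g0 G0
  q_homog C_curve CE.
have FG := regular_pair_of_bezout F0 bezout.
have CI := ideal_eq CE.
have I_homog : homogeneous_ideal (gen_ideal (curve_generators h F G A B)).
  by rewrite -CI; apply: subscheme_homog.
have M_iso : giso M
    (gshift (quotient_module (gen_ideal [:: 'X_ix; 'X_iy; F; G])) (- d_h)).
  rewrite /M /hartshorne_rao CI.
  exact: (hartshorne_rao_quotient hx hy Fx Fy Gx Gy Ay Bx g0 k0 F0 FG I_homog
    h_homog FZ GZ g_homog yB_homog bezout).
have M_dual : giso (gdual M) (gshift M (d - 2)).
  have Fe : kill ix (kill iy F) = F by rewrite Fy.
  have Ge : kill ix (kill iy G) = G by rewrite Gy.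
  have [lam [lam_lin lam_J lam_perfect]] :=
    gorenstein_functional Fe Ge FZ GZ dF_gt0 dG_gt0 F0 FG bezout.
  apply: (gorenstein_dual M_iso _ lam_lin lam_J lam_perfect).
  by rewrite /d; ring.
split=> //; last by exists (d - 2).
rewrite /has_degree /coordinate_ring CI.
have [dg gE] : exists dg : nat, d_h + pdeg F = dg.
  case: (d_h + pdeg F) g_homog => [dg _|dg /= /eqP g00]; first by exists dg.
  by rewrite g00 eqxx in g0.
have [dk kE] : exists dk : nat, d_h + pdeg G = dk.
  case: (d_h + pdeg G) k_homog => [dk _|dk /= /eqP k00]; first by exists dk.
  by rewrite k00 eqxx in k0.
have [dq qE] : exists dq : nat, d_h + pdeg F + pdeg G = dq.
  by exists (dg + (msize G).-1)%N; rewrite gE.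
rewrite -/d_h gE in g_homog; rewrite -/d_h kE in k_homog; rewrite -/d_h qE in q_homog.
have -> : d = (dg + dk)%N%:Z by rewrite PoszD -gE -kE /d; ring.
exact: (curve_hilbert hx hy Fy Gx Gy Ay Bx g0 k0 G0 g_homog k_homog q_homog).
Qed.
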